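(* Let $\lambda\in\mathbb{N}$ be a security parameter, let $n=n(\lambda)$, let $\Pi_{\mathsf{OSM}}$ be a one-shot message authentication code (OSMAC) scheme with message space $\{0,1\}^{\ell(\lambda)}$, and let $\Pi_{\mathsf{UTE}}$ be the untelegraphable encryption scheme built from $\Pi_{\mathsf{OSM}}$ by the MAC-chain construction with length parameter $n$ (defined in the context). Suppose $n=\Omega(\log\lambda)$, $n=o(\lambda)$, and $\Pi_{\mathsf{OSM}}$ satisfies two-signature security for adversaries that run in time $2^n\cdot\mathrm{poly}(\lambda)$ and have advantage at most $2^{-n^2}$ (i.e. every such adversary has advantage at most $2^{-n^2}$). Then $\Pi_{\mathsf{UTE}}$ satisfies one-time indistinguishability security in the classical oracle model.
   Context: QPT means quantum polynomial time; $x\xleftarrow{R}X$ denotes uniform sampling; $\mathrm{negl}$ is a negligible function; $\epsilon$ denotes the empty string. OSMAC. A tuple of QPT algorithms: $\mathsf{Setup}(1^\lambda)\to(\mathsf{pp},\mathsf{mvk})$; $\mathsf{KeyGen}(\mathsf{pp})\to(|\mathsf{sk}\rangle,\mathsf{vk})$ with quantum signing key and classical verification key; $\mathsf{Sign}(|\mathsf{sk}\rangle,m)\to\sigma$; $\mathsf{Vrfy}(\mathsf{pp},\mathsf{mvk},\mathsf{vk},m,\sigma)\to\{0,1\}$. Correctness: honest signatures under honestly generated keys verify with probability $1-\mathrm{negl}(\lambda)$. Two-signature security: the advantage of an adversary $\mathcal{A}$ is the probability, over $(\mathsf{pp},\mathsf{mvk})\leftarrow\mathsf{Setup}(1^\lambda)$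 and $(\mathsf{vk},m_0,\sigma_0,m_1,\sigma_1)\leftarrow\mathcal{A}(\mathsf{pp})$, that $m_0\ne m_1$ and $\mathsf{Vrfy}(\mathsf{pp},\mathsf{mvk},\mathsf{vk},m_c,\sigma_c)=1$ for both $c\in\{0,1\}$; (standard) two-signature security says it is negligible for all QPT $\mathcal{A}$. Classical oracle model: algorithms can efficiently generate a black-box oracle for any classical function with polynomial-size description; other parties (including adversaries in both stages) given the oracle have only quantum oracle access to it. MAC-chain construction (separate encryption/decryption keys, message space $\{\mathcal{M}_\lambda\}$). For $r\in\{0,1\}^n$ let $V_r=\{\epsilon,r[1],r[1,2],\dots,r[1,n-1],r\}$ be the set of all prefixes of $r$. The message space $\{0,1\}^{\ell}$ of the OSMAC is large enough to contain (encodings of) concatenations of two verification keys and strings in $\{0,1\}^{n+\lambda}$. - $\mathsf{Gen}(1^\lambda)$: $s\xleftarrow{R}\{0,1\}^{n+\lambda}$, $(\mathsf{pp},\mathsf{mvk})\leftarrow\mathsf{OSM.Setup}(1^\lambda)$; output $\mathsf{ek}=(\mathsf{pp},\mathsf{mvk},s)$, $\mathsf{dk}=s$. - $\mathsf{Enc}(\mathsf{ek},m)$: $(|\mathsf{sk}_\epsilon\rangle,\mathsf{vk}_\epsilon)\leftarrow\mathsf{OSM.KeyGen}(\mathsf{pp})$; generate the classical oracle $\mathcal{O}_{\mathsf{ek},m,\mathsf{vk}_\epsilon}$ which on input $s'\in\{0,1\}^{n+\lambda}$, $r\in\{0,1\}^n$, $\{\mathsf{st}_v\}_{v\in V_r}$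 parses $\mathsf{st}_\epsilon=(\mathsf{vk}_0,\mathsf{vk}_1,\sigma_\epsilon)$, $\mathsf{st}_v=(\mathsf{vk}_v,\mathsf{vk}_{v\|0},\mathsf{vk}_{v\|1},\sigma_v)$ for $v\in V_r\setminus\{\epsilon,r\}$, $\mathsf{st}_r=(\mathsf{vk}_r,\sigma_r)$ (keys occurring in several tuples must agree) and outputs $m$ if $s'=s$, $\mathsf{OSM.Vrfy}(\mathsf{pp},\mathsf{mvk},\mathsf{vk}_v,\mathsf{vk}_{v\|0}\|\mathsf{vk}_{v\|1},\sigma_v)=1$ for all $v\in V_r\setminus\{r\}$, and $\mathsf{OSM.Vrfy}(\mathsf{pp},\mathsf{mvk},\mathsf{vk}_r,s',\sigma_r)=1$; otherwise it outputs $\bot$. Output $(|\mathsf{sk}_\epsilon\rangle,\mathcal{O}_{\mathsf{ek},m,\mathsf{vk}_\epsilon},\mathsf{pp})$. - $\mathsf{Dec}(\mathsf{dk},(|\mathsf{sk}_\epsilon\rangle,\mathcal{O},\mathsf{pp}))$: sample OSMAC key pairs for every $v\in V_{0^n}\setminus\{\epsilon\}$ and for each such $v$ with its last bit flipped; set $\sigma_v\leftarrow\mathsf{OSM.Sign}(|\mathsf{sk}_v\rangle,\mathsf{vk}_{v\|0}\|\mathsf{vk}_{v\|1})$ for $v\in V_{0^n}\setminus\{0^n\}$ and $\sigma_{0^n}\leftarrow\mathsf{OSM.Sign}(|\mathsf{sk}_{0^n}\rangle,\mathsf{dk})$; form the tuples $\mathsf{st}_v$ and output $\mathcal{O}(\mathsf{dk},0^n,\{\mathsf{st}_v\}_{v\in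 V_{0^n}})$. One-time indistinguishability security of a UTE scheme: in the game with bit $b$, $\mathcal{A}$ outputs $m_0,m_1$; the challenger samples $(\mathsf{ek},\mathsf{dk})$ and gives one encryption of $m_b$ to $\mathcal{A}$; $\mathcal{A}$ outputs a classical string $\mathsf{st}$; $\mathcal{B}$ receives $\mathsf{st}$ and $\mathsf{dk}$ and outputs $b_{\mathcal{B}}$ (both stages may query oracles contained in the ciphertext). Security: $|\Pr[b_{\mathcal{B}}=1\mid b=0]-\Pr[b_{\mathcal{B}}=1\mid b=1]|=\mathrm{negl}(\lambda)$ for all QPT $(\mathcal{A},\mathcal{B})$. *)

(* Defs.v *)
From HB Require Import structures.
From mathcomp Require Import all_boot all_order all_algebra.
From mathcomp Require Import complex.
From mathcomp Require Import all_classical all_reals all_analysis.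

Set Implicit Arguments.
Unset Strict Implicit.
Unset Printing Implicit Defensive.

Import Order.TTheory GRing.Theory Num.Theory numFieldNormedType.Exports.

Local Open Scope ring_scope.
Local Open Scope classical_set_scope.

Notation bits := (seq bool).

(** * Quantum states and quantum processes

   One global register is shared by all the parties; qubits are named by their
   index in it, and a party can only act on the qubits whose names it holds.
   A pure state of [nq] qubits is given by its amplitudes on bit strings of
   size [nq]; the values of [amp] elsewhere are irrelevant. *)

Record qstate (R : realType) := QState { nq : nat; amp : bits -> R[i] }.

Definition qinit (R : realType) : qstate R := QState 0 (fun=> 1).

Definition sqmod (R : realType) (z : R[i]) : R :=
  complex.Re z ^+ 2 + complex.Im z ^+ 2.

Definition sqnorm (R : realType) (psi : qstate R) : R :=
  \sum_(b : (nq psi).-tuple bool) sqmod (amp psi b).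

Definition scale (R : realType) (a : R[i]) (psi : qstate R) : qstate R :=
  QState (nq psi) (fun b => a * amp psi b).

(* Adjoins the qubit number [nq psi] in state |0>. *)
Definition fresh (R : realType) (psi : qstate R) : qstate R :=
  QState (nq psi).+1
    (fun b => if nth false b (nq psi) then 0 else amp psi (take (nq psi) b)).

Definition gate1 (R : realType) (u : bool -> bool -> R[i]) (i : nat)
    (psi : qstate R) : qstate R :=
  QState (nq psi)
    (fun b => \sum_(c : bool) u (nth false b i) c * amp psi (set_nth false b i c)).

Definition hadamard (R : realType) (a c : bool) : R[i] :=
  Complex ((-1) ^+ (a && c) / Num.sqrt 2) 0.

Definition tgate (R : realType) (a c : bool) : R[i] :=
  if a == c then (if a then Complex (Num.sqrt 2)^-1 (Num.sqrt 2)^-1 else 1) else 0.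

Definition read (xs : seq nat) (b : bits) : bits := [seq nth false b i | i <- xs].

(* Adds [v], padded with zeros or truncated to the size of [ys], to the
   positions [ys] of [b]. *)
Definition xor_at (ys : seq nat) (v b : bits) : bits :=
  mkseq (fun i => nth false b i (+) ((i \in ys) && nth false v (index i ys)))
        (size b).

(* |x>|y> |-> |x>|y (+) f x>; for [f := id] and one-qubit registers, CNOT. *)
Definition xor_query (R : realType) (f : bits -> bits) (xs ys : seq nat)
    (psi : qstate R) : qstate R :=
  QState (nq psi) (fun b => amp psi (xor_at ys (f (read xs b)) b)).

Definition project (R : realType) (i : nat) (c : bool) (psi : qstate R) :
    qstate R :=
  QState (nq psi) (fun b => if nth false b i == c then amp psi b else 0).

(* A process maps a state to the list of its possible outcomes, each with the
   corresponding unnormalized state, whose squared norm is the probability of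
   the outcome. *)
Definition qproc (R : realType) (X : Type) := qstate R -> seq (X * qstate R).

Definition ret (R : realType) (X : Type) (x : X) : qproc R X :=
  fun psi => [:: (x, psi)].

Definition bind (R : realType) (X Y : Type) (p : qproc R X)
    (k : X -> qproc R Y) : qproc R Y :=
  fun psi => flatten [seq k o.1 o.2 | o <- p psi].

Notation "'let*' x ':=' p 'in' k" := (bind p (fun x => k))
  (at level 200, x binder, right associativity,
   format "'[v' 'let*'  x  ':='  p  'in' '/' k ']'").

Definition apply (R : realType) (X : Type) (g : qstate R -> qstate R) (x : X) :
  qproc R X := fun psi => [:: (x, g psi)].

Definition uniform (R : realType) (k : nat) : qproc R bits :=
  fun psi => [seq (tval s, scale (Complex (Num.sqrt (2 ^+ k))^-1 0) psi)
             | s <- enum {: k.-tuple bool}].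

Arguments uniform : clear implicits.

Definition Pr (R : realType) (p : qproc R bool) : R :=
  \sum_(o <- p (qinit R) | o.1) sqnorm o.2.

(** * Quantum algorithms

   A program acts on classical stacks of bits and quantum stacks of (names of)
   qubits, both indexed by nat. *)

Inductive instr : Type :=
| Push of nat & bool
| Pop of nat
| Case of nat & seq instr & seq instr & seq instr
    (* [Case a c1 c0 ce]: top of the classical stack [a] is 1 / is 0 / [a] is
       empty; the stack is left unchanged. *)
| While of nat & seq instr   (* while the top of the stack is 1 *)
| New of nat                 (* pushes a fresh qubit |0> *)
| Move of nat & nat          (* moves the top qubit to another stack *)
| Had of nat                 (* Had, Tee, Cnot act on top qubits *)
| Tee of nat
| Cnot of nat & nat
| Meas of nat & nat          (* pops and measures the top qubit; pushes the
                                outcome on a classical stack *)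
| Query of nat & nat.        (* oracle call; the input and output registers are
                                whole quantum stacks *)

Notation prog := (seq instr).

Record mem := Mem { cl : nat -> bits; qu : nat -> seq nat }.

Definition upd (T : Type) (g : nat -> T) (i : nat) (v : T) : nat -> T :=
  fun j => if j == i then v else g j.

Definition setcl (m : mem) (a : nat) (v : bits) := Mem (upd (cl m) a v) (qu m).
Definition setqu (m : mem) (x : nat) (v : seq nat) := Mem (cl m) (upd (qu m) x v).

(* One step; the returned program is to be executed before the continuation.
   Instructions whose operands are missing, or which would use one qubit
   twice, have no effect. *)
Definition step (R : realType) (f : bits -> bits) (i : instr) (m : mem) :
    qproc R (prog * mem) :=
  match i with
  | Push a b => ret ([::], setcl m a (b :: cl m a))
  | Pop a => ret ([::], setcl m a (behead (cl m a)))
  | Case a c1 c0 ce =>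
      ret (match cl m a with
           | true :: _ => c1 | false :: _ => c0 | [::] => ce
           end, m)
  | While a c => ret (if head false (cl m a) then rcons c i else [::], m)
  | New x => fun psi =>
      [:: (([::], setqu m x (nq psi :: qu m x)), fresh psi)]
  | Move x y =>
      if qu m x is q :: qs then
        let m' := setqu m x qs in ret ([::], setqu m' y (q :: qu m' y))
      else ret ([::], m)
  | Had x =>
      if qu m x is q :: _ then apply (gate1 (@hadamard R) q) ([::], m)
      else ret ([::], m)
  | Tee x =>
      if qu m x is q :: _ then apply (gate1 (@tgate R) q) ([::], m)
      else ret ([::], m)
  | Cnot x y =>
      match x == y, qu m x, qu m y with
      | false, q :: _, q' :: _ => apply (xor_query id [:: q] [:: q']) ([::], m)
      | _, _, _ => ret ([::], m)
      end
  | Meas x a =>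
      if qu m x is q :: qs then fun psi =>
        [seq (([::], setcl (setqu m x qs) a (c :: cl m a)), project q c psi)
        | c <- [:: false; true]]
      else ret ([::], m)
  | Query x y =>
      if x == y then ret ([::], m)
      else apply (xor_query f (qu m x) (qu m y)) ([::], m)
  end.

(* Runs [c] with oracle [f] for at most [t] steps. *)
Fixpoint exec (R : realType) (f : bits -> bits) (t : nat) (c : prog) (m : mem) :
    qproc R mem :=
  match t, c with
  | t'.+1, i :: c' => let* o := step f i m in exec f t' (o.1 ++ c') o.2
  | _, _ => ret m
  end.

Definition no_oracle : bits -> bits := fun=> [::].

(* Classical inputs are on the classical stacks 0, 1, ..., a quantum input on
   the quantum stack 0; same convention for outputs. *)
Definition load (xs : seq bits) (q : seq nat) : mem :=
  Mem (fun i => nth [::] xs i) (fun i => if i == 0%N then q else [::]).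

Definition poly_clock (c lam : nat) : nat := (lam ^ c + c)%N.

Definition poly_bounded (g : nat -> nat) : Prop :=
  exists c, forall lam, (g lam <= poly_clock c lam)%N.

(* A QPT algorithm: a single program, for all security parameters, together
   with a polynomial clock. *)
Record qpt := QPT { code : prog; clock : nat }.

Definition run (R : realType) (f : bits -> bits) (A : qpt) (lam : nat) (m : mem) :
  qproc R mem := exec f (poly_clock (clock A) lam) (code A) m.

Definition one_pow (lam : nat) : bits := nseq lam true.

Definition negl (R : realType) (g : nat -> R) : Prop :=
  forall c : nat, \forall lam \near \oo, `|g lam| <= (lam%:R ^+ c)^-1.

(** * One-shot message authentication codes

   The message space is {0,1}^(msglen lam); verification keys and signatures
   are strings of lengths [vklen lam] and [siglen lam]. *)

Record osmac := OSMAC {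
  Setup : qpt; KeyGen : qpt; Sign : qpt; Vrfy : qpt;
  msglen : nat -> nat; vklen : nat -> nat; siglen : nat -> nat }.

(* Contents of a register of [k] cells. *)
Definition pad (k : nat) (s : bits) : bits := take k (s ++ nseq k false).

Section OSMAC.
Context (R : realType) (S : osmac) (lam : nat).

Definition setup : qproc R (bits * bits) :=
  let* m := run no_oracle (Setup S) lam (load [:: one_pow lam] [::]) in
  ret (cl m 0%N, cl m 1%N).

Definition keygen (pp : bits) : qproc R (seq nat * bits) :=
  let* m := run no_oracle (KeyGen S) lam (load [:: one_pow lam; pp] [::]) in
  ret (qu m 0%N, pad (vklen S lam) (cl m 0%N)).

Definition sign (sk : seq nat) (msg : bits) : qproc R bits :=
  let* m := run no_oracle (Sign S) lam (load [:: one_pow lam; msg] sk) in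
  ret (pad (siglen S lam) (cl m 0%N)).

Definition vrfy_prob (pp mvk vk msg sigma : bits) : R :=
  Pr (let* m := run no_oracle (Vrfy S) lam
                  (load [:: one_pow lam; pp; mvk; vk; msg; sigma] [::]) in
      ret (head false (cl m 0%N))).

Definition verify (pp mvk vk msg sigma : bits) : bool :=
  vrfy_prob pp mvk vk msg sigma == 1.

Definition honest_game (msg : bits) : qproc R bool :=
  let* p := setup in
  let* k := keygen p.1 in
  let* sigma := sign k.1 msg in
  ret (verify p.1 p.2 k.2 msg sigma).

(* The adversary [A] is run for [t] steps. *)
Definition two_sig_game (A : prog) (t : nat) : qproc R bool :=
  let* p := setup in
  let* m := exec no_oracle t A (load [:: one_pow lam; p.1] [::]) in
  let vk := cl m 0%N in
  let m0 := cl m 1%N in let sigma0 := cl m 2%N in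
  let m1 := cl m 3%N in let sigma1 := cl m 4%N in
  ret [&& size m0 == msglen S lam, size m1 == msglen S lam, m0 != m1,
          verify p.1 p.2 vk m0 sigma0 & verify p.1 p.2 vk m1 sigma1].

End OSMAC.

Arguments setup : clear implicits.
Arguments keygen : clear implicits.
Arguments sign : clear implicits.
Arguments verify : clear implicits.
Arguments vrfy_prob : clear implicits.
Arguments honest_game : clear implicits.
Arguments two_sig_game : clear implicits.

(* Verification answers each query deterministically, so that it can be
   performed by a classical oracle. *)
Definition vrfy_deterministic (R : realType) (S : osmac) : Prop :=
  forall lam pp mvk vk msg sigma,
    vrfy_prob R S lam pp mvk vk msg sigma = 0 \/
    vrfy_prob R S lam pp mvk vk msg sigma = 1.

Definition osmac_correct (R : realType) (S : osmac) : Prop :=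
  exists2 eps : nat -> R, negl eps &
    forall lam msg, size msg = msglen S lam ->
      1 - eps lam <= Pr (honest_game R S lam msg).

Definition is_osmac (R : realType) (S : osmac) : Prop :=
  [/\ poly_bounded (msglen S), poly_bounded (vklen S), poly_bounded (siglen S),
      vrfy_deterministic R S & osmac_correct R S].

(* Adversaries of running time T(lam) * poly(lam) have advantage at most
   delta(lam), for all large enough lam. *)
Definition two_sig_secure (R : realType) (S : osmac) (T : nat -> nat)
    (delta : nat -> R) : Prop :=
  forall (A : prog) (c : nat), \forall lam \near \oo,
    Pr (two_sig_game R S lam A (T lam * poly_clock c lam)) <= delta lam.

(** * Untelegraphable encryption in the classical oracle model *)

(* A ciphertext consists of qubits, a classical string, and a classical
   function accessible as an oracle only. *)
Record ciphertext := Ciphertext {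
  ct_qubits : seq nat; ct_oracle : bits -> bits; ct_bits : bits }.

Record ute (R : realType) := UTE {
  ute_ek : Type;
  ute_msg : nat -> pred bits;
  ute_gen : nat -> qproc R (ute_ek * bits);
  ute_enc : nat -> ute_ek -> bits -> qproc R ciphertext;
  ute_dec : nat -> bits -> ciphertext -> qproc R (option bits) }.

Arguments ute_msg {R} u.
Arguments ute_gen {R} u.
Arguments ute_enc {R} u.
Arguments ute_dec {R} u.

(* [A1] and [A2] are the two phases of the first adversary; the memory of [A1]
   is kept by [A2], except for the stacks 0, which receive the ciphertext. *)
Definition ute_game (R : realType) (U : ute R) (A1 A2 B : qpt) (lam : nat)
    (b : bool) : qproc R bool :=
  let* mA := run no_oracle A1 lam (load [:: one_pow lam] [::]) in
  let m0 := cl mA 0%N in let m1 := cl mA 1%N in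
  if ute_msg U lam m0 && ute_msg U lam m1 then
    let* k := ute_gen U lam in
    let* ct := ute_enc U lam k.1 (if b then m1 else m0) in
    let* mA' := run (ct_oracle ct) A2 lam
                  (setqu (setcl mA 0 (ct_bits ct)) 0 (ct_qubits ct)) in
    let st := cl mA' 0%N in
    let* mB := run (ct_oracle ct) B lam (load [:: one_pow lam; st; k.2] [::]) in
    ret (head false (cl mB 0%N))
  else ret false.

Definition one_time_ind (R : realType) (U : ute R) : Prop :=
  forall A1 A2 B : qpt,
    negl (fun lam => `|Pr (ute_game U A1 A2 B lam false)
                       - Pr (ute_game U A1 A2 B lam true)|).

(** * The MAC-chain construction *)

Section MacChain.
Context (R : realType) (n : nat -> nat) (S : osmac).

(* Field lengths of the tuple st_v of the prefix v of length i: vk_v (unless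
   v is the root), the keys of the two children (unless v is the leaf), and
   the signature. *)
Definition st_shape (lam i : nat) : seq nat :=
  nseq (i != 0%N) (vklen S lam)
  ++ nseq (if (i < n lam)%N then 2 else 0) (vklen S lam)
  ++ [:: siglen S lam].

(* Field lengths of an oracle input: s', r, then the n+1 tuples. *)
Definition input_shape (lam : nat) : seq nat :=
  [:: (n lam + lam)%N, n lam
    & [seq sumn (st_shape lam i) | i <- iota 0 (n lam).+1]].

Definition mac_oracle (lam : nat) (pp mvk s msg vk0 : bits) (u : bits) : bits :=
  let fields := reshape (input_shape lam) u in
  let s' := nth [::] fields 0 in
  let r := nth [::] fields 1 in
  let st i := reshape (st_shape lam i) (nth [::] fields i.+2) in
  let key i := if i == 0%N then vk0 else nth [::] (st i) 0 in
  let left i := nth [::] (st i) (i != 0%N) in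
  let right i := nth [::] (st i) (i != 0%N).+1 in
  let sigma i := last [::] (st i) in
  if [&& size u == sumn (input_shape lam),
         s' == s,
         all (fun i => key i.+1 == if nth false r i then right i else left i)
             (iota 0 (n lam)),
         all (fun i => verify R S lam pp mvk (key i)
                         (pad (msglen S lam) (left i ++ right i)) (sigma i))
             (iota 0 (n lam))
       & verify R S lam pp mvk (key (n lam)) (pad (msglen S lam) s')
           (sigma (n lam))]
  then true :: msg else nseq (size msg).+1 false.

Definition mac_gen (lam : nat) : qproc R ((bits * bits * bits) * bits) :=
  let* s := uniform R (n lam + lam) in
  let* p := setup R S lam in
  ret ((p.1, p.2, s), s).

Definition mac_enc (lam : nat) (ek : bits * bits * bits) (msg : bits) :
    qproc R ciphertext :=
  let: (pp, mvk, s) := ek in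
  let* k := keygen R S lam pp in
  ret (Ciphertext k.1 (mac_oracle lam pp mvk s msg k.2) pp).

(* The tuples st_v, each flattened, for the last [k].+1 prefixes v of 0^n;
   [own] is the key field of the first one and [sk] its signing key. *)
Fixpoint mac_chain_sign (lam : nat) (pp dk : bits) (k : nat) (own : bits)
    (sk : seq nat) : qproc R (seq bits) :=
  if k is k'.+1 then
    let* k0 := keygen R S lam pp in
    let* k1 := keygen R S lam pp in
    let* sigma := sign R S lam sk (pad (msglen S lam) (k0.2 ++ k1.2)) in
    let* sts := mac_chain_sign lam pp dk k' k0.2 k0.1 in
    ret ((own ++ k0.2 ++ k1.2 ++ sigma) :: sts)
  else
    let* sigma := sign R S lam sk (pad (msglen S lam) dk) in
    ret [:: own ++ sigma].

Definition mac_dec (lam : nat) (dk : bits) (ct : ciphertext) :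
    qproc R (option bits) :=
  let* sts := mac_chain_sign lam (ct_bits ct) dk (n lam) [::] (ct_qubits ct) in
  let y := ct_oracle ct (dk ++ nseq (n lam) false ++ flatten sts) in
  ret (if y is true :: msg then Some msg else None).

Definition mac_chain (M : nat -> pred bits) : ute R :=
  UTE M mac_gen mac_enc mac_dec.

End MacChain.

Arguments mac_chain : clear implicits.

(* Main.v *)
(** Let [L := n lam + lam]. The adversary's view is compared with the same game
   in which the ciphertext oracle rejects everything; rejecting queries act as
   the identity, so by a hybrid argument the gap is controlled by the total mass
   that the queries of that second game put on accepted inputs. That
   game uses the key [s] only as an input of the second stage, so [s] can be
   drawn after the first adversary has finished, and each query of the first
   stage hits [s] with mass at most [2 ^ - L]. For the second stage fix a step [t], let [p] be
   the probability that measuring its [t]-th query yields an accepted input, and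
   run it twice on the same [st], with independent keys [s1] and [s2]: by
   Cauchy-Schwarz, both measured inputs are accepted and have the same [r] with
   probability at least [2 ^ - n * p ^ 2], and [s1 = s2] has probability
   [2 ^ - L] only. Two accepted chains with the same root and the same path [r]
   that sign distinct leaves contain two signatures of distinct messages under
   one key, so [p ^ 2 <= 2 ^ n * (2 ^ - n ^ 2 * poly lam + 2 ^ - L)], which is
   negligible as [2 ^ n] dominates a positive power of [lam].

   The reduction is a single program for all security parameters. Instead of
   computing the lengths, clocks and positions that depend on [lam], it guesses
   them, with a distribution giving the number [k] probability of order
   [1 / k ^ 2]; this costs a polynomial factor only. *)

Require Import Defs.
From mathcomp Require Import all_boot all_order all_algebra.
From mathcomp Require Import complex.
From mathcomp Require Import all_classical all_reals all_analysis.
From mathcomp Require Import zify ring lra.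
Import Defs.

Set Implicit Arguments.
Unset Strict Implicit.
Unset Printing Implicit Defensive.

Import Order.TTheory GRing.Theory Num.Theory numFieldNormedType.Exports.

Local Open Scope ring_scope.

(** * Quantum states *)

(** The second stage receives a classical string and no qubits. A party without qubits treats the
    whole register as a spectator, so its behaviour depends on the state only through the squared
    norm. This fact lets the second stage be run twice on one [st], lets Setup commute with the
    first adversary, and reduces a run on a large register to one on the empty register.

    Distances are kept squared throughout: squared distances add over measurement outcomes, norms do
    not. The price is the slack [eta], chosen last as a quarter of the target bound.

    Cauchy-Schwarz is applied for a fixed outcome of the first stage, while security speaks of an
    average over these outcomes. The square is therefore replaced by its tangent at [ka], which is
    affine and can be averaged before [ka] is chosen.

    The reduction makes 42 guesses: 8 to lay out its inputs, 10 to prepare the two runs, and 4 for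
    each of the 6 substrings that form its output. *)

Section States.
Context (R : realType).
Implicit Types (psi phi : qstate R) (z : R[i]).

Lemma sqmod_ge0 z : 0 <= sqmod z.
Proof. by rewrite /sqmod addr_ge0 ?sqr_ge0. Qed.

Lemma sqmod0 : sqmod (0 : R[i]) = 0.
Proof. by rewrite /sqmod /= expr0n addr0. Qed.

Lemma sqmodM z z' : sqmod (z * z') = sqmod z * sqmod z'.
Proof. by case: z z' => [a b] [c d]; rewrite /sqmod /=; ring. Qed.

Lemma sqmod_real (x : R) : sqmod (Complex x 0) = x ^+ 2.
Proof. by rewrite /sqmod /= expr0n addr0. Qed.

Lemma amgm (eta u v : R) : 0 < eta ->
  `|2 * u * v| <= eta * u ^+ 2 + eta^-1 * v ^+ 2.
Proof.
move=> e0; rewrite ler_norml -subr_ge0 opprK -[X in _ && X]subr_ge0.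
have -> : eta * u ^+ 2 + eta^-1 * v ^+ 2 - 2 * u * v = eta^-1 * (eta * u - v) ^+ 2.
  by field; rewrite gt_eqF.
have -> : 2 * u * v + (eta * u ^+ 2 + eta^-1 * v ^+ 2) = eta^-1 * (eta * u + v) ^+ 2.
  by field; rewrite gt_eqF.
by apply/andP; split; rewrite mulr_ge0 ?sqr_ge0 // invr_ge0 ltW.
Qed.

(** Expand [z] as [z' + (z - z')] and split the cross term by [amgm]. This compares acceptance
    probabilities at the end of two runs. *)
Lemma le_sqmod_sub (eta : R) z z' : 0 < eta ->
  `|sqmod z - sqmod z'| <= eta * sqmod z' + (1 + eta^-1) * sqmod (z - z').
Proof.
move=> e0; case: z z' => [a b] [c d]; rewrite /sqmod /=.
have := amgm c (a - c) e0; have := amgm d (b - d) e0.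
have := sqr_ge0 (a - c); have := sqr_ge0 (b - d).
rewrite !ler_norml => h1 h2 /andP[h3 h4] /andP[h5 h6]; apply/andP; split; lra.
Qed.

(** The free weight [k] is what makes an induction over [t] steps lose a factor linear in [t]
    instead of exponential. *)
Lemma le_sqmod_add3 (k : R) z y x : 0 < k ->
  sqmod (x - z) <= (1 + k^-1) * sqmod (x - y) + (1 + k) * sqmod (y - z).
Proof.
move=> k0; case: z y x => [a b] [c d] [e f]; rewrite /sqmod /=.
have := amgm (c - a) (e - c) k0; have := amgm (d - b) (f - d) k0.
rewrite !ler_norml => /andP[h3 h4] /andP[h5 h6]; lra.
Qed.

Lemma le_sqmod_sub2 z z' : sqmod (z - z') <= 2 * sqmod z + 2 * sqmod z'.
Proof.
case: z z' => [a b] [c d]; rewrite /sqmod /=.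
by have := sqr_ge0 (a + c); have := sqr_ge0 (b + d); nra.
Qed.

Lemma sum_bits_cat m n (F : bits -> R) :
  \sum_(b : (m + n).-tuple bool) F b =
  \sum_(a : m.-tuple bool) \sum_(b : n.-tuple bool) F (a ++ b).
Proof.
rewrite pair_big /=.
pose h (p : m.-tuple bool * n.-tuple bool) := cat_tuple p.1 p.2.
have sz (b : (m + n).-tuple bool) : size (take m b) == m.
  by rewrite size_takel // size_tuple leq_addr.
have sz' (b : (m + n).-tuple bool) : size (drop m b) == n.
  by rewrite size_drop size_tuple addKn.
rewrite (reindex h) //=; exists (fun b => (Tuple (sz b), Tuple (sz' b))) => [[a b] _|b _].
  by congr pair; apply: val_inj; rewrite /= (take_size_cat, drop_size_cat) ?size_tuple.
by apply: val_inj; rewrite /= cat_take_drop.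
Qed.

Lemma sum_bits_reindex n (h : bits -> bits) (F : bits -> R) :
  (forall b, size b = n -> size (h b) = n /\ h (h b) = b) ->
  \sum_(b : n.-tuple bool) F b = \sum_(b : n.-tuple bool) F (h b).
Proof.
move=> hP; have sz (b : n.-tuple bool) : size (h b) == n.
  by apply/eqP; case: (hP b (size_tuple b)).
rewrite (reindex (fun b => Tuple (sz b))) //=.
by exists (fun b => Tuple (sz b)) => b _; apply: val_inj => /=;
  case: (hP b (size_tuple b)).
Qed.

Lemma sum_bits0 (F : bits -> R) : \sum_(b : 0.-tuple bool) F b = F [::].
Proof.
rewrite (bigD1 [tuple]) //= big1 ?addr0 // => b; rewrite tuple0 => /eqP.
by case.
Qed.

Lemma sum_bits1 (F : bits -> R) :
  \sum_(b : 1.-tuple bool) F b = F [:: false] + F [:: true].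
Proof.
rewrite (bigD1 [tuple false]) //= (bigD1 [tuple true]) //= big1 ?addr0 // => b.
case/tupleP: b => x b; rewrite tuple0 => /andP[/eqP h1 /eqP h2].
by exfalso; case: x h1 h2.
Qed.

Lemma nth_setn (b : bits) i c j :
  nth false (set_nth false b i c) j = if j == i then c else nth false b j.
Proof. by rewrite nth_set_nth. Qed.

Lemma size_setn (b : bits) i c : (i < size b)%N -> size (set_nth false b i c) = size b.
Proof. by move=> h; rewrite size_set_nth; apply/maxn_idPr. Qed.

Lemma set_nth_same (b : bits) i c d :
  set_nth false (set_nth false b i c) i d = set_nth false b i d.
Proof. by rewrite set_set_nth eqxx. Qed.

(** Adding the sum to its image under flipping bit [i] pairs the two values of that bit, without
    splitting strings around position [i]. *)
Lemma sum_bits_flip n i (F : bits -> R) : (i < n)%N ->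
  (\sum_(b : n.-tuple bool) F b) *+ 2 =
  \sum_(b : n.-tuple bool) (F (set_nth false b i false) + F (set_nth false b i true)).
Proof.
move=> lin; pose h b := set_nth false b i (~~ nth false b i).
have hP b : size b = n -> size (h b) = n /\ h (h b) = b.
  move=> sb; have e : size (h b) = n by rewrite size_set_nth sb; apply/maxn_idPr.
  split=> //; apply: (@eq_from_nth _ false); rewrite ?size_set_nth ?e ?sb.
    by rewrite !(maxn_idPr _).
  by move=> j _; rewrite /h !nth_setn eqxx negbK; case: (j =P i) => [->|].
rewrite mulr2n [in X in _ + X](sum_bits_reindex _ hP) -big_split /=.
apply: eq_bigr => b _; have e : F b = F (set_nth false b i (nth false b i)).
  congr F; apply: (@eq_from_nth _ false); rewrite ?size_set_nth ?size_tuple.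
    by apply/esym/maxn_idPr.
  by move=> j _; rewrite nth_setn; case: eqP => // ->.
by rewrite [X in X + _]e /h; case: (nth false b i) => //=; rewrite addrC.
Qed.

Definition qsub psi phi : qstate R := QState (nq psi) (fun b => amp psi b - amp phi b).

(** Expectation of [g] at the outcome of a hypothetical measurement of the qubits [xs]; the state is
    unnormalized and is not disturbed. *)
Definition mass (g : bits -> R) (xs : seq nat) psi : R :=
  \sum_(b : (nq psi).-tuple bool) g (read xs b) * sqmod (amp psi b).

Lemma sqnorm_ge0 psi : 0 <= sqnorm psi.
Proof. by apply: sumr_ge0 => b _; apply: sqmod_ge0. Qed.

Lemma sqnorm_mass psi : sqnorm psi = mass (fun=> 1) [::] psi.
Proof. by apply: eq_bigr => b _; rewrite mul1r. Qed.

Definition unitary2 (u : bool -> bool -> R[i]) := forall x y : R[i],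
  sqmod (u false false * x + u false true * y) +
  sqmod (u true false * x + u true true * y) = sqmod x + sqmod y.

Lemma sqrt2_sq : (Num.sqrt 2 : R)^-1 * (Num.sqrt 2)^-1 = 2^-1.
Proof. by rewrite -invfM -expr2 sqr_sqrtr. Qed.

Lemma hadamard_unitary : unitary2 (@hadamard R).
Proof.
move=> [a b] [c d]; rewrite /sqmod /hadamard /= ?expr0 ?expr1.
have e := sqrt2_sq; set r := (Num.sqrt 2)^-1 in e *.
transitivity ((r * r) * 2 * (a ^+ 2 + b ^+ 2 + c ^+ 2 + d ^+ 2)); first by ring.
by rewrite e; field.
Qed.

Lemma tgate_unitary : unitary2 (@tgate R).
Proof.
move=> [a b] [c d]; rewrite /sqmod /tgate /=.
have e := sqrt2_sq; set r := (Num.sqrt 2)^-1 in e *.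
transitivity (a ^+ 2 + b ^+ 2 + (r * r) * 2 * (c ^+ 2 + d ^+ 2)); first by ring.
by rewrite e; field.
Qed.

Lemma sqnorm_gate1 u i psi : unitary2 u -> (i < nq psi)%N ->
  sqnorm (gate1 u i psi) = sqnorm psi.
Proof.
move=> uu li; have inj2 (x y : R) : x *+ 2 = y *+ 2 -> x = y by move=> h; lra.
apply: inj2; rewrite /sqnorm /=.
rewrite (sum_bits_flip (fun b => sqmod (\sum_(c : bool) u (nth false b i) c *
    amp psi (set_nth false b i c))) li) (sum_bits_flip (fun b => sqmod (amp psi b)) li).
apply: eq_bigr => b _; rewrite !big_bool /= !nth_setn eqxx !set_nth_same.
by rewrite ![u _ true * _ + _]addrC uu.
Qed.

Lemma sqnorm_fresh psi : sqnorm (fresh psi) = sqnorm psi.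
Proof.
rewrite /sqnorm /= -addn1 (sum_bits_cat _ _ (fun b => sqmod (if nth false b (nq psi) then 0
  else amp psi (take (nq psi) b)))); apply: eq_bigr => b _.
rewrite (sum_bits1 (fun c => sqmod (if nth false (b ++ c) (nq psi) then 0
  else amp psi (take (nq psi) (b ++ c))))) !nth_cat size_tuple ltnn subnn /=.
by rewrite sqmod0 addr0 take_size_cat ?size_tuple.
Qed.

Lemma mass_project g xs i psi :
  mass g xs (project i false psi) + mass g xs (project i true psi) = mass g xs psi.
Proof.
rewrite /mass -big_split; apply: eq_bigr => b _ /=.
by case: (nth false b i); rewrite /= sqmod0 mulr0 ?addr0 ?add0r.
Qed.

Lemma sqnorm_project i psi :
  sqnorm (project i false psi) + sqnorm (project i true psi) = sqnorm psi.
Proof. by rewrite !sqnorm_mass; apply: mass_project. Qed.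

Lemma size_xor_at ys v b : size (xor_at ys v b) = size b.
Proof. by rewrite size_mkseq. Qed.

Lemma nth_xor_at ys v b i : nth false (xor_at ys v b) i =
  (i < size b)%N && (nth false b i (+) ((i \in ys) && nth false v (index i ys))).
Proof.
case: ltnP => h; first by rewrite nth_mkseq.
by rewrite nth_default // size_xor_at.
Qed.

Lemma read_xor_at (xs ys : seq nat) v b :
  (forall q, q \in xs -> q \in ys -> False) -> {in xs, forall q, (q < size b)%N} ->
  read xs (xor_at ys v b) = read xs b.
Proof.
move=> dis bd; apply/eq_in_map => q qx; rewrite nth_xor_at bd //=.
by case: (boolP (q \in ys)) => [/(dis _ qx)//|_]; rewrite addbF.
Qed.

(** The query permutes the basis states and, as [ys] avoids [xs], leaves the contents of [xs] alone.
    The permutation is an involution since xoring twice cancels. *)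
Lemma mass_xor_query g f xs ys psi :
  (forall q, q \in xs -> q \in ys -> False) -> {in xs, forall q, (q < nq psi)%N} ->
  mass g xs (xor_query f xs ys psi) = mass g xs psi.
Proof.
move=> dis bd; rewrite /mass /=; pose h b := xor_at ys (f (read xs b)) b.
have hr b : size b = nq psi -> read xs (h b) = read xs b.
  by move=> sb; apply: read_xor_at => // q qx; rewrite sb bd.
rewrite [RHS](@sum_bits_reindex _ h (fun b => g (read xs b) * sqmod (amp psi b))).
  by apply: eq_bigr => b _; rewrite hr ?size_tuple.
move=> b sb; split; first by rewrite size_xor_at.
rewrite {1}/h hr //; apply: (@eq_from_nth _ false); rewrite !size_xor_at // => i li.
by rewrite !nth_xor_at size_xor_at li /= -addbA addbb addbF.
Qed.

Lemma mass_cst xs ys psi : mass (fun=> 1) xs psi = mass (fun=> 1) ys psi.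
Proof. by []. Qed.

Lemma sqnorm_xor_query f xs ys psi :
  (forall q, q \in xs -> q \in ys -> False) -> {in xs, forall q, (q < nq psi)%N} ->
  sqnorm (xor_query f xs ys psi) = sqnorm psi.
Proof.
move=> dis bd; rewrite !sqnorm_mass (mass_cst _ xs) (mass_cst _ xs psi).
exact: mass_xor_query.
Qed.

Lemma xor_at0 ys v b : (forall i, nth false v i = false) -> xor_at ys v b = b.
Proof.
move=> v0; apply: (@eq_from_nth _ false); rewrite size_xor_at // => i li.
by rewrite nth_xor_at li v0 andbF addbF.
Qed.

(** A missing answer bit reads as [false], so the empty answer acts as an all-zero one; an oracle
    that rejects everything thus behaves as [no_oracle]. *)
Lemma xor_query_no_oracle xs ys psi : xor_query no_oracle xs ys psi = psi.
Proof.
case: psi => k a; rewrite /xor_query /=; congr QState; apply/funext => b.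
by rewrite xor_at0 // => i; rewrite nth_nil.
Qed.

End States.

(** * Runs and the hybrid argument *)

Section Exec.
Context (R : realType).
Implicit Types (psi phi : qstate R) (m : mem) (f : bits -> bits) (c : prog).

(** States are unnormalized, so probabilities enter through [F], usually a number times [sqnorm]. *)
Definition E X (p : qproc R X) psi (F : X -> qstate R -> R) : R :=
  \sum_(o <- p psi) F o.1 o.2.

Lemma E_ret X (x : X) psi F : E (ret x) psi F = F x psi.
Proof. by rewrite /E big_seq1. Qed.

Lemma E_bind X Y (p : qproc R X) (k : X -> qproc R Y) psi F :
  E (bind p k) psi F = E p psi (fun x psi' => E (k x) psi' F).
Proof. by rewrite /E /bind big_flatten big_map. Qed.

Lemma E_le X (p : qproc R X) psi F G :
  (forall x psi', F x psi' <= G x psi') -> E p psi F <= E p psi G.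
Proof. by move=> h; apply: ler_sum. Qed.

Lemma E_eq X (p : qproc R X) psi F G :
  (forall x psi', F x psi' = G x psi') -> E p psi F = E p psi G.
Proof. by move=> h; apply: eq_bigr. Qed.

Lemma E_ge0 X (p : qproc R X) psi F :
  (forall x psi', 0 <= F x psi') -> 0 <= E p psi F.
Proof. by move=> h; apply: sumr_ge0. Qed.

Lemma E_add X (p : qproc R X) psi F G :
  E p psi (fun x psi' => F x psi' + G x psi') = E p psi F + E p psi G.
Proof. exact: big_split. Qed.

Lemma E_scale X (p : qproc R X) psi (a : R) F :
  E p psi (fun x psi' => a * F x psi') = a * E p psi F.
Proof. by rewrite /E mulr_sumr. Qed.

Lemma E_sum X (I : Type) (r : seq I) (P : pred I) (p : qproc R X) psi F :
  E p psi (fun x psi' => \sum_(i <- r | P i) F i x psi') =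
  \sum_(i <- r | P i) E p psi (F i).
Proof. exact: exchange_big. Qed.

Lemma PrE (p : qproc R bool) :
  Pr p = E p (qinit R) (fun b psi => if b then sqnorm psi else 0).
Proof. exact: big_mkcond. Qed.

(* Distinct stack cells hold distinct qubits, all of index less than [N]. *)
Definition wf m (N : nat) : Prop :=
  [/\ forall x q, q \in qu m x -> (q < N)%N,
      forall x, uniq (qu m x)
    & forall x y q, q \in qu m x -> q \in qu m y -> x = y].

(* What [t] steps can change: new qubits have index at least [N]. *)
Definition ext (t : nat) m (N : nat) m' (N' : nat) : Prop :=
  [/\ (N <= N')%N,
      forall x q, q \in qu m' x -> (exists y, q \in qu m y) \/ (N <= q)%N
    & forall a, (size (cl m' a) <= size (cl m a) + t)%N].

Lemma ext_refl m N : ext 0 m N m N.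
Proof. by split=> [//|x q h|a]; [left; exists x|rewrite addn0]. Qed.

Lemma ext_trans t t' m N m1 N1 m2 N2 :
  ext t m N m1 N1 -> ext t' m1 N1 m2 N2 -> ext (t + t') m N m2 N2.
Proof.
case=> a1 b1 c1 [a2 b2 c2]; split; first exact: leq_trans a2.
  move=> x q /b2[[y /b1[|h]]|h]; [by left|by right|by right; apply: leq_trans h].
by move=> a; rewrite addnA (leq_trans (c2 a)) // leq_add2r.
Qed.

Lemma ext_leq t t' m N m' N' : (t <= t')%N -> ext t m N m' N' -> ext t' m N m' N'.
Proof.
by move=> h [a b c]; split=> // x; rewrite (leq_trans (c x)) // leq_add2l.
Qed.

Definition query_regs (i : instr) : option (nat * nat) :=
  if i is Query x y then (if x == y then None else Some (x, y)) else None.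

(** The eleven instructions have six kinds of effect. The oracle stays a variable of the indexed
    process and occurs in [SpQuery] only, so one case analysis treats runs under two oracles at
    once. *)
Inductive step_spec m : option (nat * nat) ->
    ((bits -> bits) -> qproc R (prog * mem)) -> Prop :=
| SpRet p m' : (forall N, wf m N -> wf m' N) -> (forall N, ext 1 m N m' N) ->
    step_spec m None (fun f => ret (p, m'))
| SpNew x : step_spec m None
    (fun f psi => [:: (([::], setqu m x (nq psi :: qu m x)), fresh psi)])
| SpGate u x q qs : unitary2 u -> qu m x = q :: qs ->
    step_spec m None (fun f => apply (gate1 u q) ([::], m))
| SpCnot x y q qs q' qs' : x != y -> qu m x = q :: qs -> qu m y = q' :: qs' ->
    step_spec m None (fun f => apply (xor_query id [:: q] [:: q']) ([::], m))
| SpMeas x q qs a : qu m x = q :: qs -> step_spec m None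
    (fun f psi => [seq (([::], setcl (setqu m x qs) a (b :: cl m a)), project q b psi)
                  | b <- [:: false; true]])
| SpQuery x y : x != y -> step_spec m (Some (x, y))
    (fun f => apply (xor_query f (qu m x) (qu m y)) ([::], m)).

Lemma wf_pop m x q qs N : qu m x = q :: qs -> wf m N -> wf (setqu m x qs) N.
Proof.
move=> e [h1 h2 h3].
have s y p : p \in qu (setqu m x qs) y -> p \in qu m y.
  by rewrite /= /upd; case: eqP => [->|//]; rewrite e inE orbC => ->.
split=> [y p /s/h1//|y|y z p /s h /s /(h3 _ _ _ h)//].
by rewrite /= /upd; case: eqP => // _; have := h2 x; rewrite e => /andP[].
Qed.

Lemma wf_push m x q N : (forall y, q \notin qu m y) -> (q < N)%N -> wf m N ->
  wf (setqu m x (q :: qu m x)) N.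
Proof.
move=> nq_ lq [h1 h2 h3].
have s y p : p \in qu (setqu m x (q :: qu m x)) y -> (p = q /\ y = x) \/ p \in qu m y.
  rewrite /= /upd; case: eqP => [->|_]; last by right.
  by rewrite inE => /orP[/eqP->|]; [left|right].
split=> [y p /s[[-> _]//|/h1//]|y|y z p].
  by rewrite /= /upd; case: eqP => //= _; rewrite nq_ h2.
move=> /s[[-> ->]|hy] /s[[e ->]|hz] //.
- by move: hz; rewrite (negPf (nq_ z)).
- by move: hy; rewrite e (negPf (nq_ y)).
exact: h3 hy hz.
Qed.

Lemma wf_widen m N N' : (N <= N')%N -> wf m N -> wf m N'.
Proof. by move=> h [h1 h2 h3]; split=> // x q /h1 /leq_trans; apply. Qed.

Lemma ext1_cl m a v N : (size v <= (size (cl m a)).+1)%N -> ext 1 m N (setcl m a v) N.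
Proof.
move=> h; split=> // [x q hq|b]; first by left; exists x.
by rewrite /= /upd addn1; case: eqP => [->|].
Qed.

Lemma wf_notin m x q qs y N : qu m x = q :: qs -> wf m N -> q \notin qu (setqu m x qs) y.
Proof.
move=> e [h1 h2 h3]; rewrite /= /upd; case: eqP => [_|ne].
  by have := h2 x; rewrite e => /andP[].
by apply/negP => hy; apply: ne; apply: h3 hy _; rewrite e mem_head.
Qed.

Lemma wf_move m x q qs y N : qu m x = q :: qs -> wf m N ->
  wf (setqu (setqu m x qs) y (q :: qu (setqu m x qs) y)) N.
Proof.
move=> e w; apply: wf_push (wf_pop e w); first by move=> z; apply: wf_notin e w.
by case: w => h _ _; apply: (h x); rewrite e mem_head.
Qed.

Lemma ext_move m x q qs y N : qu m x = q :: qs ->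
  ext 1 m N (setqu (setqu m x qs) y (q :: qu (setqu m x qs) y)) N.
Proof.
move=> e; split=> // [z p|b]; last by rewrite leq_addr.
have s z' : p \in upd (qu m) x qs z' -> exists y0, p \in qu m y0.
  rewrite /upd; case: eqP => _ h; last by exists z'.
  by exists x; rewrite e inE h orbT.
rewrite /= {1}/upd; case: (z =P y) => [_|_ /s]; last by left.
rewrite inE => /orP[/eqP->|/s]; left=> //.
by exists x; rewrite e mem_head.
Qed.

Definition stepf i m f := @step R f i m.

Lemma stepP i m : step_spec m (query_regs i) (stepf i m).
Proof.
rewrite /stepf.
have ext0 N : ext 1 m N m N by apply: ext_leq (ext_refl m N).
case: i => [a b|a|a c1 c0 ce|a c|x|x y|x|x|x y|x a|x y] /=.
- by apply: SpRet => // N; apply: ext1_cl.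
- by apply: SpRet => // N; apply: ext1_cl; rewrite size_behead leqW ?leq_pred.
- exact: SpRet.
- exact: SpRet.
- exact: SpNew.
- case e: (qu m x) => [|q qs]; first exact: SpRet.
  by apply: SpRet => N; [exact: wf_move|exact: ext_move].
- case e: (qu m x) => [|q qs]; first exact: SpRet.
  by apply: SpGate e; apply: hadamard_unitary.
- case e: (qu m x) => [|q qs]; first exact: SpRet.
  by apply: SpGate e; apply: tgate_unitary.
- case: eqP => [_|/eqP ne]; first exact: SpRet.
  case e: (qu m x) => [|q qs]; first exact: SpRet.
  case e': (qu m y) => [|q' qs']; first exact: SpRet.
  exact: SpCnot e e'.
- case e: (qu m x) => [|q qs]; first exact: SpRet.
  exact: SpMeas e.
- case: ifP => [_|/negbT ne]; first exact: SpRet.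
  exact: SpQuery.
Qed.

Lemma wf_meas m x q qs a v N : qu m x = q :: qs -> wf m N ->
  wf (setcl (setqu m x qs) a v) N.
Proof. exact: wf_pop. Qed.

Lemma wf_new m x N : wf m N -> wf (setqu m x (N :: qu m x)) N.+1.
Proof.
move=> w; apply: wf_push => //; last exact: wf_widen w.
by move=> y; apply/negP; case: w => h _ _ /h; rewrite ltnn.
Qed.

Lemma ext_new m x N : ext 1 m N (setqu m x (N :: qu m x)) N.+1.
Proof.
split=> // [y q|a]; last by rewrite leq_addr.
rewrite /= /upd; case: eqP => [_|_ h]; last by left; exists y.
by rewrite inE => /orP[/eqP->|h]; [right|left; exists x].
Qed.

Lemma ext_meas m x q qs a b N : qu m x = q :: qs ->
  ext 1 m N (setcl (setqu m x qs) a (b :: cl m a)) N.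
Proof.
move=> e; split=> // [y p|d].
  rewrite /= /upd; case: eqP => _ h; left; last by exists y.
  by exists x; rewrite e inE h orbT.
by rewrite /= /upd addn1; case: eqP => [->|].
Qed.

Lemma wf_disj m N x y : wf m N -> x != y ->
  forall q, q \in qu m x -> q \in qu m y -> False.
Proof. by case=> _ _ h /eqP ne q hx hy; apply: ne; apply: h hx hy. Qed.

Lemma wf_cnot m N x y q qs q' qs' : wf m N -> x != y ->
  qu m x = q :: qs -> qu m y = q' :: qs' ->
  forall p, p \in [:: q] -> p \in [:: q'] -> False.
Proof.
move=> w ne e e' p; rewrite !inE => /eqP-> /eqP h.
by apply: (wf_disj w ne (q := q)); rewrite ?e ?e' ?h mem_head.
Qed.

Lemma step_le f i m psi F G : wf m (nq psi) ->
  (forall o psi', wf o.2 (nq psi') -> ext 1 m (nq psi) o.2 (nq psi') ->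
    F o psi' <= G o psi') ->
  E (step f i m) psi F <= E (step f i m) psi G.
Proof.
have ext0 N : ext 1 m N m N by apply: ext_leq (ext_refl m N).
rewrite -/(stepf i m _); case: (stepP i m) => [p m' hw he|x|u x q qs _ _|x y q qs q' qs' _ _ _|x q qs a e|x y _] w h;
  rewrite /E ?big_cons ?big_nil ?addr0 /=.
- by apply: h; [apply: hw|apply: he].
- by apply: h; [apply: wf_new|apply: ext_new].
- exact: h.
- exact: h.
- by apply: lerD; apply: h; first [exact: wf_meas e w | exact: ext_meas e].
- exact: h.
Qed.

Lemma step_norm f i m psi : wf m (nq psi) ->
  E (step f i m) psi (fun=> @sqnorm R) = sqnorm psi.
Proof.
rewrite -/(stepf i m _); case: (stepP i m) => [p m' hw he|x|u x q qs uu e|x y q qs q' qs' ne e e'|x q qs a e|x y ne] w;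
  rewrite /E ?big_cons ?big_nil ?addr0 /=.
- by [].
- exact: sqnorm_fresh.
- by apply: sqnorm_gate1 => //; case: w => h _ _; apply: (h x); rewrite e mem_head.
- apply: sqnorm_xor_query; first exact: wf_cnot w ne e e'.
  by move=> p; rewrite inE => /eqP->; case: w => h _ _; apply: (h x); rewrite e mem_head.
- exact: sqnorm_project.
- apply: sqnorm_xor_query; first exact: wf_disj w ne.
  by move=> q; case: w => h _ _; apply: h.
Qed.

Lemma exec_nil f t m : @exec R f t [::] m = ret m.
Proof. by case: t. Qed.

Lemma E_execS f t i c m psi F : E (exec f t.+1 (i :: c) m) psi F =
  E (step f i m) psi (fun o psi' => E (exec f t (o.1 ++ c) o.2) psi' F).
Proof. by rewrite /= E_bind. Qed.

Lemma exec_le f t c m psi F G : wf m (nq psi) ->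
  (forall m' psi', wf m' (nq psi') -> ext t m (nq psi) m' (nq psi') ->
    F m' psi' <= G m' psi') ->
  E (exec f t c m) psi F <= E (exec f t c m) psi G.
Proof.
elim: t c m psi => [|t IH] [|i c] m psi w h; rewrite ?exec_nil ?E_ret.
- by apply: h => //; apply: ext_refl.
- by apply: h => //; apply: ext_refl.
- by apply: h => //; apply: ext_leq (ext_refl _ _).
rewrite !E_execS; apply: step_le => // o psi1 w1 e1; apply: IH => // m' psi' w' e'.
by apply: h => //; apply: (ext_trans e1).
Qed.

Lemma exec_eq f t c m psi F G : wf m (nq psi) ->
  (forall m' psi', wf m' (nq psi') -> ext t m (nq psi) m' (nq psi') ->
    F m' psi' = G m' psi') ->
  E (exec f t c m) psi F = E (exec f t c m) psi G.
Proof.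
move=> w h; apply/eqP; rewrite eq_le.
by apply/andP; split; apply: exec_le => // m' psi' w' e'; rewrite h.
Qed.

Lemma step_eq f i m psi F G : wf m (nq psi) ->
  (forall o psi', wf o.2 (nq psi') -> ext 1 m (nq psi) o.2 (nq psi') ->
    F o psi' = G o psi') ->
  E (step f i m) psi F = E (step f i m) psi G.
Proof.
move=> w h; apply/eqP; rewrite eq_le.
by apply/andP; split; apply: step_le => // m' psi' w' e'; rewrite h.
Qed.

Lemma exec_norm f t c m psi : wf m (nq psi) ->
  E (exec f t c m) psi (fun=> @sqnorm R) = sqnorm psi.
Proof.
elim: t c m psi => [|t IH] [|i c] m psi w; rewrite ?exec_nil ?E_ret //.
by rewrite E_execS -(step_norm f i w); apply: step_eq => // o psi' w' _; apply: IH.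
Qed.

Definition qm (g : bits -> R) (i : instr) m psi : R :=
  if query_regs i is Some (x, y) then mass g (qu m x) psi else 0.

(* Total weight [g] of the query made at the [t]-th step of the run without
   oracle. *)
Fixpoint qmass (g : bits -> R) (t : nat) c m psi : R :=
  if c is i :: c' then
    if t is t'.+1 then
      E (step no_oracle i m) psi (fun o psi' => qmass g t' (o.1 ++ c') o.2 psi')
    else qm g i m psi
  else 0.

Lemma mass_ge0 g xs psi : (forall u, 0 <= g u) -> 0 <= mass g xs psi.
Proof. by move=> h; apply: sumr_ge0 => b _; rewrite mulr_ge0 ?sqmod_ge0. Qed.

Lemma qm_ge0 g i m psi : (forall u, 0 <= g u) -> 0 <= qm g i m psi.
Proof. by rewrite /qm; case: (query_regs i) => [[x y]|//]; apply: mass_ge0. Qed.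

Lemma qmass_ge0 g t c m psi : (forall u, 0 <= g u) -> 0 <= qmass g t c m psi.
Proof.
move=> h; elim: t c m psi => [|t IH] [|i c] m psi //=; first exact: qm_ge0.
by apply: E_ge0 => o psi'.
Qed.

Lemma mass_le g g' xs psi : (forall u, g u <= g' u) -> mass g xs psi <= mass g' xs psi.
Proof. by move=> h; apply: ler_sum => b _; rewrite ler_wpM2r ?sqmod_ge0. Qed.

Lemma qmass_le g g' t c m psi : (forall u, g u <= g' u) ->
  qmass g t c m psi <= qmass g' t c m psi.
Proof.
move=> h; elim: t c m psi => [|t IH] [|i c] m psi //=; last by apply: E_le.
by rewrite /qm; case: (query_regs i) => [[x y]|//]; apply: mass_le.
Qed.

Lemma qmass_sum I (r : seq I) (P : pred I) g t c m psi :
  qmass (fun u => \sum_(k <- r | P k) g k u) t c m psi =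
  \sum_(k <- r | P k) qmass (g k) t c m psi.
Proof.
elim: t c m psi => [|t IH] [|i c] m psi /=.
- by rewrite big1.
- rewrite /qm; case: (query_regs i) => [[x y]|]; last by rewrite big1.
  rewrite /mass exchange_big; apply: eq_bigr => b _; exact: mulr_suml.
- by rewrite big1.
by rewrite -E_sum; apply: E_eq.
Qed.

Lemma qmass_scale a g t c m psi :
  qmass (fun u => a * g u) t c m psi = a * qmass g t c m psi.
Proof.
elim: t c m psi => [|t IH] [|i c] m psi /=; rewrite ?mulr0 //.
  rewrite /qm; case: (query_regs i) => [[x y]|]; last by rewrite mulr0.
  by rewrite /mass mulr_sumr; apply: eq_bigr => b _; rewrite mulrA.
by rewrite -E_scale; apply: E_eq.
Qed.

Lemma qmass_add g g' t c m psi :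
  qmass (fun u => g u + g' u) t c m psi = qmass g t c m psi + qmass g' t c m psi.
Proof.
elim: t c m psi => [|t IH] [|i c] m psi /=; rewrite ?addr0 //.
  rewrite /qm; case: (query_regs i) => [[x y]|]; last by rewrite addr0.
  by rewrite /mass -big_split; apply: eq_bigr => b _; rewrite mulrDl.
by rewrite -E_add; apply: E_eq.
Qed.

Lemma qmass_le1 t c m psi : wf m (nq psi) -> qmass (fun=> 1) t c m psi <= sqnorm psi.
Proof.
elim: t c m psi => [|t IH] [|i c] m psi w /=; rewrite ?sqnorm_ge0 //.
  rewrite /qm; case: (query_regs i) => [[x y]|]; last exact: sqnorm_ge0.
  by rewrite sqnorm_mass (mass_cst _ [::]).
rewrite -(step_norm no_oracle i w); apply: step_le => // o psi' w' _; exact: IH.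
Qed.

(** Insert the state obtained by querying [phi]: the query preserves the distance between [psi] and
    [phi], and it moves [phi] only on accepted inputs, because a zero answer changes nothing. *)
Lemma sqnorm_qsub_xor f (V : pred bits) xs ys psi phi (al : R) : 0 < al ->
  nq psi = nq phi ->
  (forall q, q \in xs -> q \in ys -> False) -> {in xs, forall q, (q < nq psi)%N} ->
  (forall u i, ~~ V u -> nth false (f u) i = false) ->
  sqnorm (qsub (xor_query f xs ys psi) phi) <=
  (1 + al^-1) * sqnorm (qsub psi phi) +
  (1 + al) * (4 * mass (fun u => (V u)%:R) xs phi).
Proof.
move=> al0 e dis bd hf; pose h b := xor_at ys (f (read xs b)) b.
have hr b : size b = nq psi -> read xs (h b) = read xs b.
  by move=> sb; apply: read_xor_at => // q qx; rewrite sb bd.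
have hP b : size b = nq psi -> size (h b) = nq psi /\ h (h b) = b.
  move=> sb; split; first by rewrite size_xor_at.
  rewrite {1}/h hr //; apply: (@eq_from_nth _ false); rewrite !size_xor_at // => i li.
  by rewrite !nth_xor_at size_xor_at li /= -addbA addbb addbF.
apply: (@le_trans _ _ (\sum_(b : (nq psi).-tuple bool)
    ((1 + al^-1) * sqmod (amp psi (h b) - amp phi (h b)) +
     (1 + al) * sqmod (amp phi (h b) - amp phi b)))).
  by apply: ler_sum => b _; apply: le_sqmod_add3.
rewrite big_split /= -!mulr_sumr; apply: lerD.
  by rewrite -(sum_bits_reindex (fun b => sqmod (amp psi b - amp phi b)) hP).
rewrite ler_pM2l; last by rewrite addr_gt0.
have em : mass (fun u => (V u)%:R) xs (QState (nq psi) (amp phi)) =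
    mass (fun u => (V u)%:R) xs phi by case: {bd dis hr hP} phi e => ? ? /= ->.
rewrite -em.
(* The 4 is twice the 2 of [le_sqmod_sub2]: the states before and after the query put the same mass
   on accepted inputs. *)
have -> : 4 * mass (fun u => (V u)%:R) xs (QState (nq psi) (amp phi)) =
  \sum_(b : (nq psi).-tuple bool) (2 * ((V (read xs b))%:R * sqmod (amp phi (h b))) +
    2 * ((V (read xs b))%:R * sqmod (amp phi b))).
  rewrite big_split /= -!mulr_sumr [X in _ = _ * X + _]
    (@mass_xor_query _ (fun u => (V u)%:R) f xs ys (QState (nq psi) (amp phi)) dis bd).
  by rewrite /mass /=; lra.
apply: ler_sum => b _; case: (boolP (V (read xs b))) => [_|nV]; first by rewrite !mul1r; apply: le_sqmod_sub2.
rewrite /h xor_at0; last by move=> i; apply: hf.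
by rewrite subrr sqmod0 !mul0r !mulr0 addr0.
Qed.

Lemma qsub_fresh psi phi : nq psi = nq phi ->
  sqnorm (qsub (fresh psi) (fresh phi)) = sqnorm (qsub psi phi).
Proof.
move=> e; rewrite -(sqnorm_fresh (qsub psi phi)); apply: eq_bigr => b _ /=; rewrite -e.
by case: ifP; rewrite ?subrr.
Qed.

Lemma qsub_gate1 u i psi phi : unitary2 u -> nq psi = nq phi -> (i < nq psi)%N ->
  sqnorm (qsub (gate1 u i psi) (gate1 u i phi)) = sqnorm (qsub psi phi).
Proof.
move=> uu e li; rewrite -(sqnorm_gate1 (psi := qsub psi phi) uu li).
by apply: eq_bigr => b _ /=; rewrite -sumrB; under [in RHS]eq_bigr do rewrite mulrBr.
Qed.

Lemma qsub_project i (b : bool) psi phi :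
  qsub (project i b psi) (project i b phi) = project i b (qsub psi phi).
Proof.
by rewrite /qsub /=; congr QState; apply/funext => d; case: ifP; rewrite ?subrr.
Qed.

(* The weight [al] of the squared distance grows by one: at a query, the triangle
   inequality is applied with factors [1 + 1 / al] and [1 + al]. *)
Lemma hybrid_step f (V : pred bits) i m psi phi (al ka eta : R) F G delta :
  1 <= al -> 0 <= ka -> wf m (nq psi) -> nq psi = nq phi ->
  (forall u i, ~~ V u -> nth false (f u) i = false) ->
  (forall o psi' phi', nq psi' = nq phi' -> wf o.2 (nq psi') ->
    `|F o psi' - G o phi'| <=
    eta * sqnorm phi' + ka * (al * sqnorm (qsub psi' phi') + delta o phi')) ->
  `|E (step f i m) psi F - E (step no_oracle i m) phi G| <=
  eta * sqnorm phi + ka * ((al + 1) * sqnorm (qsub psi phi) +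
    4 * (al * (al + 1)) * qm (fun u => (V u)%:R) i m phi +
    E (step no_oracle i m) phi delta).
Proof.
move=> al1 ka0 w e hf h.
have al0 : 0 < al by apply: lt_le_trans al1.
have w' : wf m (nq phi) by rewrite -e.
(* Outside queries the squared distance is preserved, so the growth of its weight from [al] to
   [al + 1] is pure slack. *)
have slack (X Y D : R) : X <= eta * sqnorm phi + ka * (al * D + Y) -> 0 <= D ->
    X <= eta * sqnorm phi + ka * ((al + 1) * D + 0 + Y).
  move=> hX D0; rewrite addr0; apply: le_trans hX _; rewrite lerD2l ler_wpM2l // lerD2r.
  by rewrite ler_wpM2r // lerDl.
rewrite /qm -/(stepf i m f) -/(stepf i m _); case: (stepP i m) => [p m' hw he|x|u x q qs uu ee|x y q qs q' qs' ne ee ee'|x q qs a ee|x y ne];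
  rewrite /E ?big_cons ?big_nil ?addr0 ?mulr0 /=.
- by apply: slack (sqnorm_ge0 _); apply: h => //; apply: hw.
- apply: slack (sqnorm_ge0 _).
  rewrite -e -(qsub_fresh e) -(sqnorm_fresh phi); apply: h => /=; rewrite ?e //.
  exact: wf_new.
- have lq : (q < nq psi)%N by case: w => hq _ _; apply: (hq x); rewrite ee mem_head.
  apply: slack (sqnorm_ge0 _); rewrite -(qsub_gate1 uu e lq).
  by rewrite -(sqnorm_gate1 (psi := phi) uu (i := q)) -?e //; apply: h.
- apply: slack (sqnorm_ge0 _).
  have lq : {in [:: q], forall q, (q < nq psi)%N}.
    by move=> p; rewrite inE => /eqP->; case: w => hq _ _; apply: (hq x); rewrite ee mem_head.
  have dis := wf_cnot w ne ee ee'.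
  rewrite -(@sqnorm_xor_query _ id _ _ (qsub psi phi) dis lq).
  by rewrite -(@sqnorm_xor_query _ id _ _ phi dis) -?e //; apply: h.
(* Both runs have the same outcomes here; norms and squared distances split over the two
   projections. *)
- rewrite -[X in eta * X](sqnorm_project q) -[sqnorm (qsub psi phi)](sqnorm_project q).
  have wm b := @wf_meas m x q qs a (b :: cl m a) _ ee w.
  have h0 := h ([::], setcl (setqu m x qs) a (false :: cl m a)) (project q false psi)
    (project q false phi) e (wm false).
  have h1 := h ([::], setcl (setqu m x qs) a (true :: cl m a)) (project q true psi)
    (project q true phi) e (wm true).
  rewrite !qsub_project in h0 h1.
  set F0 := F _ _ in h0 *; set F1 := F _ _ in h1 *.
  set G0 := G _ _ in h0 *; set G1 := G _ _ in h1 *.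
  have -> : F0 + F1 - (G0 + G1) = (F0 - G0) + (F1 - G1) by ring.
  apply: le_trans (ler_normD _ _) _; apply: le_trans (lerD h0 h1) _.
  have : 0 <= ka * (sqnorm (project q false (qsub psi phi)) +
                    sqnorm (project q true (qsub psi phi))).
    by rewrite mulr_ge0 // addr_ge0 // sqnorm_ge0.
  set d0 := delta _ _; set d1 := delta _ _; lra.
- have dis := wf_disj w ne.
  have bd : {in qu m x, forall q, (q < nq psi)%N} by move=> q; case: w => hq _ _; apply: hq.
  rewrite xor_query_no_oracle; set M := mass _ _ _; set psi1 := xor_query _ _ _ _.
  have hd : sqnorm (qsub psi1 phi) <= (1 + al^-1) * sqnorm (qsub psi phi) + (1 + al) * (4 * M).
    exact: sqnorm_qsub_xor.
  apply: le_trans (h _ psi1 phi _ _) _ => //; rewrite lerD2l ler_wpM2l // lerD2r.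
  apply: le_trans (ler_wpM2l (ltW al0) hd) _.
  rewrite le_eqVlt; apply/orP; left; apply/eqP; field; exact: lt0r_neq0.
Qed.

Lemma qmass_sumS g t i c m psi :
  \sum_(s < t.+1) qmass g s (i :: c) m psi = qm g i m psi +
  E (step no_oracle i m) psi
    (fun o psi' => \sum_(s < t) qmass g s (o.1 ++ c) o.2 psi').
Proof. by rewrite big_ord_recl /= E_sum. Qed.

(** Read backwards: weight [al] on the squared distance at the end becomes [al + t] at the start.
    The term [delta] carries what a later run already owes, so that two runs can be chained. [C]
    bounds the coefficients that [hybrid_step] gives to the queries on the way. *)
Lemma hybrid_exec f (V : pred bits) t c m psi phi (al ka eta C : R) F G delta :
  1 <= al -> 0 <= ka -> 4 * (al + t%:R) ^+ 2 <= C -> wf m (nq psi) -> nq psi = nq phi ->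
  (forall u i, ~~ V u -> nth false (f u) i = false) ->
  (forall m' psi' phi', nq psi' = nq phi' -> wf m' (nq psi') ->
    `|F m' psi' - G m' phi'| <=
    eta * sqnorm phi' + ka * (al * sqnorm (qsub psi' phi') + delta m' phi')) ->
  `|E (exec f t c m) psi F - E (exec no_oracle t c m) phi G| <=
  eta * sqnorm phi + ka * ((al + t%:R) * sqnorm (qsub psi phi) +
    (C * (\sum_(s < t) qmass (fun u => (V u)%:R) s c m phi) +
    E (exec no_oracle t c m) phi delta)).
Proof.
move=> al1 ka0 hC w e hf h.
elim: t hC c m psi phi w e => [|t IH] hC [|i c] m psi phi w e.
- by rewrite /= !E_ret big_ord0 mulr0 add0r addr0; apply: h.
- by rewrite /= !E_ret big_ord0 mulr0 add0r addr0; apply: h.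
- rewrite !exec_nil !E_ret big1 ?mulr0 ?add0r; last by move=> [[|s] ls] _.
  apply: le_trans (h _ _ _ e w) _; rewrite lerD2l ler_wpM2l // lerD2r.
  by rewrite ler_wpM2r ?sqnorm_ge0 // lerDl.
have lC : 4 * (al + t%:R) ^+ 2 <= C.
  apply: le_trans hC; rewrite ler_pM2l // lerXn2r ?nnegrE ?addr_ge0 //; lra.
rewrite !E_execS; pose d o phi' := C * (\sum_(s < t) qmass (fun u => (V u)%:R) s (o.1 ++ c) o.2 phi') +
    E (exec no_oracle t (o.1 ++ c) o.2) phi' delta.
have t0 : 0 <= t%:R :> R by [].
have a1 : 1 <= al + t%:R by lra.
apply: le_trans (@hybrid_step f V i m psi phi _ _ _ _ _ d a1 ka0 w e hf _) _.
  by move=> o psi' phi' e' w'; apply: IH.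
have hd : E (step no_oracle i m) phi d =
    C * E (step no_oracle i m) phi (fun o psi' =>
      \sum_(s < t) qmass (fun u => (V u)%:R) s (o.1 ++ c) o.2 psi') +
    E (step no_oracle i m) phi (fun o psi' => E (exec no_oracle t (o.1 ++ c) o.2) psi' delta).
  by rewrite -E_scale -E_add.
have hq : 4 * ((al + t%:R) * (al + t%:R + 1)) * qm (fun u => (V u)%:R) i m phi <=
    C * qm (fun u => (V u)%:R) i m phi.
  apply: ler_wpM2r; first by apply: qm_ge0 => u; case: (V u).
  apply: le_trans hC; rewrite ler_pM2l // -natr1; nra.
rewrite lerD2l ler_wpM2l // hd qmass_sumS -natr1; lra.
Qed.

End Exec.

(** * Spectator qubits *)

Section Junk.
Context (R : realType).
Implicit Types (psi phi chi : qstate R) (m : mem) (f : bits -> bits) (c : prog).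

(** Qubits are named by their rank of creation, so [k] qubits adjoined before the qubit [n0] move
    all the names from [n0] on. *)
Definition shift (n0 k i : nat) : nat := if (i < n0)%N then i else (i + k)%N.

Definition junk (n0 k : nat) (b : bits) : bits := take k (drop n0 b).

Definition unjunk (n0 k : nat) (b : bits) : bits := take n0 b ++ drop (n0 + k) b.

(* [psi'] is the product of [psi] and [chi], the qubits of [chi] being inserted
   before the qubit [n0] of [psi]. *)
Definition inserted n0 chi psi psi' : Prop :=
  [/\ nq psi' = (nq psi + nq chi)%N, (n0 <= nq psi)%N
    & forall b, size b = nq psi' ->
        amp psi' b = amp chi (junk n0 (nq chi) b) * amp psi (unjunk n0 (nq chi) b)].

Definition shifted n0 k m m' : Prop :=
  cl m' = cl m /\ forall x, qu m' x = map (shift n0 k) (qu m x).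

Lemma nth_unjunk n0 k b i : (n0 <= size b)%N ->
  nth false (unjunk n0 k b) i = nth false b (shift n0 k i).
Proof.
move=> h; rewrite nth_cat size_takel // /shift; case: ltnP => h1; first by rewrite nth_take.
by rewrite nth_drop; congr nth; lia.
Qed.

Lemma size_unjunk n0 k b : (n0 + k <= size b)%N ->
  size (unjunk n0 k b) = (size b - k)%N.
Proof. by move=> h; rewrite size_cat size_takel ?size_drop; lia. Qed.

Lemma eq_unjunk n0 k b d : (n0 + k <= size b)%N -> size d = (size b - k)%N ->
  (forall i, (i < size b - k)%N -> nth false d i = nth false b (shift n0 k i)) ->
  unjunk n0 k b = d.
Proof.
move=> h s e; apply: (@eq_from_nth _ false); rewrite ?size_unjunk ?s // => i li.
by rewrite nth_unjunk ?e //; lia.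
Qed.

Lemma eq_junk n0 k b b' : (n0 + k <= size b)%N -> (n0 + k <= size b')%N ->
  (forall i, (n0 <= i < n0 + k)%N -> nth false b i = nth false b' i) ->
  junk n0 k b = junk n0 k b'.
Proof.
move=> h h' e; have s d : (n0 + k <= size d)%N -> size (junk n0 k d) = k.
  by move=> hd; rewrite size_takel // size_drop; lia.
apply: (@eq_from_nth _ false); rewrite ?s // => i li.
by rewrite !nth_take // !nth_drop e //; lia.
Qed.

(** Cutting a string into prefix, spectator block and rest factorizes the sum: amplitudes multiply,
    and [G] does not read the block. *)
Lemma sum_inserted n0 chi psi psi' (G : bits -> R) : inserted n0 chi psi psi' ->
  \sum_(b : (nq psi').-tuple bool) G (unjunk n0 (nq chi) b) * sqmod (amp psi' b) =
  sqnorm chi * \sum_(b : (nq psi).-tuple bool) G b * sqmod (amp psi b).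
Proof.
case=> e le h; set k := nq chi in e h *.
have [r er] : {r | nq psi = (n0 + r)%N} by exists (nq psi - n0)%N; lia.
under eq_bigr => b _ do rewrite h ?size_tuple // sqmodM.
have e' : nq psi' = (n0 + (k + r))%N by lia.
rewrite er {}e' {e le h er}.
rewrite (sum_bits_cat _ _ (fun b => G (unjunk n0 k b) *
  (sqmod (amp chi (junk n0 k b)) * sqmod (amp psi (unjunk n0 k b))))).
rewrite (sum_bits_cat _ _ (fun b => G b * sqmod (amp psi b))) mulr_sumr.
apply: eq_bigr => a _; rewrite (sum_bits_cat _ _ (fun b => G (unjunk n0 k (a ++ b)) *
  (sqmod (amp chi (junk n0 k (a ++ b))) * sqmod (amp psi (unjunk n0 k (a ++ b)))))).
rewrite /sqnorm mulr_suml; apply: eq_bigr => j _; rewrite mulr_sumr; apply: eq_bigr => d _.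
have -> : junk n0 k (a ++ (j ++ d)) = j.
  by rewrite /junk drop_size_cat ?size_tuple // take_size_cat ?size_tuple.
have -> : unjunk n0 k (a ++ (j ++ d)) = a ++ d.
  by rewrite /unjunk take_size_cat ?size_tuple // catA drop_size_cat // size_cat !size_tuple.
by rewrite mulrCA.
Qed.

Lemma sqnorm_inserted n0 chi psi psi' : inserted n0 chi psi psi' ->
  sqnorm psi' = sqnorm chi * sqnorm psi.
Proof.
move=> h; have := sum_inserted (fun=> 1) h.
by under eq_bigr do rewrite mul1r; under [X in _ = _ * X]eq_bigr do rewrite mul1r.
Qed.

Lemma read_shift n0 k xs b : (n0 <= size b)%N ->
  read (map (shift n0 k) xs) b = read xs (unjunk n0 k b).
Proof.
by move=> h; rewrite /read -map_comp; apply: eq_map => i /=; rewrite nth_unjunk.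
Qed.

Lemma mass_inserted n0 chi psi psi' g xs : inserted n0 chi psi psi' ->
  mass g (map (shift n0 (nq chi)) xs) psi' = sqnorm chi * mass g xs psi.
Proof.
move=> h; rewrite -(sum_inserted (fun b => g (read xs b)) h); apply: eq_bigr => b _.
by rewrite read_shift // size_tuple; case: h; lia.
Qed.

Lemma shift_lt n0 k i n : (i < n)%N -> (shift n0 k i < n + k)%N.
Proof. by move=> h; rewrite /shift; case: (ltnP i n0); lia. Qed.

Lemma shift_inj n0 k : injective (shift n0 k).
Proof. by move=> i j; rewrite /shift; case: (ltnP i n0); case: (ltnP j n0); lia. Qed.

Lemma shift_junk n0 k i j : (n0 <= j < n0 + k)%N -> (j == shift n0 k i) = false.
Proof. by rewrite /shift => h; apply/eqP; case: ltnP; lia. Qed.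

Lemma inserted_fresh n0 chi psi psi' : inserted n0 chi psi psi' ->
  inserted n0 chi (fresh psi) (fresh psi').
Proof.
case=> e le h; split=> /=; [lia|lia|] => b sb; set k := nq chi in e h *.
have -> : nth false (unjunk n0 k b) (nq psi) = nth false b (nq psi').
  by rewrite nth_unjunk ?e; [rewrite /shift ltnNge le|lia].
case: ifP => _; first by rewrite mulr0.
rewrite h ?size_takel; [|lia..]; congr (amp chi _ * amp psi _).
  by apply: eq_junk; rewrite ?size_takel; [lia..|] => i li; rewrite nth_take //; lia.
apply: eq_unjunk => [||i]; rewrite ?size_takel ?size_unjunk; try lia; move=> li.
rewrite nth_take; last lia.
rewrite nth_unjunk ?nth_take //; last lia.
by have := @shift_lt n0 k i (nq psi); lia.
Qed.

Lemma unjunk_set n0 k b i d n : (n0 <= n)%N -> (i < n)%N -> size b = (n + k)%N ->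
  unjunk n0 k (set_nth false b (shift n0 k i) d) = set_nth false (unjunk n0 k b) i d.
Proof.
move=> le li sb; have ls := @shift_lt n0 k i n li.
apply: eq_unjunk => [||j]; rewrite ?size_setn ?size_unjunk ?size_setn; try lia; move=> lj.
by rewrite !nth_setn nth_unjunk ?(inj_eq (@shift_inj _ _)) //; lia.
Qed.

Lemma junk_set n0 k b i d n : (n0 <= n)%N -> (i < n)%N -> size b = (n + k)%N ->
  junk n0 k (set_nth false b (shift n0 k i) d) = junk n0 k b.
Proof.
move=> le li sb; have ls := @shift_lt n0 k i n li.
apply: eq_junk; rewrite ?size_setn; [lia..|] => j lj.
by rewrite nth_setn shift_junk.
Qed.

Lemma inserted_gate1 n0 chi psi psi' u i : (i < nq psi)%N -> inserted n0 chi psi psi' ->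
  inserted n0 chi (gate1 u i psi) (gate1 u (shift n0 (nq chi) i) psi').
Proof.
move=> li [e le h]; split=> //= b sb; rewrite nth_unjunk; last lia.
rewrite mulr_sumr; apply: eq_bigr => d _; rewrite h.
  by rewrite (unjunk_set _ (n := nq psi)) ?(junk_set _ (n := nq psi)) //; [ring|lia..].
by rewrite size_setn // sb e shift_lt.
Qed.

Lemma inserted_project n0 chi psi psi' i d : (i < nq psi)%N -> inserted n0 chi psi psi' ->
  inserted n0 chi (project i d psi) (project (shift n0 (nq chi) i) d psi').
Proof.
move=> li [e le h]; split=> //= b sb; rewrite nth_unjunk; last lia.
by case: ifP => _; rewrite ?mulr0 // h.
Qed.

Lemma inserted_xor n0 chi psi psi' f xs ys : inserted n0 chi psi psi' ->
  inserted n0 chi (xor_query f xs ys psi)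
    (xor_query f (map (shift n0 (nq chi)) xs) (map (shift n0 (nq chi)) ys) psi').
Proof.
move=> [e le h]; split=> //= b sb; set k := nq chi in e h *.
rewrite read_shift; last lia.
rewrite h ?size_xor_at //; congr (amp chi _ * amp psi _).
  apply: eq_junk; rewrite ?size_xor_at; [lia..|] => j lj; rewrite nth_xor_at.
  have -> : (j \in map (shift n0 k) ys) = false.
    by apply/mapP => -[i _ /eqP]; rewrite shift_junk.
  by rewrite /= addbF; case: ltnP => // ?; rewrite nth_default.
apply: eq_unjunk => [||j]; rewrite ?size_xor_at ?size_unjunk; try lia; move=> lj.
have lt : (j < nq psi)%N by lia.
have ls := @shift_lt n0 k j _ lt.
rewrite !nth_xor_at nth_unjunk; last lia.
rewrite (mem_map (@shift_inj _ _)) (index_map (@shift_inj _ _)) size_unjunk; last lia.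
by congr (_ && _); apply/idP/idP; lia.
Qed.

(** A scalar factor is a spectator without qubits. *)
Lemma inserted_scale a psi : inserted 0 (QState 0 (fun=> a)) psi (scale a psi).
Proof. by split=> //= [|b _]; rewrite ?addn0 // /unjunk take0 drop0. Qed.

(** For a party that holds no qubits yet, the whole register is the spectator and its own part is
    the empty state. *)
Lemma inserted_all psi : inserted 0 psi (qinit R) psi.
Proof. by split=> //= b sb; rewrite mulr1 /junk drop0 -sb take_size. Qed.

Lemma wf_mem m N x q qs : wf m N -> qu m x = q :: qs -> (q < N)%N.
Proof. by case=> h _ _ e; apply: (h x); rewrite e mem_head. Qed.

Lemma step_shift n0 chi f i m m' psi psi' (F F' : prog * mem -> qstate R -> R) a :
  wf m (nq psi) -> inserted n0 chi psi psi' -> shifted n0 (nq chi) m m' ->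
  (forall p m1 m1' psi1 psi1', wf m1 (nq psi1) -> ext 1 m (nq psi) m1 (nq psi1) ->
    inserted n0 chi psi1 psi1' -> shifted n0 (nq chi) m1 m1' ->
    F' (p, m1') psi1' = a * F (p, m1) psi1) ->
  E (step f i m') psi' F' = a * E (step f i m) psi F.
Proof.
move=> w ins [ec eq] h.
have ext0 : ext 1 m (nq psi) m (nq psi) by apply: ext_leq (ext_refl _ _).
have eS v x m1 m1' : shifted n0 (nq chi) m1 m1' ->
    shifted n0 (nq chi) (setcl m1 x v) (setcl m1' x v).
  by case=> e1 e2; split=> //=; rewrite e1.
have eQ v x m1 m1' : shifted n0 (nq chi) m1 m1' -> shifted n0 (nq chi) (setqu m1 x v)
    (setqu m1' x (map (shift n0 (nq chi)) v)).
  by case=> e1 e2; split=> //= y; rewrite /upd; case: eqP => // _; rewrite e2.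
have sm : shifted n0 (nq chi) m m' by [].
have hh p m1 m1' psi1 psi1' : wf m1 (nq psi1) -> ext 1 m (nq psi) m1 (nq psi1) ->
    inserted n0 chi psi1 psi1' -> shifted n0 (nq chi) m1 m1' ->
    \sum_(o <- [:: ((p, m1'), psi1')]) F' o.1 o.2 = a * \sum_(o <- [:: ((p, m1), psi1)]) F o.1 o.2.
  by move=> *; rewrite !big_seq1; apply: h.
case: i => [b d|b|b c1 c0 ce|b c|x|x y|x|x|x y|x b|x y]; rewrite /E /=.
- rewrite ec; apply: hh => //; last exact: eS.
  exact: ext1_cl.
- rewrite ec; apply: hh => //; last exact: eS.
  by apply: ext1_cl; rewrite size_behead leqW ?leq_pred.
- by rewrite ec; apply: hh.
- by rewrite ec; apply: hh.
- apply: hh; [exact: wf_new|exact: ext_new|exact: inserted_fresh|].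
  rewrite eq; have -> : nq psi' = shift n0 (nq chi) (nq psi).
    by case: ins => -> le _; rewrite /shift ltnNge le.
  exact: (eQ (nq psi :: qu m x)).
- rewrite eq; case e: (qu m x) => [|q qs] /=; first exact: hh.
  have sm' := eQ qs x _ _ sm.
  rewrite -[upd _ _ _ y]/(qu (setqu m' x (map (shift n0 (nq chi)) qs)) y).
  have -> : qu (setqu m' x (map (shift n0 (nq chi)) qs)) y =
      map (shift n0 (nq chi)) (qu (setqu m x qs) y) by case: sm'.
  rewrite /ret.
  apply: hh => //; [exact: wf_move|exact: ext_move|exact: (eQ (q :: _) y)].
- rewrite eq; case e: (qu m x) => [|q qs] /=; first exact: hh.
  by apply: hh => //; apply: inserted_gate1 => //; apply: wf_mem e.
- rewrite eq; case e: (qu m x) => [|q qs] /=; first exact: hh.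
  by apply: hh => //; apply: inserted_gate1 => //; apply: wf_mem e.
- rewrite !eq; case: (x == y) => /=; first exact: hh.
  case e: (qu m x) => [|q qs] /=; first exact: hh.
  case e': (qu m y) => [|q' qs'] /=; first exact: hh.
  by apply: hh => //; apply: (inserted_xor id [:: q] [:: q']).
- rewrite eq ec; case e: (qu m x) => [|q qs] /=; first exact: hh.
  rewrite !big_cons !big_nil !addr0 mulrDr; congr (_ + _); apply: h;
   by [exact: wf_meas e w|exact: ext_meas e|apply: inserted_project ins; apply: wf_mem e
      |apply/eS/eQ].
- case: (x == y); first exact: hh.
  by rewrite !eq; apply: hh => //; apply: inserted_xor.
Qed.

(** A run acts on its own qubits only, so the product form persists; a factor [a] between the final
    values is then a factor between the expectations. *)
Lemma exec_shift n0 chi f t c m m' psi psi' (F F' : mem -> qstate R -> R) a :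
  wf m (nq psi) -> inserted n0 chi psi psi' -> shifted n0 (nq chi) m m' ->
  (forall m1 m1' psi1 psi1', wf m1 (nq psi1) -> ext t m (nq psi) m1 (nq psi1) ->
    inserted n0 chi psi1 psi1' -> shifted n0 (nq chi) m1 m1' ->
    F' m1' psi1' = a * F m1 psi1) ->
  E (exec f t c m') psi' F' = a * E (exec f t c m) psi F.
Proof.
elim: t c m m' psi psi' => [|t IH] [|i c] m m' psi psi' w ins sh h; rewrite ?exec_nil ?E_ret.
- by apply: h => //; apply: ext_refl.
- by apply: h => //; apply: ext_refl.
- by apply: h => //; apply: ext_leq (ext_refl _ _).
rewrite !E_execS; apply: step_shift w ins sh _ => p m1 m1' psi1 psi1' w1 e1 ins1 sh1.
apply: IH => // m2 m2' psi2 psi2' w2 e2 ins2 sh2; apply: h => //.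
exact: (ext_trans e1).
Qed.

Lemma qmass_shift n0 chi g t c m m' psi psi' :
  wf m (nq psi) -> inserted n0 chi psi psi' -> shifted n0 (nq chi) m m' ->
  qmass g t c m' psi' = sqnorm chi * qmass g t c m psi.
Proof.
elim: t c m m' psi psi' => [|t IH] [|i c] m m' psi psi' w ins sh /=; rewrite ?mulr0 //.
  rewrite /qm; case: (query_regs i) => [[x y]|]; last by rewrite mulr0.
  by case: sh => _ ->; apply: mass_inserted.
by apply: step_shift w ins sh _ => p m1 m1' psi1 psi1' w1 e1 ins1 sh1; apply: IH.
Qed.

End Junk.

(** * Programs that guess numbers and strings *)

(* Scratch classical stacks of the programs below; [tmp] is used by [sub_prog]. *)
Notation cnt := 5%N (only parsing).
Notation flag := 6%N (only parsing).
Notation dbl := 7%N (only parsing).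
Notation par := 8%N (only parsing).
Notation tmp := 9%N (only parsing).

Lemma mem_ext m m' : cl m =1 cl m' -> qu m =1 qu m' -> m = m'.
Proof. by case: m m' => [a b] [a' b'] /= /funext-> /funext->. Qed.

Ltac mem_tac := apply: mem_ext => ? //=; rewrite /upd;
  repeat (match goal with |- context [?x == ?y] => case: (x =P y) => [?|?] end;
    subst => //=); try by [exfalso; lia].

Section Gadgets.
Context (R : realType) (P : mem -> R) (P_ge0 : forall m, 0 <= P m).
Implicit Types (psi : qstate R) (m : mem) (c rest body : prog) (F : R) (T : nat).

(* Expectation of [P] over the runs that halt within [T] steps. *)
Fixpoint Vh T c m psi : R :=
  match c with
  | [::] => P m * sqnorm psi
  | i :: c' => if T is T'.+1 then
      E (step no_oracle i m) psi (fun o psi' => Vh T' (o.1 ++ c') o.2 psi')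
    else 0
  end.

Lemma Vh_ge0 T c m psi : 0 <= Vh T c m psi.
Proof.
elim: T c m psi => [|T IH] [|i c] m psi //=; rewrite ?mulr_ge0 ?sqnorm_ge0 //.
by apply: E_ge0 => o psi'.
Qed.

Lemma Vh_leS T c m psi : Vh T c m psi <= Vh T.+1 c m psi.
Proof.
elim: T c m psi => [|T IH] [|i c] m psi //=; last by apply: E_le => o psi'.
by apply: E_ge0 => o psi'; case: (_ ++ _) => // *; rewrite mulr_ge0 ?sqnorm_ge0.
Qed.

(** Unfinished runs count for 0, so more time can only help and time bounds may be rounded up. *)
Lemma Vh_mono T T' c m psi : (T <= T')%N -> Vh T c m psi <= Vh T' c m psi.
Proof.
move=> /subnK <-; elim: (T' - T)%N => [|k IH]; rewrite ?add0n // addSn.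
exact: le_trans IH (Vh_leS _ _ _ _).
Qed.

Lemma Vh_exec T c m psi :
  Vh T c m psi <= E (exec no_oracle T c m) psi (fun m' psi' => P m' * sqnorm psi').
Proof.
elim: T c m psi => [|T IH] [|i c] m psi; rewrite ?exec_nil ?E_ret //=.
  by rewrite mulr_ge0 ?sqnorm_ge0.
by rewrite E_bind; apply: E_le => o psi'.
Qed.

Lemma Vh_det T i c m p m' psi : @step R no_oracle i m = ret (p, m') ->
  Vh T.+1 (i :: c) m psi = Vh T (p ++ c) m' psi.
Proof. by move=> /= ->; rewrite E_ret. Qed.

(** Bounds are established from the end of a program backwards, like weakest preconditions.
    Quantifying over [psi] makes the qubits spent by earlier coins harmless. *)
Definition LB T c m F := forall psi, F * sqnorm psi <= Vh T c m psi.

Lemma LB0 T c m : LB T c m 0.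
Proof. by move=> psi; rewrite mul0r Vh_ge0. Qed.

Lemma LB_le T T' c m F F' : (T <= T')%N -> F' <= F -> LB T c m F -> LB T' c m F'.
Proof.
move=> hT hF h psi; apply: le_trans (Vh_mono _ _ _ hT); apply: le_trans (h psi).
by rewrite ler_wpM2r ?sqnorm_ge0.
Qed.

Lemma LB_det T i c m p m' F : @step R no_oracle i m = ret (p, m') ->
  LB T (p ++ c) m' F -> LB T.+1 (i :: c) m F.
Proof. by move=> e h psi; rewrite (Vh_det _ _ _ e). Qed.

Lemma LB_push T a b c m F :
  LB T c (setcl m a (b :: cl m a)) F -> LB T.+1 (Push a b :: c) m F.
Proof. by apply: (@LB_det _ _ _ _ [::]). Qed.

Lemma LB_pop T a c m F :
  LB T c (setcl m a (behead (cl m a))) F -> LB T.+1 (Pop a :: c) m F.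
Proof. by apply: (@LB_det _ _ _ _ [::]). Qed.

Lemma LB_while0 T a body c m F : head false (cl m a) = false ->
  LB T c m F -> LB T.+1 (While a body :: c) m F.
Proof. by move=> h; apply: (@LB_det _ _ _ _ [::]); rewrite /= h. Qed.

Lemma LB_while1 T a body c m F : head false (cl m a) = true ->
  LB T (body ++ While a body :: c) m F -> LB T.+1 (While a body :: c) m F.
Proof.
by move=> h; rewrite -cat_rcons; apply: LB_det; rewrite /= h.
Qed.

Lemma LB_case T a c1 c0 ce c m F :
  LB T ((if cl m a is b :: _ then (if b then c1 else c0) else ce) ++ c) m F ->
  LB T.+1 (Case a c1 c0 ce :: c) m F.
Proof. by apply: LB_det => /=; case: (cl m a) => [|[] ?]. Qed.

Definition coin a : prog := [:: New 0; Had 0; Meas 0 a].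

Lemma sqnorm_coin psi b :
  sqnorm (project (nq psi) b (gate1 (@hadamard R) (nq psi) (fresh psi))) = 2^-1 * sqnorm psi.
Proof.
rewrite /sqnorm /= -addn1 (sum_bits_cat _ _ (fun b0 => sqmod
  (if nth false b0 (nq psi) == b then \sum_(c : bool) @hadamard R (nth false b0 (nq psi)) c *
     (if nth false (set_nth false b0 (nq psi) c) (nq psi) then 0
      else amp psi (take (nq psi) (set_nth false b0 (nq psi) c))) else 0))) mulr_sumr.
apply: eq_bigr => d _; rewrite (sum_bits1 (fun x => sqmod
  (if nth false (d ++ x) (nq psi) == b then \sum_(c : bool) @hadamard R (nth false (d ++ x) (nq psi)) c *
     (if nth false (set_nth false (d ++ x) (nq psi) c) (nq psi) then 0
      else amp psi (take (nq psi) (set_nth false (d ++ x) (nq psi) c))) else 0))).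
have sd : size d = nq psi by rewrite size_tuple.
have e x : take (nq psi) (set_nth false (d ++ [:: x]) (nq psi) false) = d.
  apply: (@eq_from_nth _ false); rewrite size_takel ?sd ?size_setn ?size_cat ?sd //= ?addn1 //.
  by move=> j lj; rewrite nth_take // nth_setn nth_cat sd lj; case: eqP => // E0; lia.
have hs x : sqmod (@hadamard R x false) = 2^-1.
  by rewrite /hadamard andbF expr0 sqmod_real expr_div_n expr1n sqr_sqrtr // mul1r.
rewrite !big_bool /= !nth_setn eqxx !nth_cat sd ltnn subnn /= !e !mulr0 !add0r.
by case: b => /=; rewrite ?sqmod0 ?sqmodM ?hs ?add0r ?addr0.
Qed.

Lemma LB_coin T a c m F0 F1 : LB T c (setcl m a (false :: cl m a)) F0 ->
  LB T c (setcl m a (true :: cl m a)) F1 -> LB (T + 3) (coin a ++ c) m (2^-1 * (F0 + F1)).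
Proof.
move=> h0 h1 psi; rewrite addn3 /= /E !big_seq1 /= ?big_seq1 /= big_cons big_seq1 /=.
set m1 := setcl _ a (false :: _); set m2 := setcl _ a (true :: _).
have e0 : m1 = setcl m a (false :: cl m a).
  by apply: mem_ext => j //=; rewrite /upd; case: eqP => // ->.
have e1 : m2 = setcl m a (true :: cl m a).
  by apply: mem_ext => j //=; rewrite /upd; case: eqP => // ->.
rewrite e0 e1 mulrDr mulrDl; apply: lerD.
  by have := h0 (project (nq psi) false (gate1 (@hadamard R) (nq psi) (fresh psi)));
     rewrite sqnorm_coin mulrCA mulrA.
by have := h1 (project (nq psi) true (gate1 (@hadamard R) (nq psi) (fresh psi)));
   rewrite sqnorm_coin mulrCA mulrA.
Qed.

(** [mu i] is the memory with [i] rounds left, counted in unary on [a]. A round costs 2 besides its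
    body, for the test and the pop; the last 1 is the failing test. *)
Lemma LB_loop (mu : nat -> mem) a body tau k T rest F :
  (forall i, (i <= k)%N -> cl (mu i) a = nseq i true) ->
  (forall i T' F', (i < k)%N -> LB T' (While a (Pop a :: body) :: rest) (mu i) F' ->
    LB (T' + tau) (body ++ While a (Pop a :: body) :: rest)
       (setcl (mu i.+1) a (nseq i true)) F') ->
  LB T rest (mu 0) F ->
  LB (T + k * (tau + 2) + 1) (While a (Pop a :: body) :: rest) (mu k) F.
Proof.
elim: k => [|k IH] hc hb h.
  by rewrite mul0n addn0 addn1; apply: LB_while0 => //; rewrite hc.
have h' : LB (T + k * (tau + 2) + 1) (While a (Pop a :: body) :: rest) (mu k) F.
  by apply: IH => // [i li|i T' F' li]; [apply: hc|apply: hb]; lia.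
have -> : (T + k.+1 * (tau + 2) + 1 = (T + k * (tau + 2) + 1 + tau).+2)%N by lia.
apply: LB_while1; first by rewrite hc.
apply: LB_pop; rewrite hc //=; exact: hb.
Qed.

Definition clean m := [/\ cl m cnt = [::], cl m flag = [::], cl m dbl = [::] & cl m par = [::]].

Definition double_prog : prog :=
  [:: While cnt [:: Pop cnt; Push dbl true; Push dbl true];
      While dbl [:: Pop dbl; Push cnt true]].

Lemma nseqS (b : bool) k : b :: nseq k b = nseq k.+1 b.
Proof. by []. Qed.

Lemma LB_double x T c m F : cl m cnt = nseq x true -> cl m dbl = [::] ->
  LB T c (setcl m cnt (nseq x.*2 true)) F ->
  LB (T + (10 * x + 2)) (double_prog ++ c) m F.
Proof.
move=> hx hd h.
pose mu1 i := setcl (setcl m dbl (nseq (x - i).*2 true)) cnt (nseq i true).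
pose mu2 i := setcl (setcl m cnt (nseq (x.*2 - i) true)) dbl (nseq i true).
have -> : m = mu1 x by mem_tac; rewrite ?subnn.
(* [x] rounds with two pushes, then twice as many with one push: [4 * x + 1] and [6 * x + 1]
   steps. *)
apply: (@LB_le ((T + x.*2 * (1 + 2) + 1) + x * (2 + 2) + 1)) (lexx _) _; first lia.
apply: (@LB_loop mu1 cnt [:: Push dbl true; Push dbl true] 2 x) => [//|i T' F' li h'|].
  rewrite addn2; apply/LB_push/LB_push; congr (LB _ _ _ _): h'.
  by mem_tac; rewrite !nseqS; congr nseq; lia.
have -> : mu1 0 = mu2 x.*2 by mem_tac; rewrite ?subnn ?subn0.
apply: (@LB_loop mu2 dbl [:: Push cnt true] 1 x.*2) => [//|i T' F' li h'|].
  rewrite addn1; apply/LB_push; congr (LB _ _ _ _): h'.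
  by mem_tac; rewrite !nseqS; congr nseq; lia.
by congr (LB _ _ _ _): h; mem_tac; rewrite ?subn0.
Qed.

Definition num_body : prog :=
  double_prog ++ coin par ++ [:: Case par [:: Push cnt true] [::] [::]; Pop par] ++ coin flag.

(* Leaves on [cnt] a random number: bits are appended until a coin says stop, so
   that [x > 0] has probability at least [1 / (8 * x ^ 2)]. *)
Definition num_prog : prog :=
  coin flag ++ [:: While flag (Pop flag :: num_body); Pop flag].

(** A binary digit costs two coins, its value and the decision to go on, hence a factor 1/4; a
    positive [x] has at most [1 + log2 x] digits. *)
Definition num_weight (x : nat) : R := if x == 0%N then 1 else (4 * x%:R ^+ 2)^-1.

Lemma num_weight_half x : (0 < x)%N -> num_weight x <= 2^-1 * (2^-1 * num_weight x./2).
Proof.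
rewrite /num_weight => x0; rewrite (gtn_eqF x0).
have xR : 0 < x%:R :> R by rewrite ltr0n.
case: eqP => [x20|/eqP x20].
  have -> : x = 1%N by have := odd_double_half x; rewrite x20; case: (odd x) => /=; lia.
  by rewrite expr1n; lra.
have yR : 0 < (x./2)%:R :> R by rewrite ltr0n lt0n.
have le : (x./2)%:R * 2 <= x%:R :> R by rewrite -natrM ler_nat; have := odd_double_half x; lia.
rewrite -!invfM lef_pV2 ?posrE ?mulr_gt0 ?exprn_gt0 //.
nra.
Qed.

Lemma num_weight_ge0 x : 0 <= num_weight x.
Proof. by rewrite /num_weight; case: ifP => // _; rewrite invr_ge0 mulr_ge0 ?sqr_ge0. Qed.

(** Digits are appended on the right, so the last round turns [x./2] into [x]; strong induction
    provides [x./2]. *)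
Lemma LB_num_loop x T c m F : clean m -> 0 <= F ->
  LB T (coin flag ++ While flag (Pop flag :: num_body) :: c) (setcl m cnt (nseq x true)) F ->
  LB (T + 40 * x) (coin flag ++ While flag (Pop flag :: num_body) :: c) m (num_weight x * F).
Proof.
move=> [m1 m2 m3 m4] F0; elim/ltn_ind: x T F F0 => x IH T F F0 h.
have [x0|x0] := posnP x.
  rewrite /num_weight x0 eqxx mul1r muln0 addn0; move: h; rewrite x0 /=.
  by congr LB; mem_tac.
have lx : (x./2 < x)%N by have := odd_double_half x; lia.
have key : LB (T + 5 * x + 20) (coin flag ++ While flag (Pop flag :: num_body) :: c)
    (setcl m cnt (nseq x./2 true)) (2^-1 * (2^-1 * F)).
  have h' : LB (T + 5 * x + 17) (While flag (Pop flag :: num_body) :: c)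
      (setcl (setcl m cnt (nseq x./2 true)) flag [:: true]) (2^-1 * F).
    apply: (@LB_le (T + 6 + (3 + (10 * x./2 + 2))).+2) (lexx _) _; first lia.
    apply: LB_while1 => //; rewrite cat_cons; apply: LB_pop.
    rewrite {1}/num_body -!catA.
    rewrite addnA; apply: (@LB_double x./2) => //.
    have ev b : b = odd x -> LB (T + 6)
        ([:: Case par [:: Push cnt true] [::] [::]; Pop par] ++ coin flag ++
          While flag (Pop flag :: num_body) :: c)
        (setcl (setcl (setcl m cnt (nseq x./2.*2 true)) flag [::]) par [:: b]) F.
      move=> eb; apply: (@LB_le (T + b).+2) (lexx _) _; first by case: (b); lia.
      apply: LB_case => /=; case: b eb => /= eb.
        rewrite addn1; apply/LB_push/LB_pop => //=; move: h; congr LB.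
        by mem_tac; rewrite nseqS; congr nseq; have := odd_double_half x; lia.
      rewrite addn0; apply/LB_pop => //=; move: h; congr LB.
      by mem_tac; congr nseq; have := odd_double_half x; lia.
    (* A digit of the wrong parity is counted as a failure. *)
    have cases b : LB (T + 6) ([:: Case par [:: Push cnt true] [::] [::]; Pop par] ++
         coin flag ++ While flag (Pop flag :: num_body) :: c)
        (setcl (setcl (setcl m cnt (nseq x./2.*2 true)) flag [::]) par [:: b])
        (if b == odd x then F else 0).
      by case: eqP => [|_]; [exact: ev|exact: LB0].
    apply: (@LB_le (T + 6 + 3) _ _ _ (2^-1 * ((if false == odd x then F else 0) +
        (if true == odd x then F else 0)))).
    - by lia.
    - by case: (odd x) => /=; rewrite ?add0r ?addr0.
    by apply: LB_coin; [move: (cases false)|move: (cases true)]; congr LB; mem_tac; rewrite m4.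
  apply: (@LB_le (T + 5 * x + 17 + 3) _ _ _ (2^-1 * (0 + 2^-1 * F))).
  - by lia.
  - by rewrite add0r.
  apply: LB_coin; first exact: LB0.
  by move: h'; congr LB; mem_tac; rewrite m2.
have F4 : 0 <= 2^-1 * (2^-1 * F) by rewrite !mulr_ge0.
apply: LB_le (IH _ lx _ _ F4 key).
  (* The 40 is large enough for [40 * x./2 + 5 * x + 20 <= 40 * x] at every positive [x]. *)
  by have := odd_double_half x; lia.
have := num_weight_half x0; have := num_weight_ge0 x; nra.
Qed.

(** The factor [2^-1] and the 5 extra steps pay for the coin that ends the number, the failing test
    and the final pop. *)
Lemma LB_num x T c m F : clean m -> 0 <= F -> LB T c (setcl m cnt (nseq x true)) F ->
  LB (T + 40 * x + 5) (num_prog ++ c) m (num_weight x * (2^-1 * F)).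
Proof.
move=> cm F0 h; have [m1 m2 m3 m4] := cm; rewrite /num_prog -catA.
have -> : (T + 40 * x + 5 = T.+2 + 3 + 40 * x)%N by lia.
apply: LB_num_loop => //; first by rewrite mulr_ge0.
apply: (@LB_le (T.+2 + 3) _ _ _ (2^-1 * (F + 0))) => //; first by rewrite addr0.
apply: LB_coin; last exact: LB0.
apply: LB_while0 => //; apply: LB_pop; move: h; congr LB.
by mem_tac; rewrite m2.
Qed.

Definition rep body : prog := num_prog ++ [:: While cnt (Pop cnt :: body)].

(** Room for guessing a number up to [N], at 40 steps per unit, and for [N] rounds with a body of at
    most 10 steps. *)
Definition rep_time N : nat := 60 * N + 20.

(** A lower bound valid for all guesses up to [N] at once, so that costs multiply without tracking
    the guessed values. The successor keeps it positive when [N] is 0. *)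
Definition rep_weight N : R := (8 * N.+1%:R ^+ 2)^-1.

Lemma rep_weight_gt0 N : 0 < rep_weight N.
Proof. by rewrite invr_gt0 mulr_gt0 // exprn_gt0. Qed.

Lemma rep_weight_le N k : (k <= N)%N -> rep_weight N <= num_weight k * 2^-1.
Proof.
move=> kN; have h : 1 <= N.+1%:R :> R by rewrite ler1n.
rewrite /rep_weight /num_weight; case: eqP => [_|/eqP k0].
  rewrite mul1r lef_pV2 ?posrE ?mulr_gt0 ?exprn_gt0 //; nra.
have kR : 0 < k%:R :> R by rewrite ltr0n lt0n.
have le : k%:R <= N.+1%:R :> R by rewrite ler_nat leqW.
rewrite -invfM lef_pV2 ?posrE ?mulr_gt0 ?exprn_gt0 //; nra.
Qed.

Lemma LB_rep (nu : nat -> mem) k N body tau T rest F :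
  clean (nu 0%N) -> (forall i, cl (nu i) cnt = [::]) -> (k <= N)%N -> (tau <= 10)%N -> 0 <= F ->
  (forall j r T' rest' F', (j < k)%N -> LB T' rest' (setcl (nu j.+1) cnt (nseq r true)) F' ->
    LB (T' + tau) (body ++ rest') (setcl (nu j) cnt (nseq r true)) F') ->
  LB T rest (nu k) F ->
  LB (T + rep_time N) (rep body ++ rest) (nu 0%N) (rep_weight N * F).
Proof.
move=> cl0 cn kN ht F0 hb h.
apply: (@LB_le (T + k * (tau + 2) + 1 + 40 * k + 5) _ _ _ (num_weight k * (2^-1 * F))).
- rewrite /rep_time; nia.
- by rewrite mulrA ler_wpM2r // rep_weight_le.
rewrite -catA; apply: LB_num => //.
pose mu i := setcl (nu (k - i)%N) cnt (nseq i true).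
have -> : setcl (nu 0%N) cnt (nseq k true) = mu k by rewrite /mu subnn.
apply: (@LB_loop mu) => [//|i T' F' li h'|].
  have -> : setcl (mu i.+1) cnt (nseq i true) = setcl (nu (k - i.+1)%N) cnt (nseq i true).
    by mem_tac.
  apply: hb; first lia.
  by have -> : (k - i.+1).+1 = (k - i)%N by lia.
by move: h; congr LB; rewrite /mu subn0; mem_tac; rewrite cn.
Qed.

(* The stacks not touched by [num_prog]. *)
Definition ok (a : nat) := ((a < 5) || (8 < a))%N.

Lemma clean_setcl m a v : ok a -> clean m -> clean (setcl m a v).
Proof.
move=> oa [h1 h2 h3 h4]; rewrite /clean /= /upd.
by do 4![case: eqP => [?|_]; [exfalso; move: oa; rewrite /ok; lia|]].
Qed.

Lemma LB_rep_push a b k N T rest m F : ok a -> clean m -> (k <= N)%N -> 0 <= F ->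
  LB T rest (setcl m a (nseq k b ++ cl m a)) F ->
  LB (T + rep_time N) (rep [:: Push a b] ++ rest) m (rep_weight N * F).
Proof.
rewrite /ok => oa cm kN F0 h; have [m1 m2 m3 m4] := cm.
pose nu j := setcl m a (nseq j b ++ cl m a).
have -> : m = nu 0%N by mem_tac.
apply: (@LB_rep nu k N _ 1) => //.
- by apply: clean_setcl.
- by move=> i; rewrite /= /upd; case: eqP => // e; exfalso; lia.
move=> j r T' rest' F' lj h'; rewrite addn1; apply: LB_push; move: h'; congr LB.
by mem_tac.
Qed.

Definition mv a b : prog :=
  [:: Case a [:: Pop a; Push b true] [:: Pop a; Push b false] [::]].

Definition mv2 a b d : prog :=
  [:: Case a [:: Pop a; Push b true; Push d true] [:: Pop a; Push b false; Push d false] [::]].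

Lemma rev_take_S (s : bits) j x : (j < size s)%N -> nth false s j = x ->
  rev (take j.+1 s) = x :: rev (take j s).
Proof. by move=> h e; rewrite (take_nth false h) rev_rcons e. Qed.

(** Moving bit by bit reverses the string, hence [rev]; the guessed count [k] need not exhaust the
    source. *)
Lemma LB_rep_mv a b k N T rest m F : ok a -> ok b -> a != b -> clean m ->
  (k <= N)%N -> (k <= size (cl m a))%N -> 0 <= F ->
  LB T rest (setcl (setcl m a (drop k (cl m a))) b (rev (take k (cl m a)) ++ cl m b)) F ->
  LB (T + rep_time N) (rep (mv a b) ++ rest) m (rep_weight N * F).
Proof.
rewrite /ok => oa ob ab cm kN ka F0 h; have [m1 m2 m3 m4] := cm.
pose nu j := setcl (setcl m a (drop j (cl m a))) b (rev (take j (cl m a)) ++ cl m b).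
have -> : m = nu 0%N by mem_tac; rewrite ?drop0 ?take0.
apply: (@LB_rep nu k N _ 3) => //.
- by do 2![apply: clean_setcl => //].
- by move=> i; rewrite /= /upd; do 2![case: eqP => [e|_]; first by [exfalso; lia]].
move=> j r T' rest' F' lj h'; rewrite addn3; apply: LB_case.
have lj' : (j < size (cl m a))%N by lia.
have e : cl (setcl (nu j) cnt (nseq r true)) a =
    nth false (cl m a) j :: drop j.+1 (cl m a).
  rewrite /= /upd; do 2![case: eqP => [e|_]; first by [exfalso; lia]].
  by rewrite eqxx -drop_nth.
rewrite e; case ex: (nth _ _ _); apply/LB_pop/LB_push; move: h'; congr LB;
  rewrite e; mem_tac; by rewrite (rev_take_S lj' ex).
Qed.

Lemma LB_rep_mv2 a b d k N T rest m F : ok a -> ok b -> ok d ->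
  a != b -> a != d -> b != d -> clean m ->
  (k <= N)%N -> (k <= size (cl m a))%N -> 0 <= F ->
  LB T rest (setcl (setcl (setcl m a (drop k (cl m a))) b (rev (take k (cl m a)) ++ cl m b))
    d (rev (take k (cl m a)) ++ cl m d)) F ->
  LB (T + rep_time N) (rep (mv2 a b d) ++ rest) m (rep_weight N * F).
Proof.
rewrite /ok => oa ob od ab ad bd cm kN ka F0 h; have [m1 m2 m3 m4] := cm.
pose nu j := setcl (setcl (setcl m a (drop j (cl m a))) b (rev (take j (cl m a)) ++ cl m b))
    d (rev (take j (cl m a)) ++ cl m d).
have -> : m = nu 0%N by mem_tac; rewrite ?drop0 ?take0.
apply: (@LB_rep nu k N _ 4) => //.
- by do 3![apply: clean_setcl => //].
- by move=> i; rewrite /= /upd; do 3![case: eqP => [e|_]; first by [exfalso; lia]].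
move=> j r T' rest' F' lj h'; have -> : (T' + 4 = T'.+4)%N by lia.
apply: LB_case; have lj' : (j < size (cl m a))%N by lia.
have e : cl (setcl (nu j) cnt (nseq r true)) a =
    nth false (cl m a) j :: drop j.+1 (cl m a).
  rewrite /= /upd; do 3![case: eqP => [e|_]; first by [exfalso; lia]].
  by rewrite eqxx -drop_nth.
rewrite e; case ex: (nth _ _ _); apply/LB_pop/LB_push/LB_push; move: h'; congr LB;
  rewrite e; mem_tac; by rewrite (rev_take_S lj' ex).
Qed.

(* Appends to [dst] a random substring of [src], padded with a random number of
   zeros; [src] is restored. *)
Definition sub_prog src dst : prog :=
  rep [:: Push dst false] ++ rep (mv src tmp) ++ rep (mv2 src tmp dst) ++ rep (mv tmp src).

(** The four guesses are the padding [k0], the offset [k1], the length [k2], and [k1 + k2] for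
    moving everything back from [tmp]. *)
Lemma LB_sub src dst k0 k1 k2 N T rest m F :
  ok src -> ok dst -> src != dst -> src != tmp -> dst != tmp -> clean m -> cl m tmp = [::] ->
  (k0 <= N)%N -> (k1 + k2 <= size (cl m src))%N -> (k1 + k2 <= N)%N -> 0 <= F ->
  LB T rest (setcl m dst
    (rev (take k2 (drop k1 (cl m src))) ++ nseq k0 false ++ cl m dst)) F ->
  LB (T + 4 * rep_time N) (sub_prog src dst ++ rest) m (rep_weight N ^+ 4 * F).
Proof.
move=> osrc odst sd st dt cm ct k0N ks kN F0 h.
have ot : ok tmp by [].
have w0 := ltW (rep_weight_gt0 N).
have -> : (T + 4 * rep_time N = T + rep_time N + rep_time N + rep_time N + rep_time N)%N by lia.
rewrite !exprS expr0 mulr1 -!mulrA /sub_prog -!catA.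
apply: (@LB_rep_push _ _ k0) => //; first by rewrite !mulr_ge0.
apply: (@LB_rep_mv _ _ k1) => //.
- exact: clean_setcl.
- by lia.
- by rewrite /= /upd (negPf sd); lia.
- by rewrite !mulr_ge0.
set m1 := setcl (setcl _ src _) tmp _.
have e1 : cl m1 src = drop k1 (cl m src).
  by rewrite /m1 /= /upd (negPf st) eqxx (negPf sd).
have e2 : cl m1 tmp = rev (take k1 (cl m src)).
  rewrite /m1 /= /upd (negPf sd) /= [9%N == dst]eq_sym (negPf dt) ct cats0.
  by [].
have e3 : cl m1 dst = nseq k0 false ++ cl m dst.
  by rewrite /m1 /= /upd (negPf dt) [dst == src]eq_sym (negPf sd) eqxx.
have c1 : clean m1 by do 3![apply: clean_setcl => //].
apply: (@LB_rep_mv2 _ _ _ k2) => //; [by rewrite eq_sym|by lia| |by rewrite !mulr_ge0|].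
  by rewrite e1 size_drop; lia.
rewrite e1 e2 e3; set m2 := setcl (setcl (setcl _ _ _) _ _) _ _.
have s2 : cl m2 src = drop k2 (drop k1 (cl m src)).
  by rewrite /m2 /= /upd (negPf sd) (negPf st) eqxx.
have t2 : cl m2 tmp = rev (take k1 (cl m src) ++ take k2 (drop k1 (cl m src))).
  by rewrite /m2 /= /upd [9%N == dst]eq_sym (negPf dt) rev_cat.
have sz : (k1 + k2 = size (take k1 (cl m src) ++ take k2 (drop k1 (cl m src))))%N.
  by rewrite size_cat !size_takel ?size_drop; lia.
have c2 : clean m2 by do 3![apply: clean_setcl => //].
apply: (@LB_rep_mv _ _ (k1 + k2)) => //; first by rewrite eq_sym.
  by rewrite t2 size_rev -sz.
rewrite t2 s2 drop_oversize ?size_rev -?sz // take_oversize ?size_rev -?sz // revK.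
rewrite -catA !cat_take_drop; move: h; congr LB; rewrite /m2 /m1; clear -st dt sd ct.
by mem_tac.
Qed.

Definition sample_prog a : prog := num_prog ++ [:: While cnt (Pop cnt :: coin a)].

Lemma LB_sample_loop a i T rest m (F : bits -> R) : ok a ->
  cl m cnt = nseq i true ->
  (forall s, size s = i -> LB T rest (setcl (setcl m cnt [::]) a (s ++ cl m a)) (F s)) ->
  LB (T + i * 5 + 1) (While cnt (Pop cnt :: coin a) :: rest) m
    ((2 ^+ i)^-1 * \sum_(s : i.-tuple bool) F s).
Proof.
rewrite /ok => oa; elim: i m F => [|i IH] m F hc h.
  rewrite mul0n addn0 addn1 expr0 invr1 mul1r sum_bits0; apply: LB_while0; first by rewrite hc.
  by move: (h [::] erefl); congr LB; mem_tac; rewrite hc.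
have -> : (T + i.+1 * 5 + 1 = (T + i * 5 + 1 + 3).+2)%N by lia.
apply: LB_while1; first by rewrite hc.
apply: LB_pop; rewrite hc /=.
(* Coins are pushed, so the first one tossed becomes the last bit of the sample. *)
have -> : (2 ^+ i.+1)^-1 * (\sum_(s : i.+1.-tuple bool) F s) =
  2^-1 * ((2 ^+ i)^-1 * (\sum_(s : i.-tuple bool) F (s ++ [:: false])) +
          (2 ^+ i)^-1 * (\sum_(s : i.-tuple bool) F (s ++ [:: true]))).
  rewrite -mulrDr mulrA -invfM -exprS; congr (_ * _).
  rewrite -addn1 (sum_bits_cat _ _ F) -big_split /=; apply: eq_bigr => s _.
  by rewrite (sum_bits1 (fun t => F (s ++ t))).
have step b : LB (T + i * 5 + 1) (While cnt (Pop cnt :: coin a) :: rest)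
    (setcl (setcl m cnt (nseq i true)) a (b :: cl (setcl m cnt (nseq i true)) a))
    ((2 ^+ i)^-1 * \sum_(s : i.-tuple bool) F (s ++ [:: b])).
  apply: (IH _ (fun s => F (s ++ [:: b]))) => [|s ss].
    by rewrite /= /upd; case: eqP => // e; exfalso; lia.
  have := h (s ++ [:: b]); rewrite size_cat addn1 ss => /(_ erefl); congr LB.
  by mem_tac; rewrite -catA.
by apply: LB_coin; apply: step.
Qed.

Lemma LB_sample a L N T rest m (F : bits -> R) : ok a -> clean m -> (L <= N)%N ->
  (forall s, 0 <= F s) ->
  (forall s, size s = L -> LB T rest (setcl m a (s ++ cl m a)) (F s)) ->
  LB (T + rep_time N) (sample_prog a ++ rest) m
    (rep_weight N * ((2 ^+ L)^-1 * \sum_(s : L.-tuple bool) F s)).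
Proof.
move=> oa cm LN F0 h; have [m1 m2 m3 m4] := cm.
have S0 : 0 <= (2 ^+ L)^-1 * \sum_(s : L.-tuple bool) F s.
  by rewrite mulr_ge0 ?invr_ge0 ?exprn_ge0 //; apply: sumr_ge0.
apply: (@LB_le (T + L * 5 + 1 + 40 * L + 5) _ _ _
   (num_weight L * (2^-1 * ((2 ^+ L)^-1 * \sum_(s : L.-tuple bool) F s)))).
- rewrite /rep_time; lia.
- by rewrite [leRHS]mulrA ler_wpM2r // rep_weight_le.
rewrite -catA; apply: LB_num => //; apply: LB_sample_loop => // s ss.
move: (h s ss); move: oa; rewrite /ok => oa; congr LB; mem_tac.
Qed.

End Gadgets.

(** * Clocked simulation of a program *)

Notation wst := 10%N (only parsing).
Notation mst := 11%N (only parsing).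

(** Bounds, hereditarily, the code that one step may put in front of the continuation; a loop puts
    back its body and itself, hence the successor. *)
Fixpoint branch_size (i : instr) : nat :=
  let bs := fix bs (c : prog) := if c is i :: c' then maxn (branch_size i) (bs c') else 0%N in
  match i with
  | Case a c1 c0 ce => maxn (maxn (size c1) (bs c1))
      (maxn (maxn (size c0) (bs c0)) (maxn (size ce) (bs ce)))
  | While a c => maxn (size c).+1 (bs c)
  | _ => 0
  end.

Fixpoint prog_branch_size (c : prog) : nat :=
  if c is i :: c' then maxn (branch_size i) (prog_branch_size c') else 0%N.

Lemma branch_size_Case a c1 c0 ce : branch_size (Case a c1 c0 ce) =
  maxn (maxn (size c1) (prog_branch_size c1))
    (maxn (maxn (size c0) (prog_branch_size c0)) (maxn (size ce) (prog_branch_size ce))).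
Proof. by []. Qed.

Lemma branch_size_While a c : branch_size (While a c) = maxn (size c).+1 (prog_branch_size c).
Proof. by []. Qed.

Lemma prog_branch_size_cat c c' : prog_branch_size (c ++ c') =
  maxn (prog_branch_size c) (prog_branch_size c').
Proof. by elim: c => [|i c IH] /=; rewrite ?max0n // IH maxnA. Qed.

(* [trs c] runs [c] on renamed stacks, popping one symbol of [tc] before each step;
   once [tc] is empty the remaining code is skipped. The flag [wst] stands for
   the test of a loop, which must fail when the clock has run out. *)
Section Translation.
Context (R : realType) (P : mem -> R) (P_ge0 : forall m, 0 <= P m).
Context (rc rq : nat -> nat) (tc : nat) (qcode : nat -> nat -> prog).
Context (X Y : nat -> Prop).
Hypotheses (rc_inj : injective rc) (rq_inj : injective rq).
Hypotheses (X_rc : forall i, X (rc i)) (Y_rq : forall i, Y (rq i)).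
Hypotheses (X_tc : X tc) (rc_tc : forall i, rc i != tc) (X_w : ~ X wst).
Implicit Types (psi : qstate R) (m M : mem) (c rest : prog) (T : nat).
Local Notation Vh := (@Vh R P).

Definition tick p : instr := Case tc (Pop tc :: p) [::] [::].

Fixpoint tr (i : instr) : prog :=
  let trs := fix trs (c : prog) := if c is i :: c' then tr i ++ trs c' else [::] in
  match i with
  | Push a b => [:: tick [:: Push (rc a) b]]
  | Pop a => [:: tick [:: Pop (rc a)]]
  | Case a c1 c0 ce => [:: tick [:: Case (rc a) (trs c1) (trs c0) (trs ce)]]
  | While a c =>
      let check := tick [:: Case (rc a) [:: Push wst true] [::] [::]] in
      [:: check; While wst (Pop wst :: trs c ++ [:: check])]
  | New x => [:: tick [:: New (rq x)]]
  | Move x y => [:: tick [:: Move (rq x) (rq y)]]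
  | Had x => [:: tick [:: Had (rq x)]]
  | Tee x => [:: tick [:: Tee (rq x)]]
  | Cnot x y => [:: tick [:: Cnot (rq x) (rq y)]]
  | Meas x a => [:: tick [:: Meas (rq x) (rc a)]]
  | Query x y => [:: tick (if x == y then [::] else qcode x y)]
  end.

Fixpoint trs c : prog := if c is i :: c' then tr i ++ trs c' else [::].

Lemma tr_Case a c1 c0 ce : tr (Case a c1 c0 ce) =
  [:: tick [:: Case (rc a) (trs c1) (trs c0) (trs ce)]].
Proof. by []. Qed.

Definition check a : instr := tick [:: Case (rc a) [:: Push wst true] [::] [::]].

Lemma tr_While a c : tr (While a c) =
  [:: check a; While wst (Pop wst :: trs c ++ [:: check a])].
Proof. by []. Qed.

Lemma trs_cat c c' : trs (c ++ c') = trs c ++ trs c'.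
Proof. by elim: c => [|i c IH] //=; rewrite IH catA. Qed.

Definition pull M : mem := Mem (fun i => cl M (rc i)) (fun i => qu M (rq i)).

Definition frame M M' : Prop :=
  (forall j, ~ X j -> cl M' j = cl M j) /\ (forall j, ~ Y j -> qu M' j = qu M j).

Lemma frame_refl M : frame M M.
Proof. by []. Qed.

Lemma frame_trans M1 M2 M3 : frame M1 M2 -> frame M2 M3 -> frame M1 M3.
Proof. by move=> [a b] [a' b']; split=> j h; rewrite ?a' ?b' ?a ?b. Qed.

Lemma frame_cl M a v : X a -> frame M (setcl M a v).
Proof.
by move=> h; split=> // j nj /=; rewrite /upd; case: eqP => // e; case: nj; rewrite e.
Qed.

Lemma frame_qu M a v : Y a -> frame M (setqu M a v).
Proof.
by move=> h; split=> // j nj /=; rewrite /upd; case: eqP => // e; case: nj; rewrite e.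
Qed.

Lemma pull_cl M a v : pull (setcl M (rc a) v) = setcl (pull M) a v.
Proof. by apply: mem_ext => j //=; rewrite /upd (inj_eq rc_inj). Qed.

Lemma pull_qu M a v : pull (setqu M (rq a) v) = setqu (pull M) a v.
Proof. by apply: mem_ext => j //=; rewrite /upd (inj_eq rq_inj). Qed.

Lemma pull_out M a v : (forall i, rc i != a) -> pull (setcl M a v) = pull M.
Proof. by move=> h; apply: mem_ext => j //=; rewrite /upd (negPf (h j)). Qed.

Lemma tc_w : tc != wst.
Proof. by apply/eqP => e; apply: X_w; rewrite -e. Qed.

Lemma Vh_le_det T i rest M p M' psi x : @step R no_oracle i M = ret (p, M') ->
  x <= Vh T (p ++ rest) M' psi -> x <= Vh T.+1 (i :: rest) M psi.
Proof. by move=> e; rewrite (Vh_det _ _ _ _ e). Qed.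

Lemma Vh_le_case T a c1 c0 ce rest M psi x :
  x <= Vh T ((match cl M a with
             | true :: _ => c1 | false :: _ => c0 | [::] => ce end) ++ rest) M psi ->
  x <= Vh T.+1 (Case a c1 c0 ce :: rest) M psi.
Proof. exact: Vh_le_det. Qed.

Lemma Vh_le_push T a b rest M psi x :
  x <= Vh T rest (setcl M a (b :: cl M a)) psi -> x <= Vh T.+1 (Push a b :: rest) M psi.
Proof. by apply: (@Vh_le_det _ _ _ _ [::]). Qed.

Lemma Vh_le_pop T a rest M psi x :
  x <= Vh T rest (setcl M a (behead (cl M a))) psi -> x <= Vh T.+1 (Pop a :: rest) M psi.
Proof. by apply: (@Vh_le_det _ _ _ _ [::]). Qed.

Lemma Vh_le_while T a body rest M psi x :
  x <= Vh T (if head false (cl M a) then body ++ While a body :: rest else rest) M psi ->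
  x <= Vh T.+1 (While a body :: rest) M psi.
Proof.
move=> h; apply: Vh_le_det; first by [].
by move: h; case: (head _ _); rewrite //= cat_rcons.
Qed.

Lemma Vh_le_tick T p rest M tl psi x : cl M tc = true :: tl ->
  x <= Vh T (p ++ rest) (setcl M tc tl) psi ->
  x <= Vh T.+2 (tick p :: rest) M psi.
Proof. by move=> e h; apply: Vh_le_case; rewrite e; apply: Vh_le_pop; rewrite e. Qed.

Definition rename_atom (i : instr) : option instr :=
  match i with
  | Push a b => Some (Push (rc a) b) | Pop a => Some (Pop (rc a))
  | New x => Some (New (rq x)) | Move x y => Some (Move (rq x) (rq y))
  | Had x => Some (Had (rq x)) | Tee x => Some (Tee (rq x))
  | Cnot x y => Some (Cnot (rq x) (rq y)) | Meas x a => Some (Meas (rq x) (rc a))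
  | Case _ _ _ _ | While _ _ | Query _ _ => None
  end.

Lemma tr_atom i ri rest T M psi (K : prog * mem -> qstate R -> R) :
  rename_atom i = Some ri ->
  (forall M' psi', frame M M' -> cl M' tc = cl M tc ->
    K ([::], pull M') psi' <= Vh T rest M' psi') ->
  E (step no_oracle i (pull M)) psi K <= Vh T.+1 (ri :: rest) M psi.
Proof.
rewrite [Vh _ _ _ _]/=.
have ft a v : cl (setcl M (rc a) v) tc = cl M tc.
  by rewrite /= /upd eq_sym (negPf (rc_tc a)).
case: i => [a b|a|a c1 c0 ce|a c|x|x y|x|x|x y|x a|x y] //= [<-] hK; rewrite /E /=.
- by rewrite !big_seq1 -pull_cl; apply: hK => //; apply: frame_cl.
- by rewrite !big_seq1 -pull_cl; apply: hK => //; apply: frame_cl.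
- by rewrite !big_seq1 -pull_qu; apply: hK => //; apply: frame_qu.
- case: (qu M (rq x)) => [|q qs]; rewrite !big_seq1 /=; first exact: hK.
  rewrite -pull_qu -[upd _ _ _ y]/(qu (setqu (pull M) x qs) y) -pull_qu -pull_qu.
  by apply: hK => //; apply: frame_trans (frame_qu _ _ _) (frame_qu _ _ _).
- by case: (qu M (rq x)) => [|q qs]; rewrite !big_seq1 /=; apply: hK.
- by case: (qu M (rq x)) => [|q qs]; rewrite !big_seq1 /=; apply: hK.
- rewrite (inj_eq rq_inj); case: (x == y); first by rewrite !big_seq1; apply: hK.
  case: (qu M (rq x)) => [|q qs]; first by rewrite !big_seq1; apply: hK.
  by case: (qu M (rq y)) => [|q' qs']; rewrite !big_seq1 /=; apply: hK.
- case: (qu M (rq x)) => [|q qs]; first by rewrite !big_seq1; apply: hK.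
  rewrite !big_cons !big_nil !addr0 /= -!pull_qu -!pull_cl.
  by apply: lerD; (apply: hK; last exact: (ft a)); apply: frame_trans (frame_qu _ _ _) (frame_cl _ _ _).
Qed.

(** The 6 is reached by a loop: two steps of [tick], the test, the push of the flag, the loop test
    and its pop. Queries are left to the hypothesis on [qcode], with the 4 steps that [tick]
    leaves. *)
Lemma tr_step i rest T M tl psi (K : prog * mem -> qstate R -> R) :
  cl M tc = true :: tl -> cl M wst = [::] ->
  (forall o M' psi', frame M M' -> cl M' tc = tl -> pull M' = o.2 ->
    (size o.1 <= branch_size i)%N -> (prog_branch_size o.1 <= branch_size i)%N ->
    K o psi' <= Vh T (trs o.1 ++ rest) M' psi') ->
  (forall x y, i = Query x y -> x != y ->
    K ([::], pull M) psi <= Vh (T + 4) (qcode x y ++ rest) (setcl M tc tl) psi) ->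
  E (step no_oracle i (pull M)) psi K <= Vh (T + 6) (tr i ++ rest) M psi.
Proof.
move=> htc hw hK hQ; set M1 := setcl M tc tl.
have f1 : frame M M1 by apply: frame_cl.
have p1 : pull M1 = pull M by apply: pull_out.
have t1 : cl M1 tc = tl by rewrite /= /upd eqxx.
have atom j rj : rename_atom j = Some rj -> branch_size j = 0%N -> j = i -> E (step no_oracle j (pull M)) psi K <=
   Vh (T + 6) (tick [:: rj] :: rest) M psi.
  move=> e b0 ji; apply: (le_trans _ (Vh_mono P_ge0 (T := T.+3) _ _ _ _)); last lia.
  apply: (Vh_le_tick htc); rewrite -/M1 -p1; apply: tr_atom e _ => M' psi' f2 t2.
  apply: (hK ([::], pull M') M') => //; last by rewrite t2.
  exact: frame_trans f2.
case: i hK hQ atom => [a b|a|a c1 c0 ce|a c|x|x y|x|x|x y|x a|x y] hK hQ atom;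
  try by apply: atom.
- rewrite tr_Case cat_cons cat0s E_ret.
  apply: (le_trans _ (Vh_mono P_ge0 (T := T.+3) _ _ _ _)); last lia.
  apply: (Vh_le_tick htc); rewrite -/M1; apply: Vh_le_case.
  have e : cl M1 (rc a) = cl (pull M) a by rewrite -p1.
  rewrite e; have h p := hK (p, pull M) M1 psi f1 t1 p1; move: h; rewrite branch_size_Case => h.
  by case: (cl (pull M) a) => [|[] s]; apply: h; rewrite !leq_max ?leqnn ?orbT.
- rewrite tr_While 2!cat_cons cat0s E_ret.
  apply: (le_trans _ (Vh_mono P_ge0 (T := T.+4.+2) _ _ _ _)); last lia.
  apply: (Vh_le_tick htc); rewrite -/M1 cat_cons cat0s; apply: Vh_le_case.
  have e : cl M1 (rc a) = cl (pull M) a by rewrite -p1.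
  have w1 : cl M1 wst = [::] by rewrite /= /upd eq_sym (negPf tc_w).
  rewrite e; have h p := hK (p, pull M) M1 psi f1 t1 p1; move: h; rewrite branch_size_While => h.
  case: (cl (pull M) a) => [|[] s].
  - apply: Vh_le_while; rewrite w1; apply: le_trans (h [::] _ _) _ => //.
    by apply: Vh_mono => //; lia.
  - apply: Vh_le_push; apply: Vh_le_while; rewrite [head _ _]/= cat_cons.
    apply: Vh_le_pop; have -> : setcl (setcl M1 wst (true :: cl M1 wst)) wst
       (behead (cl (setcl M1 wst (true :: cl M1 wst)) wst)) = M1.
      by clear -w1; clearbody M1; mem_tac; rewrite w1.
    rewrite -catA -[[:: check a] ++ _]/(tr (While a c) ++ rest) catA.
    (* The check that ends the body, followed by the loop, is the translation of the loop; so the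
       code is again a translation, in the shape that [step] produces. *)
    have -> : trs c ++ tr (While a c) = trs (rcons c (While a c)).
      by rewrite -cats1 trs_cat [trs [:: _]]/trs cats0.
    apply: h; first by rewrite size_rcons leq_max leqnn.
    rewrite -cats1 prog_branch_size_cat.
    have -> : prog_branch_size [:: While a c] = maxn (branch_size (While a c)) 0 by [].
    by rewrite branch_size_While; lia.
  - apply: Vh_le_while; rewrite w1; apply: le_trans (h [::] _ _) _ => //.
    by apply: Vh_mono => //; lia.
- rewrite /E [step _ _ _]/= [tr _]/=; case: (eqVneq x y) => [exy|nxy].
    rewrite big_seq1; apply: (le_trans _ (Vh_mono P_ge0 (T := T.+2) _ _ _ _)); last lia.
    apply: (Vh_le_tick htc); apply: (hK ([::], pull M) M1) => //.
  rewrite big_seq1 /= xor_query_no_oracle.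
  have -> : (T + 6 = (T + 4).+2)%N by lia.
  by apply: (Vh_le_tick htc); apply: hQ.
Qed.

(** An instruction is skipped by its [tick]; a loop needs one more step, for the test on the empty
    flag. *)
Lemma tr_flush c rest T M psi : cl M tc = [::] -> cl M wst = [::] ->
  Vh T rest M psi <= Vh (T + 2 * size c) (trs c ++ rest) M psi.
Proof.
move=> ht hw; elim: c => [|i c IH]; first by rewrite muln0 addn0.
have key p : Vh T rest M psi <= Vh (T + 2 * size c).+1 (tick p :: trs c ++ rest) M psi.
  by apply: Vh_le_case; rewrite ht.
have -> : (T + 2 * size (i :: c) = (T + 2 * size c).+2)%N by rewrite /=; lia.
have [[a [d e]]|[p e]] : (exists a d, i = While a d) \/ exists p, tr i = [:: tick p].
- by case: i => *; by [right; eexists|left; do 2!eexists].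
- rewrite e [trs _]/trs -/(trs c) tr_While 2!cat_cons; apply: Vh_le_case; rewrite ht.
  by apply: Vh_le_while; rewrite hw.
- rewrite [trs _]/trs -/(trs c) e; apply: le_trans (key p) _; exact: Vh_leS.
Qed.

(** Six steps per simulated step, then two per instruction left over; each of the [t] steps adds at
    most [D] instructions. *)
Definition tr_time (D t : nat) (c : prog) : nat := 6 * t + 2 * (size c + t * D).

Lemma tr_time_step D t c i (o : prog) : (size o <= D)%N ->
  (tr_time D t (o ++ c) + 6 <= tr_time D t.+1 (i :: c))%N.
Proof. by rewrite /tr_time size_cat /= => h; nia. Qed.

(** The clocked copy always reaches [rest], by skipping what remains when the clock is empty, even
    if the truncated run was cut in the middle. *)
Lemma tr_run D t c rest T M psi (G : mem -> qstate R -> R) :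
  (forall x y, qcode x y = [::]) -> cl M tc = nseq t true -> cl M wst = [::] ->
  (prog_branch_size c <= D)%N ->
  (forall M' psi', frame M M' -> G (pull M') psi' <= Vh T rest M' psi') ->
  E (exec no_oracle t c (pull M)) psi G <= Vh (T + tr_time D t c) (trs c ++ rest) M psi.
Proof.
move=> hq; elim: t c M psi => [|t IH] [|i c] M psi ht hw hD h.
- rewrite exec_nil E_ret; apply: le_trans (h _ _ (frame_refl M)) _.
  by apply: Vh_mono => //; lia.
- rewrite E_ret; apply: le_trans (h _ _ (frame_refl M)) _.
  apply: le_trans (tr_flush (i :: c) rest T psi ht hw) _.
  by apply: Vh_mono => //; rewrite /tr_time; lia.
- rewrite exec_nil E_ret; apply: le_trans (h _ _ (frame_refl M)) _.
  by apply: Vh_mono => //; lia.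
rewrite E_execS.
have hD' : (branch_size i <= D)%N /\ (prog_branch_size c <= D)%N.
  by move: hD; rewrite geq_max => /andP.
have key o M' psi' : frame M M' -> cl M' tc = nseq t true -> pull M' = o.2 ->
    (size o.1 <= branch_size i)%N -> (prog_branch_size o.1 <= branch_size i)%N ->
    E (exec no_oracle t (o.1 ++ c) o.2) psi' G <=
    Vh (T + tr_time D t.+1 (i :: c) - 6) (trs o.1 ++ trs c ++ rest) M' psi'.
  move=> f t' <- s1 s2; rewrite catA -trs_cat.
  apply: le_trans (IH _ _ _ t' _ _ _) _.
  - by case: f => -> .
  - by rewrite prog_branch_size_cat; lia.
  - by move=> M2 psi2 f2; apply: h; apply: frame_trans f2.
  by apply: Vh_mono => //; have := @tr_time_step D t c i o.1; lia.
have t6 : (6 <= tr_time D t.+1 (i :: c))%N by rewrite /tr_time; lia.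
have -> : (T + tr_time D t.+1 (i :: c) = (T + tr_time D t.+1 (i :: c) - 6) + 6)%N by lia.
rewrite [trs _]/trs -/(trs c) -catA.
apply: (tr_step ht hw key) => x y _ _; rewrite hq.
have f1 : frame M (setcl M tc (nseq t true)) by apply: frame_cl.
apply: le_trans (key ([::], pull M) _ psi f1 _ _ _ _) _ => //.
- by rewrite /= /upd eqxx.
- exact: pull_out.
by apply: Vh_mono => //; lia.
Qed.

End Translation.

(** * Measuring the query made at a chosen step *)

Section Measurement.
Context (R : realType) (P : mem -> R) (P_ge0 : forall m, 0 <= P m).
Context (rc rq : nat -> nat) (tc out : nat) (X Y : nat -> Prop).
Hypotheses (rc_inj : injective rc) (rq_inj : injective rq).
Hypotheses (X_rc : forall i, X (rc i)) (Y_rq : forall i, Y (rq i)).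
Hypotheses (X_tc : X tc) (rc_tc : forall i, rc i != tc) (X_w : ~ X wst) (X_m : ~ X mst).
Hypotheses (X_out : ~ X out) (out_w : out != wst) (out_m : out != mst).
Implicit Types (psi : qstate R) (m M : mem) (c rest : prog) (T : nat).
Local Notation Vh := (@Vh R P).
Local Notation X' := (fun j => X j \/ j = out).

Lemma frame_weak M M' : frame X Y M M' -> frame X' Y M M'.
Proof. by move=> [f1 f2]; split=> // j h; apply: f1 => hx; apply: h; left. Qed.

(* When the clock runs out at a query, the input register is measured onto
   [out]; at other queries nothing is done. *)
Definition measure_code x : prog :=
  [:: Push wst true; While wst [:: Pop wst; Meas (rq x) mst;
        Case mst [:: Pop mst; Push out true; Push wst true]
                 [:: Pop mst; Push out false; Push wst true] [::]]].

Definition qmeasure (x y : nat) : prog := [:: Case tc [::] [::] (measure_code x)].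

(** A round takes 7 steps: test, pop, measurement, case, pop and two pushes. On an empty register
    the round leaves the flag empty; it takes 5 steps with the failing test. *)
Lemma measure_loop x xs rest T M0 M psi (g : bits -> R) (acc : bits) :
  qu M (rq x) = xs -> cl M wst = [:: true] -> cl M mst = [::] -> cl M out = acc ->
  cl M0 wst = [::] ->
  frame X' Y M0 (setcl M wst [::]) -> cl M tc = cl M0 tc ->
  (forall M' psi' u, size u = size xs -> frame X' Y M0 M' -> cl M' tc = cl M0 tc ->
    cl M' out = rev u ++ acc -> g u * sqnorm psi' <= Vh T rest M' psi') ->
  mass g xs psi <= Vh (T + 7 * size xs + 5)
    (While wst [:: Pop wst; Meas (rq x) mst;
        Case mst [:: Pop mst; Push out true; Push wst true]
                 [:: Pop mst; Push out false; Push wst true] [::]] :: rest) M psi.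
Proof.
have wo : (wst == out) = false by rewrite eq_sym (negPf out_w).
have mo : (mst == out) = false by rewrite eq_sym (negPf out_m).
have wt := tc_w X_tc X_w.
have tc_out : tc != out by apply/eqP => e; apply: X_out; rewrite -e.
have mt : tc != mst by apply/eqP => e; apply: X_m; rewrite -e.
set body := [:: Pop wst; _; _].
elim: xs M psi g acc => [|q qs IH] M psi g acc hx hw hm ho hw0 f ht h.
  have -> : (T + 7 * size ([::] : seq nat) + 5 = T.+4.+1)%N by rewrite /=; lia.
  apply: Vh_le_while; rewrite hw [head _ _]/= [body ++ _]cat_cons; apply: Vh_le_pop.
  rewrite hw [behead _]/=; set M1 := setcl M wst [::] in f *.
  rewrite 2!cat_cons; apply: (@Vh_le_det _ _ _ _ _ _ [::] M1); first by rewrite /= hx.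
  apply: Vh_le_case; rewrite [cl M1 mst]hm; apply: Vh_le_while.
  have -> : head false (cl M1 wst) = false by [].
  rewrite (_ : mass g [::] psi = g [::] * sqnorm psi); last first.
    by rewrite /mass /sqnorm mulr_sumr.
  apply: h => //=; first by rewrite /upd (negPf wt).
  by rewrite /upd (negPf out_w).
have -> : (T + 7 * size (q :: qs) + 5 = (T + 7 * size qs + 5).+4.+3)%N by rewrite /=; lia.
apply: Vh_le_while; rewrite hw [head _ _]/= [body ++ _]cat_cons; apply: Vh_le_pop.
rewrite hw [behead _]/=; set M1 := setcl M wst [::] in f *.
rewrite [Vh _ _ _ _]/= hx /= [X in _ <= X]/E /= !big_cons big_nil addr0 /=.
have branch b : mass (fun u => g (b :: u)) qs (project q b psi) <=
    Vh (T + 7 * size qs + 5).+4 (Case mst [:: Pop mst; Push out true; Push wst true]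
                 [:: Pop mst; Push out false; Push wst true] [::] :: While wst body :: rest)
      (setcl (setqu M1 (rq x) qs) mst (b :: cl M mst)) (project q b psi).
  apply: Vh_le_case; have e0 : cl (setcl (setqu M1 (rq x) qs) mst (b :: cl M mst)) mst = [:: b].
    by rewrite /= /upd hm.
  rewrite e0.
  set M2 := setcl _ mst _ in e0 *.
  set M3 := setcl (setcl (setcl M2 mst [::]) out (b :: acc)) wst [:: true].
  have key : mass (fun u => g (b :: u)) qs (project q b psi) <=
     Vh (T + 7 * size qs + 5) (While wst body :: rest) M3 (project q b psi).
    apply: (IH M3 _ _ (b :: acc)) => //.
    - by rewrite /= /upd eqxx.
    - by rewrite /= /upd mo.
    - by rewrite /= /upd (negPf out_w) eqxx.
    - apply: frame_trans f _; split=> j nj; rewrite /= /upd.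
        have -> : (j == out) = false by apply/eqP => e; apply: nj; right.
        by case: (j =P wst) => //= _; case: (j =P mst) => [->|].
      by case: eqP => // e; case: nj; rewrite e.
    - by rewrite /= /upd (negPf wt) (negPf tc_out) (negPf mt).
    move=> M' psi' u su f' t' o'; apply: (h M' psi' (b :: u)) => //=; first by rewrite su.
    by rewrite o' rev_cons cat_rcons.
  have e3 v : setcl (setcl (setcl M2 mst [::]) out (v :: acc)) wst [:: true] =
      setcl (setcl (setcl M2 mst (behead (cl M2 mst))) out
        (v :: cl (setcl M2 mst (behead (cl M2 mst))) out)) wst
        (true :: cl (setcl (setcl M2 mst (behead (cl M2 mst))) out
        (v :: cl (setcl M2 mst (behead (cl M2 mst))) out)) wst).
    rewrite e0 [behead _]/=.
    have -> : cl (setcl M2 mst [::]) out = acc by rewrite /= /upd (negPf out_m) (negPf out_w).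
    by congr setcl; rewrite /= /upd wo.
  have -> : (if b then [:: Pop mst; Push out true; Push wst true]
     else [:: Pop mst; Push out false; Push wst true]) = [:: Pop mst; Push out b; Push wst true].
    by case: (b).
  rewrite 3!cat_cons cat0s; apply: Vh_le_pop; apply: Vh_le_push; apply: Vh_le_push.
  by rewrite -e3.
rewrite -(mass_project g (q :: qs) q psi).
have em b : mass g (q :: qs) (project q b psi) = mass (fun u => g (b :: u)) qs (project q b psi).
  by apply: eq_bigr => d _ /=; case: eqP => [->//|_]; rewrite sqmod0 !mulr0.
by rewrite !em; apply: lerD; apply: branch.
Qed.

(** A clock of [t.+1] symbols runs out at the [tick] of the step numbered [t] from 0: that query is
    measured and all later code is skipped. Restricting [g] to length [N0] bounds the time of the
    measurement. *)
Lemma tr_measure D t c rest T M psi (g : bits -> R) N0 :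
  cl M tc = nseq t.+1 true -> cl M wst = [::] -> cl M mst = [::] -> cl M out = [::] ->
  (prog_branch_size c <= D)%N -> (forall u, 0 <= g u) -> (forall u, size u <> N0 -> g u = 0) ->
  (forall M' psi' u, size u = N0 -> frame X' Y M M' -> cl M' out = rev u ->
    g u * sqnorm psi' <= Vh T rest M' psi') ->
  qmass g t c (pull rc rq M) psi <=
  Vh (T + tr_time D t.+1 c + 7 * N0 + 10) (trs rc rq tc qmeasure c ++ rest) M psi.
Proof.
elim: t c M psi => [|t IH] [|i c] M psi ht hw hm ho hD g0 gN h;
  try exact: Vh_ge0.
  rewrite [qmass _ _ _ _ _]/= /qm; case ei : (query_regs i) => [[x y]|]; last exact: Vh_ge0.
  have [ii nxy] : i = Query x y /\ x != y.
    by move: ei; case: (i) => //= x' y'; case: eqP => // /eqP ? [<- <-].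
  rewrite ii [trs _ _ _ _ _]/trs -/(trs rc rq tc qmeasure c) -catA [tr _ _ _ _ _]/= (negPf nxy) [qmeasure x y]/qmeasure.
  have [sN|sN] := eqVneq (size (qu (pull rc rq M) x)) N0; last first.
    rewrite /mass big1 ?Vh_ge0 // => b _; rewrite gN ?mul0r // size_map; exact/eqP.
  have -> : (T + tr_time D 1 (Query x y :: c) + 7 * N0 + 10 =
      ((T + tr_time D 1 (Query x y :: c) + 7 * N0 + 6).+4))%N by lia.
  apply: (Vh_le_tick ht); rewrite -/(nseq 0 true); set M1 := setcl M tc [::].
  apply: Vh_le_case; have -> : cl M1 tc = [::] by rewrite /= /upd eqxx.
  rewrite 2!cat_cons; apply: Vh_le_push.
  apply: le_trans (_ : _ <= Vh (T + 2 * size c + 7 * N0 + 5) _ _ _) _; last first.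
    by apply: Vh_mono => //; rewrite /tr_time /=; lia.
  have wt := tc_w X_tc X_w.
  have tc_out : tc != out by apply/eqP => e; apply: X_out; rewrite -e.
  have wo := negPf out_w.
  have mt : tc != mst by apply/eqP => e; apply: X_m; rewrite -e.
  have w1 : cl M1 wst = [::] by rewrite /= /upd eq_sym (negPf wt).
  have f1 : frame X Y M M1 by apply: frame_cl.
  rewrite -sN; apply: (@measure_loop x _ _ _ M1 _ psi g [::]) => //.
  - by rewrite w1.
  - by rewrite /= /upd [mst == tc]eq_sym (negPf mt).
  - by rewrite /= /upd wo [out == tc]eq_sym (negPf tc_out).
  - by split=> // j nj; rewrite /= /upd; case: eqP => // ->.
  - by rewrite /= /upd (negPf wt).
  move=> M' psi' u su f' t' o'; apply: le_trans (tr_flush P_ge0 rc rq qmeasure c rest T _ _ _).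
  - by apply: h; rewrite ?su //; [apply: frame_trans (frame_weak f1) f'|rewrite o' cats0].
  - by rewrite t' /= /upd eqxx.
  - by case: f' => -> //; case=> [//|e]; move: out_w; rewrite -e.
rewrite [qmass _ _ _ _ _]/=.
have hD' : (branch_size i <= D)%N /\ (prog_branch_size c <= D)%N.
  by move: hD; rewrite geq_max => /andP.
have t6 : (6 <= tr_time D t.+2 (i :: c))%N by rewrite /tr_time; lia.
have key o M' psi' : frame X Y M M' -> cl M' tc = nseq t.+1 true -> pull rc rq M' = o.2 ->
    (size o.1 <= branch_size i)%N -> (prog_branch_size o.1 <= branch_size i)%N ->
    qmass g t (o.1 ++ c) o.2 psi' <=
    Vh (T + tr_time D t.+2 (i :: c) + 7 * N0 + 10 - 6)
       (trs rc rq tc qmeasure o.1 ++ trs rc rq tc qmeasure c ++ rest) M' psi'.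
  move=> f t' <- s1 s2; rewrite catA -trs_cat.
  apply: le_trans (IH _ _ _ t' _ _ _ _ g0 gN _) _.
  - by case: f => -> .
  - by case: f => -> .
  - by case: f => -> .
  - by rewrite prog_branch_size_cat; lia.
  - move=> M2 psi2 u su f2; apply: h => //; apply: frame_trans f2; exact: frame_weak.
  by apply: Vh_mono => //; have := @tr_time_step D t.+1 c i o.1; lia.
have -> : (T + tr_time D t.+2 (i :: c) + 7 * N0 + 10 =
    (T + tr_time D t.+2 (i :: c) + 7 * N0 + 10 - 6) + 6)%N by lia.
rewrite [trs _ _ _ _ _]/trs -/(trs rc rq tc qmeasure c) -catA.
apply: (tr_step P_ge0 rc_inj rq_inj X_rc Y_rq X_tc rc_tc X_w ht hw key) => x y _ _.
have f1 : frame X Y M (setcl M tc (nseq t.+1 true)) by apply: frame_cl.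
have t1 : cl (setcl M tc (nseq t.+1 true)) tc = nseq t.+1 true by rewrite /= /upd eqxx.
rewrite addn4 cat_cons cat0s; apply: Vh_le_case; rewrite t1.
apply: le_trans (key ([::], pull rc rq M) _ psi f1 t1 _ _ _) _ => //.
  exact: pull_out.
by apply: Vh_mono => //; lia.
Qed.

End Measurement.

(** * The reduction *)

(* Renaming for the [k]-th of four memories: the stack 0 is placed at [z], the
   others at the indices above 31 congruent to [k] modulo 4. *)
Definition ren (z k i : nat) : nat := if i is i'.+1 then (32 + 4 * i' + k)%N else z.

Definition ren_dom (z k tc j : nat) : Prop :=
  j = z \/ j = tc \/ exists i, j = (32 + 4 * i + k)%N.

Lemma ren_inj z k : (z < 32)%N -> injective (ren z k).
Proof. by move=> hz [|i] [|j] //=; lia. Qed.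

Lemma ren_domP z k tc i : ren_dom z k tc (ren z k i).
Proof. by case: i => [|i]; [left|right; right; exists i]. Qed.

Lemma ren_domN z k tc j : j <> z -> j <> tc -> (forall i, j <> (32 + 4 * i + k)%N) ->
  ~ ren_dom z k tc j.
Proof. by move=> nz nt h [/nz|[/nt|[i /h]]]. Qed.

(** Stacks still empty when [copy_prog] starts: outputs and scratch, the clocks of the two runs of
    B, the stacks 22 to 31, and those of the memories 2 and 3. *)
Definition idle (j : nat) : bool :=
  [|| (j < 12)%N, (14 < j < 17)%N, (21 < j < 32)%N | (31 < j)%N && (1 < j %% 4)%N].

Definition quidle (j : nat) : bool :=
  [|| j == 3%N, j == 4%N | (31 < j)%N && (1 < j %% 4)%N].

(** The simulated game is the one without oracle, where a query changes nothing. *)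
Definition skip_query (x y : nat) : prog := [::].

(* Layout of the classical stacks: 0-4 outputs, 12-16 guessed clocks, 17 input of
   A1, 18-19 copies of the public parameters, 20 shared stack 0 of A2, 21 stack 0
   of KeyGen, 22 the verification key, 23-24 copies of [st], 25-26 the measured
   queries, 27-28 stacks 0 of the two runs of B, 33-35 stacks 1 of KeyGen and B,
   38-39 stacks 2 of B, holding the two keys. The memory of A1 is continued by
   A2, whose quantum stack 0 is that of KeyGen. *)
Definition pre_prog (rest : prog) : prog :=
  rep (mv 0 17) ++ rep (mv2 1 18 19) ++ rep (mv 18 20) ++ rep (mv 19 33) ++
  rep [:: Push 21 true] ++ rep [:: Push 12 true] ++ rep [:: Push 13 true] ++
  rep [:: Push 14 true] ++ rest.

Definition run_prog (cA1 cK cA2 rest : prog) : prog :=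
  trs (ren 17 0) (ren 1 0) 12 skip_query cA1 ++
  trs (ren 21 1) (ren 2 1) 13 skip_query cK ++
  trs (ren 20 0) (ren 2 0) 14 skip_query cA2 ++ rest.

Definition copy_prog (rest : prog) : prog :=
  rep (mv 21 22) ++ rep (mv2 20 23 24) ++ rep (mv 23 34) ++ rep (mv 24 35) ++
  rep [:: Push 27 true] ++ rep [:: Push 28 true] ++
  rep [:: Push 15 true] ++ rep [:: Push 16 true] ++
  sample_prog 38 ++ sample_prog 39 ++ rest.

Definition rerun_prog (cB : prog) : prog :=
  trs (ren 27 2) (ren 3 2) 15 (qmeasure (ren 3 2) 15 25) cB ++
  trs (ren 28 3) (ren 4 3) 16 (qmeasure (ren 4 3) 16 26) cB.

(** Stack 0 receives two pieces, one of which is guessed empty: the root key comes from [v], any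
    other key from the first measured query. *)
Definition out_prog : prog :=
  sub_prog 22 0 ++ sub_prog 25 0 ++ sub_prog 25 1 ++ sub_prog 25 2 ++
  sub_prog 26 3 ++ sub_prog 26 4.

Definition reduction (cA1 cK cA2 cB : prog) : prog :=
  pre_prog (run_prog cA1 cK cA2 (copy_prog (rerun_prog cB ++ out_prog))).

(** What [sub_prog] can extract; the zeros are there because messages and root keys are padded by
    [pad]. *)
Definition cutout (N : nat) (y s : bits) : Prop := exists k0 k1 k2,
  [/\ (k0 <= N)%N, (k1 + k2 <= size y)%N & s = take k2 (drop k1 y) ++ nseq k0 false].

(** * The first stage of the game and its spectators *)

Section Chain.
Context (R : realType) (lam TK T1 T2 : nat) (cA1 cK cA2 : prog) (pp : bits).
Implicit Types (psi : qstate R) (m : mem).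

Lemma wf_load xs n : wf (load xs [::]) n.
Proof. by split=> [x q|x|x y q] /=; case: ifP. Qed.

Lemma load_shifted n0 k xs : shifted n0 k (load xs [::]) (load xs [::]).
Proof. by split=> // x /=; case: ifP. Qed.

Definition A2mem (mA mK : mem) : mem := setqu (setcl mA 0 pp) 0 (qu mK 0%N).

Definition kg_run (Psi : bits -> mem -> qstate R -> R) (mA : mem) psi : R :=
  E (exec no_oracle TK cK (load [:: one_pow lam; pp] [::])) psi
    (fun mK psi' => Psi (cl mK 0%N) (A2mem mA mK) psi').

Definition first_run (Psi : bits -> mem -> qstate R -> R) psi : R :=
  E (exec no_oracle T1 cA1 (load [:: one_pow lam] [::])) psi (kg_run Psi).

Definition invariant (Psi : bits -> mem -> qstate R -> R) : Prop :=
  forall v n0 chi psi psi' m m', wf m (nq psi) -> inserted n0 chi psi psi' ->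
    shifted n0 (nq chi) m m' -> Psi v m' psi' = sqnorm chi * Psi v m psi.

(** KeyGen starts without qubits, so those it hands over were created after the qubits of the first
    adversary. *)
Lemma wf_A2mem mA mK n n' : wf mA n -> (n <= n')%N -> wf mK n' ->
  (forall x q, q \in qu mK x -> (n <= q)%N) -> wf (A2mem mA mK) n'.
Proof.
move=> [a1 a2 a3] nn [k1 k2 k3] hk.
have dis x q : q \in qu mK 0%N -> q \in qu mA x -> False.
  by move=> /hk h1 /a1 h2; move: (leq_ltn_trans h1 h2); rewrite ltnn.
split=> [x q|x|x y q] /=; rewrite /upd.
- by case: eqP => [_ /k1//|_ /a1 h]; apply: leq_trans nn.
- by case: eqP.
case: eqP => [->|_]; case: eqP => [->|_] // h1 h2.
- by case: (dis y q).
- by case: (dis x q).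
exact: a3 h1 h2.
Qed.

Lemma ext_load_names t xs n mK n' : ext t (load xs [::]) n mK n' ->
  forall x q, q \in qu mK x -> (n <= q)%N.
Proof. by move=> [_ h _] x q /h [[y]|//] /=; case: ifP. Qed.

Lemma kg_run_invariant Psi mA mA' n0 chi psi psi' : invariant Psi ->
  wf mA (nq psi) -> inserted n0 chi psi psi' -> shifted n0 (nq chi) mA mA' ->
  kg_run Psi mA' psi' = sqnorm chi * kg_run Psi mA psi.
Proof.
move=> hP wA ins [shc shq]; apply: exec_shift (wf_load _ _) ins (load_shifted _ _ _) _.
move=> mK mK' psi1 psi1' wK eK ins1 [shKc shKq]; rewrite shKc; apply: (hP _ n0) => //.
  case: (eK) => le _ _; exact: wf_A2mem wA le wK (ext_load_names eK).
split=> [|x] /=; first by rewrite shc.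
by rewrite /upd; case: eqP.
Qed.

Lemma first_run_sqnorm Psi psi : invariant Psi ->
  first_run Psi psi = sqnorm psi * first_run Psi (qinit R).
Proof.
move=> hP; apply: exec_shift (wf_load _ _) (inserted_all psi) (load_shifted _ _ _) _.
by move=> m1 m1' psi1 psi1' w1 e1 ins1 sh1; apply: kg_run_invariant ins1 sh1.
Qed.

Definition A2_run (G : bits -> bits -> R) (v : bits) m psi : R :=
  E (exec no_oracle T2 cA2 m) psi (fun m' psi' => G v (cl m' 0%N) * sqnorm psi').

Lemma A2_run_invariant G : invariant (A2_run G).
Proof.
move=> v n0 chi psi psi' m m' wm ins sh; apply: exec_shift wm ins sh _.
move=> m1 m1' psi1 psi1' w1 e1 ins1 [-> _].
by rewrite (sqnorm_inserted ins1) mulrCA.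
Qed.

(** A step lengthens a stack by at most one bit. This bounds the public parameters, the key and [st]
    by running times, so that their lengths can be guessed. *)
Lemma exec_size f t c m psi (F G : mem -> qstate R -> R) :
  (forall m' psi', (forall a, (size (cl m' a) <= size (cl m a) + t)%N) ->
    F m' psi' <= G m' psi') ->
  E (exec f t c m) psi F <= E (exec f t c m) psi G.
Proof.
elim: t c m psi => [|t IH] [|i c] m psi h; rewrite ?exec_nil ?E_ret;
  try by (apply: h => a; rewrite ?addn0 ?leq_addr).
rewrite !E_execS.
have key (o : prog * mem) psi' : (forall a, (size (cl o.2 a) <= size (cl m a) + 1)%N) ->
    E (exec f t (o.1 ++ c) o.2) psi' F <= E (exec f t (o.1 ++ c) o.2) psi' G.
  move=> s1; apply: IH => m' psi'' s2; apply: h => a.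
  by apply: leq_trans (s2 a) _; rewrite -add1n addnA leq_add2r.
rewrite -/(stepf i m f); case: (@stepP R i m) =>
  [p m' hw he|x|u x q qs _ _|x y q qs q' qs' _ _ _|x q qs a e|x y _];
  rewrite /E ?big_cons ?big_nil ?addr0 -/(E _ _ _) /=.
- by apply: (key (p, m')) => a; case: (he 0%N).
- by apply: (key ([::], _)) => a; rewrite leq_addr.
- by apply: (key ([::], _)) => a; rewrite leq_addr.
- by apply: (key ([::], _)) => a; rewrite leq_addr.
- by apply: lerD; apply: (key ([::], _)) => d /=; rewrite /upd addn1; case: eqP => [->|].
- by apply: (key ([::], _)) => a; rewrite leq_addr.
Qed.

End Chain.

(** * Success probability of the reduction *)

Section Reduction.
Context (R : realType) (P : mem -> R) (P_ge0 : forall m, 0 <= P m).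
Context (win : bits -> bits -> bits -> bits -> bits -> bool).
Hypothesis P_win : forall m,
  win (cl m 0) (cl m 1) (cl m 2) (cl m 3) (cl m 4) -> P m = 1.
Implicit Types (psi : qstate R) (m M : mem) (c rest : prog) (T : nat).
Local Notation Vh := (@Vh R P).
Local Notation LB := (@LB R P).
Context (N : nat).
Local Notation w := (rep_weight R N).
Local Notation tau := (rep_time N).

Let w0 : 0 <= w := ltW (rep_weight_gt0 R N).

Lemma LB_cutout src dst y s T rest M (F : R) :
  ok src -> ok dst -> src != dst -> src != tmp -> dst != tmp -> clean M -> cl M tmp = [::] ->
  cl M src = rev y -> (size y <= N)%N -> cutout N y s -> 0 <= F ->
  LB T rest (setcl M dst (s ++ cl M dst)) F ->
  LB (T + 4 * tau) (sub_prog src dst ++ rest) M (w ^+ 4 * F).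
Proof.
move=> os od sd st dt cm ct cs yN [k0 [k1 [k2 [k0N ky ->]]]] F0 h.
(* [src] holds [y] reversed, so the offset from its top is counted from the end of [y]. *)
apply: (@LB_sub _ _ _ _ _ k0 (size y - k1 - k2) k2) => //; rewrite ?cs ?size_rev; [lia|lia|].
move: h; rewrite -catA; congr (LB _ _ (setcl _ _ (_ ++ _))).
have -> : (size y - k1 - k2 = size y - (k2 + k1))%N by lia.
by rewrite drop_rev subKn 1?addnC // take_rev revK size_takel // addnK take_drop addnC.
Qed.

(* [b] serves when the key of the two signatures is taken from [u1], [a] when it is
   the root key. *)
Definition forkable (v u1 u2 : bits) : Prop := exists a b m0 s0 m1 s1 : bits,
  [/\ cutout N v a, cutout N u1 b, (cutout N u1 m0 /\ cutout N u1 s0),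
      (cutout N u2 m1 /\ cutout N u2 s1) & win (b ++ a) m0 s0 m1 s1].

Lemma LB_out M v u1 u2 : clean M -> cl M tmp = [::] ->
  (forall j, (j < 5)%N -> cl M j = [::]) ->
  cl M 22 = rev v -> cl M 25 = rev u1 -> cl M 26 = rev u2 ->
  (size v <= N)%N -> (size u1 <= N)%N -> (size u2 <= N)%N -> forkable v u1 u2 ->
  LB (24 * tau) out_prog M (w ^+ 24).
Proof.
move=> cm ct c0 cv cu1 cu2 vN u1N u2N [a [b [m0 [s0 [m1 [s1 [ha hb [hm0 hs0] [hm1 hs1] hw]]]]]]].
have -> : (24 * tau = 0 + 4 * tau + 4 * tau + 4 * tau + 4 * tau + 4 * tau + 4 * tau)%N by lia.
have -> : w ^+ 24 = w ^+ 4 * (w ^+ 4 * (w ^+ 4 * (w ^+ 4 * (w ^+ 4 * (w ^+ 4 * 1))))).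
  by rewrite mulr1 -!exprD.
have p4 (x : R) : 0 <= x -> 0 <= w ^+ 4 * x by move=> hx; rewrite mulr_ge0 ?exprn_ge0.
rewrite /out_prog -[sub_prog 26 4]cats0.
apply: (LB_cutout (y := v) (s := a)) => //; first by rewrite !p4.
apply: (LB_cutout (y := u1) (s := b)) => //; first by rewrite !p4.
apply: (LB_cutout (y := u1) (s := m0)) => //; first by rewrite !p4.
apply: (LB_cutout (y := u1) (s := s0)) => //; first by rewrite !p4.
apply: (LB_cutout (y := u2) (s := m1)) => //; first by rewrite !p4.
apply: (LB_cutout (y := u2) (s := s1)) => //.
move=> psi; rewrite /= P_win //= /upd /= !c0 // !cats0 //.
Qed.

Definition Bmem (lam : nat) (st s : bits) : mem := load [:: one_pow lam; st; s] [::].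

Context (lam t N0 D L : nat) (cB : prog).
Hypotheses (lamN : (lam <= N)%N) (tN : (t < N)%N) (N0N : (N0 <= N)%N) (LN : (L <= N)%N).
Hypotheses (BD : (prog_branch_size cB <= D)%N).

Definition fork (v u1 u2 : bits) : R :=
  (`[< [/\ size u1 = N0, size u2 = N0 & forkable v u1 u2] >])%:R.

Lemma fork_ge0 v u1 u2 : 0 <= fork v u1 u2.
Proof. by rewrite /fork ler0n. Qed.

Definition bmass (st : bits) (g : bits -> R) (s : bits) : R :=
  qmass g t cB (Bmem lam st s) (qinit R).

(** The second stage starts without qubits: the statistics of its query depend on [st] and the key
    only, so two runs in sequence are independent given [st] and the keys. *)
Lemma qmass_load st g s psi : qmass g t cB (Bmem lam st s) psi = bmass st g s * sqnorm psi.
Proof.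
rewrite mulrC; apply: (qmass_shift g t cB (wf_load _ _) (inserted_all psi)).
by split=> // x /=; case: ifP.
Qed.

Definition measure_time : nat := tr_time D t.+1 cB + 7 * N0 + 10.

Lemma LB_rerun_gen z zq k tc out T rest M st s (g : bits -> R) :
  (z < 32)%N -> (zq < 32)%N -> (k < 4)%N -> (tc < 32)%N -> (out < 32)%N ->
  uniq [:: z; tc; out; wst; mst] ->
  cl M tc = nseq t.+1 true -> cl M wst = [::] -> cl M mst = [::] -> cl M out = [::] ->
  pull (ren z k) (ren zq k) M = Bmem lam st s ->
  (forall u, 0 <= g u) -> (forall u, size u <> N0 -> g u = 0) ->
  (forall M' u, size u = N0 -> (forall j, ~ ren_dom z k tc j -> j <> out -> cl M' j = cl M j) ->
     (forall j, ~ ren_dom zq k zq j -> qu M' j = qu M j) ->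
     cl M' out = rev u -> LB T rest M' (g u)) ->
  LB (T + measure_time)
    (trs (ren z k) (ren zq k) tc (qmeasure (ren zq k) tc out) cB ++ rest) M (bmass st g s).
Proof.
move=> hz hzq hk htc hout; rewrite /= !inE !negb_or -!andbA.
case/and5P=> z_tc z_out z_w z_m /and5P[tc_out tc_w tc_m out_w /andP[out_m _]].
move=> ct cw cm co hp g0 gN h psi; rewrite -qmass_load -hp.
have -> : (T + measure_time = T + tr_time D t.+1 cB + 7 * N0 + 10)%N.
  by rewrite /measure_time; lia.
have rd j : (j < 32)%N -> j != z -> j != tc -> ~ ren_dom z k tc j.
  by move=> hj /eqP n1 /eqP n2; apply: ren_domN => // i; lia.
apply: (@tr_measure R P P_ge0 (ren z k) (ren zq k) tc out (ren_dom z k tc) (ren_dom zq k zq)) => //.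
- exact: ren_inj.
- exact: ren_inj.
- by move=> i; apply: ren_domP.
- by move=> i; apply: ren_domP.
- by right; left.
- by case=> [|i] /=; [|lia].
- by apply: rd; rewrite // eq_sym.
- by apply: rd; rewrite // eq_sym.
- by apply: rd; rewrite // eq_sym.
move=> M' psi' u su [f1 f2] o'; apply: h => //.
by move=> j n1 n2; apply: f1 => -[].
Qed.

Lemma LB_rerun M v st s1 s2 : clean M -> cl M tmp = [::] -> cl M wst = [::] -> cl M mst = [::] ->
  (forall j, (j < 5)%N -> cl M j = [::]) -> cl M 25 = [::] -> cl M 26 = [::] ->
  cl M 15 = nseq t.+1 true -> cl M 16 = nseq t.+1 true ->
  cl M 22 = rev v -> (size v <= N)%N ->
  pull (ren 27 2) (ren 3 2) M = Bmem lam st s1 ->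
  pull (ren 28 3) (ren 4 3) M = Bmem lam st s2 ->
  LB (24 * tau + measure_time + measure_time) (rerun_prog cB ++ out_prog) M
    (w ^+ 24 * bmass st (fun u1 => bmass st (fun u2 => fork v u1 u2) s2) s1).
Proof.
move=> [c5 c6 c7 c8] c9 c10 c11 c0 c25 c26 c15 c16 c22 vN p1 p2.
have w24 : 0 <= w ^+ 24 by rewrite exprn_ge0.
rewrite /rerun_prog -catA -[_ * bmass _ _ s1]qmass_scale -/(bmass _ _ s1).
apply: LB_rerun_gen => //.
- by move=> u; rewrite mulr_ge0 // qmass_ge0 // => u'; apply: fork_ge0.
- move=> u su; rewrite (_ : bmass _ _ _ = bmass st (fun u2 => 0 * fork v u u2) s2).
    by rewrite /bmass qmass_scale mul0r mulr0.
  congr (qmass _ _ _ _ _); apply/funext => u2; rewrite mul0r /fork.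
  by case: asboolP => // -[].
move=> M1 u1 su1 f1 q1 o1.
have keep j : (j < 32)%N -> j != 27%N -> j != 15%N -> j != 25%N -> cl M1 j = cl M j.
  by move=> hj /eqP n1 /eqP n2 /eqP n3; apply: f1 => //; apply: ren_domN => // i; lia.
have -> : w ^+ 24 * bmass st (fun u2 => fork v u1 u2) s2 = bmass st (fun u2 => w ^+ 24 * fork v u1 u2) s2.
  by rewrite /bmass qmass_scale.
rewrite -[out_prog]cats0 -catA cats0.
apply: LB_rerun_gen => //; rewrite ?keep //.
- rewrite -p2; apply: mem_ext => -[|j] /=.
  + by rewrite keep.
  + by apply: f1; [apply: ren_domN => [||i]|]; lia.
  + by apply: q1; apply: ren_domN => [||i]; lia.
  + by apply: q1; apply: ren_domN => [||i]; lia.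
- by move=> u; rewrite mulr_ge0 // fork_ge0.
- by move=> u su; rewrite /fork; case: asboolP => [[] //|]; rewrite mulr0.
move=> M2 u2 su2 f2 q2 o2; rewrite /fork; case: asboolP => [[_ _ fk]|_]; last first.
  by rewrite mulr0; apply: LB0.
have keep2 j : (j < 32)%N -> j != 28%N -> j != 16%N -> j != 26%N -> cl M2 j = cl M1 j.
  by move=> hj /eqP n1 /eqP n2 /eqP n3; apply: f2 => //; apply: ren_domN => // i; lia.
rewrite mulr1; apply: (LB_out (v := v) (u1 := u1) (u2 := u2)) => //; rewrite ?su1 ?su2 //.
- by split; rewrite keep2 ?keep.
- by rewrite keep2 ?keep.
- by move=> j hj; rewrite keep2 ?keep ?c0 //; lia.
- by rewrite keep2 ?keep.
- by rewrite keep2.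
Qed.

Lemma LB_mv_all a b x T rest M (F : R) : ok a -> ok b -> a != b -> clean M ->
  cl M a = x -> (size x <= N)%N -> cl M b = [::] -> 0 <= F ->
  LB T rest (setcl (setcl M a [::]) b (rev x)) F ->
  LB (T + tau) (rep (mv a b) ++ rest) M (w * F).
Proof.
move=> oa ob ab cM ea xN eb F0 h; apply: (@LB_rep_mv _ _ _ _ _ (size x)) => //.
  by rewrite ea.
by rewrite ea eb drop_size take_size cats0.
Qed.

Lemma LB_mv2_all a b d x T rest M (F : R) : ok a -> ok b -> ok d ->
  a != b -> a != d -> b != d -> clean M ->
  cl M a = x -> (size x <= N)%N -> cl M b = [::] -> cl M d = [::] -> 0 <= F ->
  LB T rest (setcl (setcl (setcl M a [::]) b (rev x)) d (rev x)) F ->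
  LB (T + tau) (rep (mv2 a b d) ++ rest) M (w * F).
Proof.
move=> oa ob od ab ad bd cM ea xN eb ed F0 h; apply: (@LB_rep_mv2 _ _ _ _ _ _ (size x)) => //.
  by rewrite ea.
by rewrite ea eb ed drop_size take_size cats0.
Qed.

Lemma LB_push_all a k T rest M (F : R) : ok a -> clean M -> (k <= N)%N ->
  cl M a = [::] -> 0 <= F -> LB T rest (setcl M a (nseq k true)) F ->
  LB (T + tau) (rep [:: Push a true] ++ rest) M (w * F).
Proof.
move=> oa cM kN ea F0 h; apply: (@LB_rep_push _ _ _ _ _ k) => //.
by rewrite ea cats0.
Qed.

Definition avg (F : bits -> R) : R := (2 ^+ L)^-1 * \sum_(s : L.-tuple bool) F s.

Lemma avg_ge0 F : (forall s, 0 <= F s) -> 0 <= avg F.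
Proof. by move=> h; rewrite mulr_ge0 ?invr_ge0 ?exprn_ge0 // sumr_ge0. Qed.

Lemma avg_scale a F : avg (fun s => a * F s) = a * avg F.
Proof. by rewrite /avg -mulr_sumr mulrCA. Qed.

Lemma LB_sample_all a T rest M (F : bits -> R) : ok a -> clean M -> cl M a = [::] ->
  (forall s, 0 <= F s) ->
  (forall s, size s = L -> LB T rest (setcl M a s) (F s)) ->
  LB (T + tau) (sample_prog a ++ rest) M (w * avg F).
Proof.
move=> oa cM ea F0 h; apply: LB_sample => // s ss.
by rewrite ea cats0; apply: h.
Qed.

Definition fork_prob (v st : bits) : R :=
  avg (fun s1 => avg (fun s2 =>
    bmass st (fun u1 => bmass st (fun u2 => fork v u1 u2) s2) s1)).

Lemma bmass_ge0 st g s : (forall u, 0 <= g u) -> 0 <= bmass st g s.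
Proof. by move=> h; apply: qmass_ge0. Qed.

Lemma fork_prob_ge0 v st : 0 <= fork_prob v st.
Proof.
apply: avg_ge0 => s1; apply: avg_ge0 => s2; apply: bmass_ge0 => u1.
by apply: bmass_ge0 => u2; apply: fork_ge0.
Qed.

Definition post_time : nat := 34 * tau + 2 * measure_time.

Lemma LB_post M v st : (forall j, idle j -> cl M j = [::]) ->
  (forall j, quidle j -> qu M j = [::]) -> cl M 21 = v -> cl M 20 = st ->
  (size v <= N)%N -> (size st <= N)%N ->
  LB post_time (copy_prog (rerun_prog cB ++ out_prog)) M (w ^+ 34 * fork_prob v st).
Proof.
move=> hi hq cv cst vN stN.
have -> : post_time = (24 * tau + measure_time + measure_time + tau + tau + tau + tau +
  tau + tau + tau + tau + tau + tau)%N by rewrite /post_time; lia.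
pose X s1 s2 := w ^+ 24 * bmass st (fun u1 => bmass st (fun u2 => fork v u1 u2) s2) s1.
have X0 s1 s2 : 0 <= X s1 s2.
  rewrite mulr_ge0 ?exprn_ge0 //; apply: bmass_ge0 => u1.
  by apply: bmass_ge0 => u2; apply: fork_ge0.
have -> : w ^+ 34 * fork_prob v st =
  w * (w * (w * (w * (w * (w * (w * (w * (w * avg (fun s1 => w * avg (X s1)))))))))).
  have -> : (fun s1 => w * avg (X s1)) = (fun s1 => w ^+ 25 * avg (fun s2 =>
      bmass st (fun u1 => bmass st (fun u2 => fork v u1 u2) s2) s1)).
    by apply/funext => s1; rewrite avg_scale mulrA -exprS.
  by rewrite avg_scale /fork_prob; set a := avg _; set b := w; ring.
have A0 : 0 <= avg (fun s1 => w * avg (X s1)).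
  by apply: avg_ge0 => s1; rewrite mulr_ge0 // avg_ge0.
have cM : clean M by split; apply: hi.
have wpos x : 0 <= x -> 0 <= w * x by move=> hx; rewrite mulr_ge0.
rewrite /copy_prog.
apply: (LB_mv_all (x := v)) => //; try by [rewrite /= /upd /= hi|rewrite !wpos|rewrite size_rev].
apply: (LB_mv2_all (x := st)) => //; try by [rewrite /= /upd /= hi|rewrite !wpos|rewrite size_rev].
apply: (LB_mv_all (x := rev st)) => //; try by [rewrite /= /upd /= hi|rewrite !wpos|rewrite size_rev].
apply: (LB_mv_all (x := rev st)) => //; try by [rewrite /= /upd /= hi|rewrite !wpos|rewrite size_rev].
apply: (LB_push_all (k := lam)) => //; try by [rewrite /= /upd /= hi|rewrite !wpos|rewrite size_rev].
apply: (LB_push_all (k := lam)) => //; try by [rewrite /= /upd /= hi|rewrite !wpos|rewrite size_rev].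
apply: (LB_push_all (k := t.+1)) => //; try by [rewrite /= /upd /= hi|rewrite !wpos|rewrite size_rev].
apply: (LB_push_all (k := t.+1)) => //; try by [rewrite /= /upd /= hi|rewrite !wpos|rewrite size_rev].
apply: LB_sample_all => //; [by rewrite /= /upd /= hi|by move=> s1; rewrite wpos ?avg_ge0|].
move=> s1 _; apply: LB_sample_all => //; first by rewrite /= /upd /= hi.
move=> s2 _; rewrite !revK; apply: (LB_rerun (st := st)) => //; rewrite /= /upd /= ?hi //.
- by move=> [|[|[|[|[|j]]]]] // _; rewrite /= /upd /= hi.
- apply: mem_ext => -[|[|[|j]]] //=; rewrite /upd.
  + have -> : (32 + 4 * j.+2 + 2)%N = (42 + 4 * j)%N by lia.
    by rewrite hi ?nth_nil; [repeat case: eqP => [?|_]; try lia|rewrite /idle; lia].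
  + by rewrite hq.
  + by rewrite hq // /quidle; lia.
  + by rewrite hq // /quidle; lia.
  + by rewrite hq // /quidle; lia.
- apply: mem_ext => -[|[|[|j]]] //=; rewrite /upd.
  + have -> : (32 + 4 * j.+2 + 3)%N = (43 + 4 * j)%N by lia.
    by rewrite hi ?nth_nil; [repeat case: eqP => [?|_]; try lia|rewrite /idle; lia].
  + by rewrite hq.
  + by rewrite hq // /quidle; lia.
  + by rewrite hq // /quidle; lia.
  + by rewrite hq // /quidle; lia.
Qed.

Context (T1 TK T2 : nat) (cA1 cK cA2 : prog) (pp : bits).
Hypotheses (T1N : (T1 <= N)%N) (TKN : (lam + TK <= N)%N) (T2N : (size pp + T2 <= N)%N).
Hypotheses (A1D : (prog_branch_size cA1 <= D)%N) (KD : (prog_branch_size cK <= D)%N).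
Hypotheses (A2D : (prog_branch_size cA2 <= D)%N).

Definition fork_value psi : R :=
  first_run lam TK T1 cA1 cK pp (A2_run T2 cA2 fork_prob) psi.

Definition run_time : nat := tr_time D T2 cA2 + tr_time D TK cK + tr_time D T1 cA1.

Local Notation post := (copy_prog (rerun_prog cB ++ out_prog)).

Lemma LB_run M : (forall j, idle j -> cl M j = [::]) ->
  (forall j, (31 < j)%N -> j != 33%N -> cl M j = [::]) -> (forall j, qu M j = [::]) ->
  cl M 17 = one_pow lam -> cl M 20 = pp -> cl M 21 = one_pow lam -> cl M 33 = pp ->
  cl M 12 = nseq T1 true -> cl M 13 = nseq TK true -> cl M 14 = nseq T2 true ->
  LB (post_time + run_time) (run_prog cA1 cK cA2 post) M (w ^+ 34 * fork_value (qinit R)).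
Proof.
move=> hi h32 hq c17 c20 c21 c33 c12 c13 c14 psi.
have w34 : 0 <= w ^+ 34 by rewrite exprn_ge0.
rewrite -mulrA [_ * sqnorm psi]mulrC -first_run_sqnorm; last exact: A2_run_invariant.
rewrite /first_run -E_scale /run_prog.
have -> : (post_time + run_time = post_time + tr_time D T2 cA2 + tr_time D TK cK + tr_time D T1 cA1)%N.
  by rewrite /run_time; lia.
have nt z k tc j : (j < 32)%N -> j <> z -> j <> tc -> ~ ren_dom z k tc j.
  by move=> hj n1 n2; apply: ren_domN => // i; lia.
have pA1 : pull (ren 17 0) (ren 1 0) M = load [:: one_pow lam] [::].
  apply: mem_ext => -[|j] //=; rewrite ?hq ?nth_nil //.
  by apply: h32; [lia|apply/eqP; lia].
rewrite -pA1.
apply: (@tr_run R P P_ge0 (ren 17 0) (ren 1 0) 12 skip_query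
  (ren_dom 17 0 12) (ren_dom 1 0 1)) => //.
- exact: ren_inj.
- exact: ren_inj.
- by move=> i; apply: ren_domP.
- by move=> i; apply: ren_domP.
- by right; left.
- by case=> [|i] //=; apply/eqP; lia.
- exact: nt.
- by rewrite hi.
move=> M1 al [f1 q1]; rewrite /kg_run -E_scale.
have d1 j : (31 < j)%N -> (0 < j %% 4)%N -> ~ ren_dom 17 0 12 j.
  by move=> hj hm; apply: ren_domN => [||i]; lia.
have e1 j : (31 < j)%N -> (0 < j %% 4)%N -> ~ ren_dom 1 0 1 j.
  by move=> hj hm; apply: ren_domN => [||i]; lia.
have pK : pull (ren 21 1) (ren 2 1) M1 = load [:: one_pow lam; pp] [::].
  apply: mem_ext => -[|[|j]] //=; rewrite ?nth_nil.
  + by rewrite f1 //; apply: nt.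
  + by rewrite f1 // ; apply: d1.
  + rewrite f1 ?h32 //; by [lia|apply/eqP; lia|apply: d1; lia].
  + by rewrite q1 ?hq //; apply: nt.
  + by rewrite q1 ?hq //; apply: e1.
  + by rewrite q1 ?hq //; apply: e1; lia.
rewrite -pK.
(* Longer keys get the value 0; [exec_size] shows that none occurs, and the bound becomes available
   inside the simulation. *)
pose G mK psi' := if (size (cl mK 0%N) <= N)%N then
  w ^+ 34 * A2_run T2 cA2 fork_prob (cl mK 0%N)
     (A2mem pp (pull (ren 17 0) (ren 1 0) M1) mK) psi' else 0.
apply: (@le_trans _ _ (E (exec no_oracle TK cK (pull (ren 21 1) (ren 2 1) M1)) al G)).
  apply: exec_size => mK psi' /(_ 0%N); rewrite /G pK /= size_nseq => s1.
  by rewrite (leq_trans s1).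
apply: (@tr_run R P P_ge0 (ren 21 1) (ren 2 1) 13 skip_query
  (ren_dom 21 1 13) (ren_dom 2 1 2)) => //.
- exact: ren_inj.
- exact: ren_inj.
- by move=> i; apply: ren_domP.
- by move=> i; apply: ren_domP.
- by right; left.
- by case=> [|i] //=; apply/eqP; lia.
- exact: nt.
- by rewrite f1 //; apply: nt.
- by rewrite f1 ?hi //; apply: nt.
move=> M2 be [f2 q2]; rewrite /G; case: leqP => [vN|_]; last exact: Vh_ge0.
have d2 j : (31 < j)%N -> (j %% 4 != 1)%N -> ~ ren_dom 21 1 13 j.
  by move=> hj /eqP hm; apply: ren_domN => [||i]; lia.
have e2 j : (31 < j)%N -> (j %% 4 != 1)%N -> ~ ren_dom 2 1 2 j.
  by move=> hj /eqP hm; apply: ren_domN => [||i]; lia.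
(* No data is moved: [A2] continues on the memory of [A1] with other stacks as its stacks 0, namely
   the copy of [pp] and the quantum stack 0 of KeyGen. *)
have pA2 : A2mem pp (pull (ren 17 0) (ren 1 0) M1) (pull (ren 21 1) (ren 2 1) M2) =
    pull (ren 20 0) (ren 2 0) M2.
  apply: mem_ext => -[|j] //=; rewrite /upd /=.
  + by rewrite f2 ?f1 ?c20 //; apply: nt.
  + by rewrite f2 //; apply: d2; lia.
  + by rewrite q2 //; apply: e2; lia.
rewrite pA2 /A2_run -E_scale.
set v := cl (pull _ _ M2) 0 in vN *.
pose G2 m3 psi' := if (size (cl m3 0%N) <= N)%N then
  w ^+ 34 * (fork_prob v (cl m3 0%N) * sqnorm psi') else 0.
apply: (@le_trans _ _ (E (exec no_oracle T2 cA2 (pull (ren 20 0) (ren 2 0) M2)) be G2)).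
  apply: exec_size => m3 psi' /(_ 0%N); rewrite /G2 -pA2 /= /upd /= => s1.
  by rewrite (leq_trans s1).
have g1 j : (j < 32)%N -> j <> 17%N -> j <> 12%N -> j <> 21%N -> j <> 13%N -> cl M2 j = cl M j.
  by move=> *; rewrite f2 ?f1 //; apply: nt.
apply: (@tr_run R P P_ge0 (ren 20 0) (ren 2 0) 14 skip_query
  (ren_dom 20 0 14) (ren_dom 2 0 2)) => //.
- exact: ren_inj.
- exact: ren_inj.
- by move=> i; apply: ren_domP.
- by move=> i; apply: ren_domP.
- by right; left.
- by case=> [|i] //=; apply/eqP; lia.
- exact: nt.
- by rewrite g1.
- by rewrite g1 ?hi.
move=> M3 ga [f3 q3]; rewrite /G2; case: leqP => [stN|_]; last exact: Vh_ge0.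
rewrite mulrA; apply: LB_post => //.
- move=> j hj; have [hj32|hj32] := leqP 32 j.
    rewrite f3 ?f2 ?f1 ?h32 //; move: hj; rewrite /idle => hj;
      by [apply/eqP; lia|apply: d1; lia|apply: d2; lia|apply: ren_domN => [||i]; lia].
  rewrite f3 ?g1 ?hi //; move: hj; rewrite /idle => hj; by [lia|apply: nt; lia].
- move=> j hj; have [hj32|hj32] := leqP 32 j.
    rewrite q3 ?q2 ?q1 ?hq //; move: hj; rewrite /quidle => hj;
      by [apply: e1; lia|apply: e2; lia|apply: ren_domN => [||i]; lia].
  rewrite q3 ?q2 ?q1 ?hq //; apply: nt; move: hj; rewrite /quidle; lia.
- by rewrite f3 //; apply: nt.
Qed.

Lemma LB_pre T rest (F : R) : 0 <= F ->
  (forall M, (forall j, idle j -> cl M j = [::]) ->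
    (forall j, (31 < j)%N -> j != 33%N -> cl M j = [::]) -> (forall j, qu M j = [::]) ->
    cl M 17 = one_pow lam -> cl M 20 = pp -> cl M 21 = one_pow lam -> cl M 33 = pp ->
    cl M 12 = nseq T1 true -> cl M 13 = nseq TK true -> cl M 14 = nseq T2 true ->
    LB T rest M F) ->
  LB (T + 8 * tau) (pre_prog rest) (load [:: one_pow lam; pp] [::]) (w ^+ 8 * F).
Proof.
move=> F0 h.
have -> : (T + 8 * tau = T + tau + tau + tau + tau + tau + tau + tau + tau)%N by lia.
have -> : w ^+ 8 * F = w * (w * (w * (w * (w * (w * (w * (w * F))))))) by set b := w; ring.
have wpos x : 0 <= x -> 0 <= w * x by move=> hx; rewrite mulr_ge0.
have ppN : (size pp <= N)%N by lia.
rewrite /pre_prog.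
apply: (LB_mv_all (x := one_pow lam)) => //; try by [rewrite size_nseq|rewrite !wpos].
apply: (LB_mv2_all (x := pp)) => //; try by rewrite !wpos.
apply: (LB_mv_all (x := rev pp)) => //; try by [rewrite size_rev|rewrite !wpos].
apply: (LB_mv_all (x := rev pp)) => //; try by [rewrite size_rev|rewrite !wpos].
apply: (LB_push_all (k := lam)) => //; try by rewrite !wpos.
apply: (LB_push_all (k := T1)) => //; try by rewrite !wpos.
apply: (LB_push_all (k := TK)) => //; try by [lia|rewrite !wpos].
apply: (LB_push_all (k := T2)) => //; try by [lia|rewrite !wpos].
rewrite !revK; apply: h => //.
- move=> j; rewrite /idle => hj; rewrite /= /upd.
  repeat (case: eqP => [?|?]; first by [|exfalso; lia]).
  by destruct j as [|[|j]]; rewrite /= ?nth_nil.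
- move=> j hj /eqP n33; rewrite /= /upd.
  repeat (case: eqP => [?|?]; first by [|exfalso; lia]).
  by destruct j as [|[|j]]; rewrite /= ?nth_nil.
- by move=> j /=; case: ifP.
- by rewrite /= /upd /= /one_pow rev_nseq.
Qed.

Definition reduction_time : nat := post_time + run_time + 8 * tau.

Lemma LB_reduction : LB reduction_time (reduction cA1 cK cA2 cB)
  (load [:: one_pow lam; pp] [::]) (w ^+ 42 * fork_value (qinit R)).
Proof.
have F0 : 0 <= w ^+ 34 * fork_value (qinit R).
  rewrite mulr_ge0 ?exprn_ge0 //; apply: E_ge0 => mA psi1; apply: E_ge0 => mK psi2.
  by apply: E_ge0 => m3 psi3; rewrite mulr_ge0 ?sqnorm_ge0 ?fork_prob_ge0.
rewrite (exprD w 8 34) -mulrA; apply: LB_pre => // M hi h32 hq c17 c20 c21 c33 c12 c13 c14.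
exact: LB_run.
Qed.

End Reduction.

(** * Forking a MAC chain *)

Definition substr (u x : bits) : Prop :=
  exists k1 k2, (k1 + k2 <= size u)%N /\ x = take k2 (drop k1 u).

Lemma substr_nil u : substr u [::].
Proof. by exists 0%N, 0%N; rewrite take0. Qed.

Lemma substr_trans u x y : substr u x -> substr x y -> substr u y.
Proof.
move=> [k1 [k2 [h ->]]] [k1' [k2' [h' ->]]]; exists (k1' + k1)%N, k2'.
have s : size (take k2 (drop k1 u)) = k2 by rewrite size_takel // size_drop; lia.
rewrite s in h'; split; first lia.
by rewrite -drop_drop [LHS]take_drop [RHS]take_drop take_takel //; lia.
Qed.

Lemma substr_field sh u j : sumn sh = size u -> substr u (nth [::] (reshape sh u) j).
Proof.
move=> e; rewrite nth_reshape; have [hj|hj] := ltnP j (size sh).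
  exists (sumn (take j sh)), (nth 0%N sh j); split=> //; rewrite -e.
  have := sumn_cat (take j.+1 sh) (drop j.+1 sh); rewrite cat_take_drop (take_nth 0%N hj).
  by rewrite sumn_rcons => ->; lia.
by rewrite (nth_default _ hj) take0; apply: substr_nil.
Qed.

(** The keys of the two children are adjacent fields, so the signed concatenation is obtained by a
    single cut. *)
Lemma substr_fields2 sh u j : sumn sh = size u -> (j.+1 < size sh)%N ->
  substr u (nth [::] (reshape sh u) j ++ nth [::] (reshape sh u) j.+1).
Proof.
move=> e hj; have hj' : (j < size sh)%N by lia.
rewrite !nth_reshape (take_nth 0%N hj') sumn_rcons [(_ + nth _ _ _)%N]addnC -drop_drop -takeD.
exists (sumn (take j sh)), (nth 0%N sh j + nth 0%N sh j.+1)%N; split=> //; rewrite -e.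
have := sumn_cat (take j.+2 sh) (drop j.+2 sh); rewrite cat_take_drop (take_nth 0%N hj).
by rewrite (take_nth 0%N hj') !sumn_rcons => ->; lia.
Qed.

Lemma size_field sh (u : bits) j : sumn sh = size u ->
  size (nth [::] (reshape sh u) j) = nth 0%N sh j.
Proof. by move=> e; rewrite -nth_shape reshapeKl ?e. Qed.

Lemma substr_cutout N u x : substr u x -> cutout N u x.
Proof. by move=> [k1 [k2 [h ->]]]; exists 0%N, k1, k2; rewrite cats0. Qed.

Lemma pad_cutout N u x k : substr u x -> (k <= N)%N -> (size x <= k)%N -> cutout N u (pad k x).
Proof.
move=> [k1 [k2 [h ex]]] kN sk; exists (k - size x)%N, k1, k2; split=> //; first lia.
rewrite -ex /pad take_cat ltnNge sk /=; congr (_ ++ _).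
by rewrite take_nseq //; lia.
Qed.

Lemma cutout_pad N (u : bits) k : (k <= N)%N -> cutout N u (pad k u).
Proof.
move=> kN; have [h|h] := leqP (size u) k.
  apply: pad_cutout => //; exists 0%N, (size u); rewrite drop0 take_size; split=> //; lia.
exists 0%N, 0%N, k; split=> //; first lia.
by rewrite drop0 cats0 /pad take_cat h.
Qed.

Lemma size_pad k (x : bits) : size (pad k x) = k.
Proof. by rewrite size_takel // size_cat size_nseq; lia. Qed.

(** Appended zeros could identify strings of different lengths, and truncation any strings; the two
    hypotheses exclude this. *)
Lemma pad_inj k (x y : bits) : (size x <= k)%N -> size x = size y -> pad k x = pad k y -> x = y.
Proof.
move=> sx sxy; rewrite /pad !take_cat -sxy ltnNge sx /= => /eqP.
by rewrite eqseq_cat // => /andP[/eqP].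
Qed.

Lemma sqnorm_qinit (R : realType) : sqnorm (qinit R) = 1.
Proof.
rewrite /sqnorm (sum_bits0 (fun b => sqmod (amp (qinit R) b))) /sqmod /=.
by rewrite expr0n expr1n addr0.
Qed.

Section Fork.
Context (R : realType) (S : osmac) (n : nat -> nat) (lam N : nat) (pp mvk : bits).
Hypotheses (vk_fit : (2 * vklen S lam <= msglen S lam)%N).
Hypotheses (s_fit : (n lam + lam <= msglen S lam)%N).
Hypotheses (msgN : (msglen S lam <= N)%N).

Definition win (vk m0 s0 m1 s1 : bits) : bool :=
  [&& size m0 == msglen S lam, size m1 == msglen S lam, m0 != m1,
      verify R S lam pp mvk vk m0 s0 & verify R S lam pp mvk vk m1 s1].

Implicit Types (u v s r : bits).

Local Notation fields u := (reshape (input_shape n S lam) u).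
Local Notation sfield u := (nth [::] (fields u) 0).
Local Notation sts u i := (reshape (st_shape n S lam i) (nth [::] (fields u) i.+2)).
Local Notation lkey u i := (nth [::] (sts u i) (i != 0%N)).
Local Notation rkey u i := (nth [::] (sts u i) (i != 0%N).+1).
Local Notation sgn u i := (last [::] (sts u i)).
Local Notation key vk0 u i := (if i == 0%N then vk0 else nth [::] (sts u i) 0).

Definition rfield (u : bits) : bits := nth [::] (fields u) 1.

Definition valid (s vk0 u : bits) : bool :=
  [&& size u == sumn (input_shape n S lam), sfield u == s,
      all (fun i => key vk0 u i.+1 == if nth false (rfield u) i then rkey u i else lkey u i)
        (iota 0 (n lam)),
      all (fun i => verify R S lam pp mvk (key vk0 u i)
                      (pad (msglen S lam) (lkey u i ++ rkey u i)) (sgn u i))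
        (iota 0 (n lam))
    & verify R S lam pp mvk (key vk0 u (n lam)) (pad (msglen S lam) (sfield u)) (sgn u (n lam))].

Lemma mac_oracle_valid s msg vk0 u : mac_oracle R n S lam pp mvk s msg vk0 u =
  if valid s vk0 u then true :: msg else nseq (size msg).+1 false.
Proof. by []. Qed.

Lemma size_st u i : size u = sumn (input_shape n S lam) -> (i <= n lam)%N ->
  sumn (st_shape n S lam i) = size (nth [::] (fields u) i.+2).
Proof.
move=> su hi; rewrite size_field //.
have -> : nth 0%N (input_shape n S lam) i.+2 =
  nth 0%N [seq sumn (st_shape n S lam i) | i <- iota 0 (n lam).+1] i by [].
by rewrite (nth_map 0%N) ?size_iota // nth_iota.
Qed.

Lemma substr_st u i : size u = sumn (input_shape n S lam) -> substr u (nth [::] (fields u) i.+2).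
Proof. by move=> su; apply: substr_field. Qed.

Lemma substr_st_field u i j : size u = sumn (input_shape n S lam) -> (i <= n lam)%N ->
  substr u (nth [::] (sts u i) j).
Proof.
move=> su hi; apply: substr_trans (substr_st i su) (substr_field _ _).
exact: size_st.
Qed.

Lemma substr_sgn u i : size u = sumn (input_shape n S lam) -> (i <= n lam)%N ->
  substr u (sgn u i).
Proof. by move=> su hi; rewrite -nth_last; apply: substr_st_field. Qed.

Lemma substr_keys u i : size u = sumn (input_shape n S lam) -> (i < n lam)%N ->
  substr u (lkey u i ++ rkey u i).
Proof.
move=> su hi; apply: substr_trans (substr_st i su) (substr_fields2 _ _).
  by apply: size_st => //; apply: ltnW.
by rewrite /st_shape hi; case: (i).
Qed.

Lemma size_lkey u i : size u = sumn (input_shape n S lam) -> (i < n lam)%N ->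
  size (lkey u i) = vklen S lam /\ size (rkey u i) = vklen S lam.
Proof.
move=> su hi; have e := size_st su (ltnW hi).
rewrite (size_field (i != 0%N) e) (size_field (i != 0%N).+1 e).
by rewrite /st_shape hi; case: (i).
Qed.

Lemma size_sfield u : size u = sumn (input_shape n S lam) -> size (sfield u) = (n lam + lam)%N.
Proof. by move=> su; rewrite size_field. Qed.

Lemma size_rfield u : size u = sumn (input_shape n S lam) -> size (rfield u) = n lam.
Proof. by move=> su; rewrite size_field. Qed.

Lemma valid_sfield s vk0 u : valid s vk0 u -> s = sfield u.
Proof. by case/and5P => _ /eqP-> _ _ _. Qed.

Lemma valid_size s vk0 u : valid s vk0 u -> size u = sumn (input_shape n S lam).
Proof. by case/and5P => /eqP. Qed.

Local Notation forkable := (@forkable win N).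

(* Two valid chains with the same root and the same leaf diverge at some node [i]:
   there the same key signs two distinct messages. *)
Lemma valid_forkable v s1 s2 u1 u2 : valid s1 (pad (vklen S lam) v) u1 ->
  valid s2 (pad (vklen S lam) v) u2 -> rfield u1 = rfield u2 -> s1 != s2 -> forkable v u1 u2.
Proof.
move=> v1 v2 er ns; have es1 := valid_sfield v1; have es2 := valid_sfield v2.
set vk0 := pad _ v in v1 v2 *.
move: v1 v2 => /and5P[/eqP z1 _ /allP k1 /allP c1 l1] /and5P[/eqP z2 _ /allP k2 /allP c2 l2].
have vkN : (vklen S lam <= N)%N by lia.
(* The root key is cut out of [v] and every other key out of [u1]; the other piece is empty. *)
have hroot i : (i <= n lam)%N -> exists a b, [/\ cutout N v a, cutout N u1 b &
    key vk0 u1 i = b ++ a].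
  move=> hi; case: eqP => [_|_].
    exists vk0, [::]; split=> //; first exact: cutout_pad.
    exact/substr_cutout/substr_nil.
  exists [::], (nth [::] (sts u1 i) 0); rewrite cats0; split=> //.
    exact/substr_cutout/substr_nil.
  by apply/substr_cutout/substr_st_field.
(* Descent along the common path: as long as no fork is found, both chains use the same key at depth
   [i]. *)
have main i : (i <= n lam)%N -> forkable v u1 u2 \/ key vk0 u1 i = key vk0 u2 i.
  elim: i => [|i IH] hi; first by right.
  have [|ek] := IH (ltnW hi); first by left.
  have ii : i \in iota 0 (n lam) by rewrite mem_iota.
  have [sl1 sr1] := size_lkey z1 hi; have [sl2 sr2] := size_lkey z2 hi.
  have [e|ne] := eqVneq (lkey u1 i ++ rkey u1 i) (lkey u2 i ++ rkey u2 i).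
    right; rewrite (eqP (k1 i ii)) (eqP (k2 i ii)) er.
    move/eqP: e; rewrite eqseq_cat ?sl1 ?sl2 // => /andP[/eqP-> /eqP->].
    by [].
  left; have [a [b [ha hb eab]]] := hroot i (ltnW hi).
  exists a, b, (pad (msglen S lam) (lkey u1 i ++ rkey u1 i)), (sgn u1 i),
    (pad (msglen S lam) (lkey u2 i ++ rkey u2 i)), (sgn u2 i); split=> //.
  - split; last by apply/substr_cutout/substr_sgn => //; apply: ltnW.
    by apply: pad_cutout => //; [apply: substr_keys|rewrite size_cat sl1 sr1; lia].
  - split; last by apply/substr_cutout/substr_sgn => //; apply: ltnW.
    by apply: pad_cutout => //; [apply: substr_keys|rewrite size_cat sl2 sr2; lia].
  rewrite /win !size_pad !eqxx -eab c1 //= ek c2 // andbT.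
  apply: contra_neq ne; apply: pad_inj; rewrite !size_cat ?sl1 ?sl2 ?sr1 ?sr2 //; lia.
(* Without an inner fork the leaf keys agree, and they sign the distinct strings [s1] and [s2]. *)
have [//|ek] := main (n lam) (leqnn _).
have [a [b [ha hb eab]]] := hroot (n lam) (leqnn _).
have sz1 := size_sfield z1; have sz2 := size_sfield z2.
exists a, b, (pad (msglen S lam) (sfield u1)), (sgn u1 (n lam)),
  (pad (msglen S lam) (sfield u2)), (sgn u2 (n lam)); split=> //.
- split; last by apply/substr_cutout/substr_sgn.
  by apply: pad_cutout; rewrite ?sz1 //; apply: substr_field.
- split; last by apply/substr_cutout/substr_sgn.
  by apply: pad_cutout; rewrite ?sz2 //; apply: substr_field.
rewrite /win !size_pad !eqxx -eab l1 //= ek l2 // andbT.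
apply: contra_neq ns; rewrite es1 es2; apply: pad_inj; rewrite sz1 ?sz2 //.
Qed.

(** * Two independent runs and a common path *)

Section Chain.
Context (t : nat) (cB : prog) (st v : bits).
Local Notation L := (n lam + lam)%N.
Local Notation N0 := (sumn (input_shape n S lam)).
Local Notation avg := (@avg R L).
Local Notation bmass := (@bmass R lam t cB st).
Local Notation vk0 := (pad (vklen S lam) v).

Definition chain_prob : R := avg (fun s => bmass (fun u => (valid s vk0 u)%:R) s).

Let ev (r s u : bits) : R := (valid s vk0 u && (rfield u == r))%:R.

Let A (r : bits) : R := avg (fun s => bmass (ev r s) s).

Lemma avg_le F G : (forall s, size s = L -> F s <= G s) -> avg F <= avg G.
Proof.
move=> h; rewrite /avg ler_wpM2l ?invr_ge0 ?exprn_ge0 //.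
by apply: ler_sum => s _; apply: h; rewrite size_tuple.
Qed.

Lemma avg_cst a : avg (fun=> a) = a.
Proof.
rewrite /avg sumr_const card_tuple card_bool -[a *+ _]mulr_natl natrX mulrA mulVf ?mul1r //.
Qed.

Lemma avg_add F G : avg (fun s => F s + G s) = avg F + avg G.
Proof. by rewrite /avg big_split mulrDr. Qed.

Lemma avg_sum I (r : seq I) (F : I -> bits -> R) :
  avg (fun s => \sum_(i <- r) F i s) = \sum_(i <- r) avg (F i).
Proof. by rewrite /avg exchange_big mulr_sumr. Qed.

Lemma avg_eq s0 : size s0 = L -> avg (fun s => (s0 == s)%:R) = (2 ^+ L)^-1.
Proof.
move=> /eqP e; rewrite /avg (bigD1 (Tuple e)) //= eqxx big1 ?addr0 ?mulr1 // => s ns.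
by case: eqP => // es; case/eqP: ns; apply: val_inj.
Qed.

Lemma bmass_le1 s : bmass (fun=> 1) s <= 1.
Proof.
apply: le_trans (qmass_le1 _ _ (wf_load _ _)) _.
by rewrite sqnorm_qinit.
Qed.

Lemma sum_ev s u : \sum_(r : (n lam).-tuple bool) ev r s u = (valid s vk0 u)%:R.
Proof.
rewrite /ev; case: (boolP (valid s vk0 u)) => [hv|_]; last by rewrite big1.
have /eqP e := size_rfield (valid_size hv).
rewrite (bigD1 (Tuple e)) //= eqxx big1 ?addr0 // => r nr.
by case: eqP => // er; case/eqP: nr; apply: val_inj.
Qed.

Lemma chain_probE : chain_prob = \sum_(r : (n lam).-tuple bool) A r.
Proof.
rewrite -avg_sum; congr (avg _); apply/funext => s.
by rewrite -qmass_sum; congr (qmass _ _ _ _ _); apply/funext => u; rewrite sum_ev.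
Qed.

Lemma sum_square_le (I : finType) (F : I -> R) :
  (\sum_i F i) ^+ 2 <= #|I|%:R * \sum_i F i ^+ 2.
Proof.
have key : 0 <= \sum_i \sum_j (F i - F j) ^+ 2.
  by apply: sumr_ge0 => i _; apply: sumr_ge0 => j _; apply: sqr_ge0.
have e1 : \sum_i \sum_j F i * F j = (\sum_i F i) ^+ 2.
  by rewrite expr2 mulr_suml; apply: eq_bigr => i _; rewrite mulr_sumr.
have e2 : \sum_(i : I) \sum_(j : I) F i ^+ 2 = #|I|%:R * \sum_i F i ^+ 2.
  by rewrite mulr_sumr; apply: eq_bigr => i _; rewrite sumr_const mulr_natl.
have e3 : \sum_(i : I) \sum_(j : I) F j ^+ 2 = #|I|%:R * \sum_i F i ^+ 2.
  by rewrite exchange_big.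
have e : \sum_i \sum_j (F i - F j) ^+ 2 =
    \sum_(i : I) \sum_(j : I) F i ^+ 2 + \sum_(i : I) \sum_(j : I) F j ^+ 2
    - 2 * \sum_i \sum_j F i * F j.
  rewrite mulr_sumr -!big_split -sumrB /=; apply: eq_bigr => i _.
  rewrite mulr_sumr -!big_split -sumrB /=; apply: eq_bigr => j _; ring.
by move: key; rewrite e e1 e2 e3; lra.
Qed.

(* Linear in [chain_prob], so that it can be averaged over the first stage; this
   is the square of [chain_prob] bounded below by its tangent at [ka]. *)
Lemma fork_prob_lower (ka : R) :
  (2 ^+ n lam)^-1 * (2 * ka * chain_prob - ka ^+ 2) - (2 ^+ L)^-1 <=
  @fork_prob R win N lam t N0 L cB v st.
Proof.
have A0 r : 0 <= A r.
  by apply: avg_ge0 => s; apply: qmass_ge0 => u; rewrite ler0n.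
have cs : chain_prob ^+ 2 <= 2 ^+ n lam * \sum_(r : (n lam).-tuple bool) A r ^+ 2.
  by rewrite chain_probE; have := sum_square_le (fun r : (n lam).-tuple bool => A r);
     rewrite card_tuple card_bool natrX.
have key : \sum_(r : (n lam).-tuple bool) A r ^+ 2 <=
    @fork_prob R win N lam t N0 L cB v st + (2 ^+ L)^-1.
  (* The square of [A r] is the probability that two runs with independent keys are both accepted
     with path [r]. *)
  have -> : \sum_(r : (n lam).-tuple bool) A r ^+ 2 = avg (fun s1 => avg (fun s2 =>
     bmass (fun u1 => bmass (fun u2 => \sum_(r : (n lam).-tuple bool) ev r s1 u1 * ev r s2 u2) s2) s1)).
    have e s1 s2 : bmass (fun u1 => bmass (fun u2 =>
        \sum_(r : (n lam).-tuple bool) ev r s1 u1 * ev r s2 u2) s2) s1 =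
       \sum_(r : (n lam).-tuple bool) bmass (ev r s2) s2 * bmass (ev r s1) s1.
      transitivity (\sum_(r : (n lam).-tuple bool)
          bmass (fun u1 => bmass (ev r s2) s2 * ev r s1 u1) s1); last first.
        by apply: eq_bigr => r _; rewrite /bmass qmass_scale.
      rewrite [RHS](esym (qmass_sum _ _ _ _ _ _ _)); congr (qmass _ _ _ _ _); apply/funext => u1.
      rewrite /bmass qmass_sum; apply: eq_bigr => r _; rewrite qmass_scale mulrC //.
    rewrite (_ : (fun s1 => _) = (fun s1 => \sum_(r : (n lam).-tuple bool) A r * bmass (ev r s1) s1)).
      rewrite avg_sum; apply: eq_bigr => r _; rewrite avg_scale expr2 //.
    apply/funext => s1; under [in LHS]eq_fun do rewrite e.
    rewrite avg_sum; apply: eq_bigr => r _.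
    by under eq_fun do rewrite mulrC; rewrite avg_scale mulrC.
  have -> : (2 ^+ L)^-1 = avg (fun s1 => avg (fun s2 => (s1 == s2)%:R)).
    rewrite -[LHS]avg_cst /avg; congr (_ * _); apply: eq_bigr => s1 _.
    by apply/esym/(avg_eq (size_tuple s1)).
  rewrite /fork_prob -avg_add; apply: avg_le => s1 hs1; rewrite -avg_add; apply: avg_le => s2 hs2.
  (* Equal keys need not give a fork; [d] pays for them and averages to the inverse of [2 ^+ L]. *)
  set d : R := (s1 == s2)%:R.
  apply: (@le_trans _ _ (bmass (fun u1 => bmass (fun u2 => fork R win N N0 v u1 u2 + d * 1) s2) s1)).
    apply: qmass_le => u1; apply: qmass_le => u2; rewrite mulr1.
    (* The events for different [r] are disjoint, so their sum is still bounded by an indicator. *)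
    have le1 : \sum_(r : (n lam).-tuple bool) ev r s1 u1 * ev r s2 u2 <=
       (valid s1 vk0 u1 && (valid s2 vk0 u2 && (rfield u1 == rfield u2)))%:R.
      have [hv|nv] := boolP (valid s1 vk0 u1 && (valid s2 vk0 u2 && (rfield u1 == rfield u2))).
        rewrite -[leRHS](_ : (valid s1 vk0 u1)%:R = 1); last by case/andP: hv => ->.
        rewrite -sum_ev; apply: ler_sum => r _; rewrite ler_piMr ?ler0n //.
        by rewrite /ev; case: (_ && _).
      rewrite big1 // => r _; rewrite /ev -natrM mulnb.
      case: (boolP (_ && _)) => // /andP[/andP[a1 /eqP b1] /andP[a2 /eqP b2]].
      by move: nv; rewrite a1 a2 b1 b2 eqxx.
    apply: le_trans le1 _; case: (boolP (_ && _)) => [/and3P[h1 h2 /eqP h3]|_]; last first.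
      by rewrite addr_ge0 ?fork_ge0 ?ler0n.
    rewrite /d; case: eqVneq => [_|ns]; first by rewrite lerDr fork_ge0.
    rewrite addr0 /fork asboolT //; split; [exact: valid_size h1|exact: valid_size h2|].
    exact: valid_forkable h1 h2 h3 ns.
  have d0 : 0 <= d by rewrite ler0n.
  rewrite (_ : (fun u1 => _) = (fun u1 => bmass (fun u2 => fork R win N N0 v u1 u2) s2 +
      (d * bmass (fun=> 1) s2) * 1)); last first.
    by apply/funext => u1; rewrite /bmass qmass_add qmass_scale mulr1.
  rewrite /bmass qmass_add qmass_scale lerD2l -/(bmass _ s1) -/(bmass _ s2).
  have h1 := bmass_le1 s1; have h2 := bmass_le1 s2.
  have g1 : 0 <= bmass (fun=> 1) s1 by apply: qmass_ge0.
  have g2 : 0 <= bmass (fun=> 1) s2 by apply: qmass_ge0.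
  by rewrite -mulrA -[leRHS]mulr1 ler_wpM2l // -[leRHS]mulr1 ler_pM.
have pn : 0 < (2 ^+ n lam : R) by rewrite exprn_gt0.
rewrite lerBlDr; apply: le_trans key; rewrite ler_pdivrMl //.
apply: le_trans cs; have := sqr_ge0 (chain_prob - ka); rewrite sqrrB; lra.
Qed.

End Chain.
End Fork.

(** * The indistinguishability game *)

Section GameBound.
Context (R : realType) (n : nat -> nat) (S : osmac) (M : nat -> pred bits).
Context (A1 A2 B : qpt) (lam : nat).
Implicit Types (psi : qstate R) (m : mem) (s v st : bits).
Local Notation L := (n lam + lam)%N.
Local Notation T1 := (poly_clock (clock A1) lam).
Local Notation T2 := (poly_clock (clock A2) lam).
Local Notation TB := (poly_clock (clock B) lam).
Local Notation TK := (poly_clock (clock (KeyGen S)) lam).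
Local Notation avg := (@avg R L).
Local Notation kg p := (@kg_run R lam TK (code (KeyGen S)) p.1).
Local Notation first p := (@first_run R lam TK T1 (code A1) (code (KeyGen S)) p.1).
Local Notation A2run := (@A2_run R T2 (code A2)).

Lemma E_norm_sub X (p : qproc R X) psi F G :
  `|E p psi F - E p psi G| <= E p psi (fun x psi' => `|F x psi' - G x psi'|).
Proof. by rewrite /E -sumrB; apply: ler_norm_sum. Qed.

Lemma E_setup psi F : E (setup R S lam) psi F =
  E (exec no_oracle (poly_clock (clock (Setup S)) lam) (code (Setup S))
      (load [:: one_pow lam] [::])) psi (fun m => F (cl m 0%N, cl m 1%N)).
Proof. by rewrite /setup E_bind; apply: E_eq => m psi'; rewrite E_ret. Qed.

Lemma E_uniform k psi F : E (uniform R k) psi F =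
  \sum_(s : k.-tuple bool) F (s : bits) (scale (Complex (Num.sqrt (2 ^+ k))^-1 0) psi).
Proof. by rewrite /E /uniform big_map big_enum. Qed.

Lemma sqmod_uniform k : sqmod (Complex (Num.sqrt (2 ^+ k : R))^-1 0) = (2 ^+ k)^-1.
Proof. by rewrite sqmod_real exprVn sqr_sqrtr // exprn_ge0. Qed.

Definition weight (F : bits * bits -> R) : R :=
  E (setup R S lam) (qinit R) (fun p psi => F p * sqnorm psi).

Lemma weight_le F G : (forall p, F p <= G p) -> weight F <= weight G.
Proof. by move=> h; apply: E_le => p psi; rewrite ler_wpM2r ?sqnorm_ge0. Qed.

Lemma weight_cst a : weight (fun=> a) = a.
Proof.
by rewrite /weight E_scale E_setup exec_norm ?sqnorm_qinit ?mulr1 //; apply: wf_load.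
Qed.

Lemma weight_add F G : weight (fun p => F p + G p) = weight F + weight G.
Proof. by rewrite -E_add; apply: E_eq => p psi; rewrite mulrDl. Qed.

Lemma weight_scale a F : weight (fun p => a * F p) = a * weight F.
Proof. by rewrite -E_scale; apply: E_eq => p psi; rewrite mulrA. Qed.

Lemma weight_sum I (r : seq I) (F : I -> bits * bits -> R) :
  weight (fun p => \sum_(i <- r) F i p) = \sum_(i <- r) weight (F i).
Proof. by rewrite -E_sum; apply: E_eq => p psi; rewrite mulr_suml. Qed.

Lemma first_run_le pp Psi Psi' psi :
  (forall v m psi', wf m (nq psi') -> Psi v m psi' <= Psi' v m psi') ->
  @first_run R lam TK T1 (code A1) (code (KeyGen S)) pp Psi psi <=
  first_run lam TK T1 (code A1) (code (KeyGen S)) pp Psi' psi.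
Proof.
move=> h; apply: exec_le; first exact: wf_load.
move=> mA psi1 wA _; apply: exec_le; first exact: wf_load.
move=> mK psi2 wK eK; apply: h; case: (eK) => le _ _.
exact: wf_A2mem wA le wK (ext_load_names eK).
Qed.

Lemma first_run_add pp Psi Psi' psi :
  @first_run R lam TK T1 (code A1) (code (KeyGen S)) pp
    (fun v m psi' => Psi v m psi' + Psi' v m psi') psi =
  first_run lam TK T1 (code A1) (code (KeyGen S)) pp Psi psi +
  first_run lam TK T1 (code A1) (code (KeyGen S)) pp Psi' psi.
Proof. by rewrite -E_add; apply: E_eq => mA psi1; rewrite -E_add. Qed.

Lemma first_run_scale pp a Psi psi :
  @first_run R lam TK T1 (code A1) (code (KeyGen S)) pp (fun v m psi' => a * Psi v m psi') psi =
  a * first_run lam TK T1 (code A1) (code (KeyGen S)) pp Psi psi.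
Proof. by rewrite -E_scale; apply: E_eq => mA psi1; rewrite -E_scale. Qed.

Lemma first_run_sum pp I (r : seq I) (Psi : I -> bits -> mem -> qstate R -> R) psi :
  @first_run R lam TK T1 (code A1) (code (KeyGen S)) pp
    (fun v m psi' => \sum_(i <- r) Psi i v m psi') psi =
  \sum_(i <- r) first_run lam TK T1 (code A1) (code (KeyGen S)) pp (Psi i) psi.
Proof. by rewrite -E_sum; apply: E_eq => mA psi1; rewrite -E_sum. Qed.

Lemma first_run_norm pp psi :
  @first_run R lam TK T1 (code A1) (code (KeyGen S)) pp (fun _ _ => @sqnorm R) psi = sqnorm psi.
Proof.
rewrite -(exec_norm no_oracle T1 (code A1) (wf_load [:: one_pow lam] (nq psi))).
by apply: E_eq => mA psi1; apply: exec_norm; apply: wf_load.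
Qed.

(** Seen from the first factor, the second one is a spectator placed after all of its qubits. *)
Lemma inserted_swap chi psi psi' : inserted 0 chi psi psi' -> inserted (nq chi) psi chi psi'.
Proof.
move=> [e _ h]; split=> [||b sb]; [by rewrite addnC|by []|].
rewrite h // /junk /unjunk drop0 take0 add0n mulrC.
rewrite (drop_oversize (n := nq chi + nq psi)) ?cats0; last by rewrite sb e addnC.
by rewrite (take_oversize (n := nq psi)) // size_drop sb e addnK.
Qed.

Lemma shifted_id m N k : wf m N -> shifted N k m m.
Proof.
move=> [w _ _]; split=> // x; rewrite -[LHS]map_id; apply/eq_in_map => q hq.
by rewrite /shift (w x).
Qed.

(* Setup acts on fresh qubits only, hence commutes with the first adversary. *)
Lemma setup_commutes a Psi : (forall p, invariant (Psi p)) ->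
  E (exec no_oracle T1 (code A1) (load [:: one_pow lam] [::])) (qinit R)
    (fun mA psi => E (setup R S lam) (scale a psi) (fun p psi' => kg p (Psi p) mA psi')) =
  sqmod a * weight (fun p => first p (Psi p) (qinit R)).
Proof.
move=> hP.
have key mA psi : wf mA (nq psi) ->
    E (setup R S lam) (scale a psi) (fun p psi' => kg p (Psi p) mA psi') =
    E (setup R S lam) (qinit R) (fun p psi' => sqmod a * (kg p (Psi p) mA psi * sqnorm psi')).
  move=> wA; rewrite !E_setup -[RHS]mul1r.
  apply: exec_shift (wf_load _ _) (inserted_all (scale a psi)) (load_shifted _ _ _) _.
  move=> m1 m1' psi1 psi1' w1 e1 ins [-> _]; rewrite mul1r.
  have wA' : wf mA (nq (scale a psi)) by [].
  set p := (cl m1 0%N, cl m1 1%N).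
  (* For the first adversary the qubits of Setup are spectators; the scalar [a] is then split off as
     one without qubits. *)
  rewrite (@kg_run_invariant R lam TK (code (KeyGen S)) p.1 (Psi p) mA mA _ _ _ _ (hP p) wA'
    (inserted_swap ins) (shifted_id _ wA')).
  rewrite (@kg_run_invariant R lam TK (code (KeyGen S)) p.1 (Psi p) mA mA _ _ _ _ (hP p) wA
    (inserted_scale a psi)).
    have -> : sqnorm (QState 0 (fun=> a)) = sqmod a.
      by rewrite /sqnorm (sum_bits0 (fun=> sqmod a)).
    by rewrite mulrC mulrA.
  split=> // x; rewrite -[LHS]map_id; apply: eq_map => q.
  by rewrite /shift /= addn0.
etransitivity; first by apply: exec_eq; [exact: wf_load|move=> mA psi wA _; exact: key].
rewrite /weight -E_scale /first_run.
rewrite [LHS]exchange_big /=; apply: eq_bigr => o _.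
by rewrite -mulr_sumr /E mulr_suml.
Qed.

Definition accept (mB : mem) psi : R := if head false (cl mB 0) then sqnorm psi else 0.

Definition tail (f : bits -> bits) s m psi : R :=
  E (exec f T2 (code A2) m) psi (fun m' psi' =>
    E (exec f TB (code B) (Bmem lam (cl m' 0%N) s)) psi' accept).

(** With the oracle as a parameter, the two encryption games and the rejecting game are three
    instances; they differ in [tail] only. *)
Definition game (f : bits * bits -> bits -> bits -> mem -> bits -> bits) : R :=
  E (exec no_oracle T1 (code A1) (load [:: one_pow lam] [::])) (qinit R) (fun mA psi =>
    if M lam (cl mA 0%N) && M lam (cl mA 1%N) then
      \sum_(s : L.-tuple bool)
        E (setup R S lam) (scale (Complex (Num.sqrt (2 ^+ L))^-1 0) psi)
          (fun p psi' => kg p (fun v m => tail (f p s v mA) s m) mA psi')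
    else 0).

Lemma Pr_game b : Pr (ute_game (mac_chain R n S M) A1 A2 B lam b) =
  game (fun p s v mA => mac_oracle R n S lam p.1 p.2 s
    (if b then cl mA 1%N else cl mA 0%N) (pad (vklen S lam) v)).
Proof.
rewrite PrE /ute_game E_bind; apply: E_eq => mA psi.
case: ifP => _; last by rewrite E_ret.
rewrite E_bind /= /mac_gen E_bind E_uniform; apply: eq_bigr => s _.
rewrite E_bind; apply: E_eq => p psi'; rewrite E_ret /= E_bind /mac_enc E_bind /keygen E_bind.
apply: E_eq => mK psi''; rewrite !E_ret /= E_bind; apply: E_eq => m' psi3.
by rewrite E_bind; apply: E_eq => mB psi4; rewrite E_ret.
Qed.

Lemma le_sqnorm_sub (eta : R) psi phi : 0 < eta -> nq psi = nq phi ->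
  `|sqnorm psi - sqnorm phi| <= eta * sqnorm phi + (1 + eta^-1) * sqnorm (qsub psi phi).
Proof.
move=> e0 e; case: phi e => k b /= e; rewrite /sqnorm /= -e.
rewrite !mulr_sumr -big_split -sumrB /=; apply: le_trans (ler_norm_sum _ _ _) _.
by apply: ler_sum => d _; apply: le_sqmod_sub.
Qed.

(** The constant of [hybrid_exec] for [T2 + TB] steps that end with weight 1. *)
Local Notation C := (4 * (1 + TB%:R + T2%:R) ^+ 2 : R).

Definition gap (V : pred bits) s v m psi : R :=
  C * (\sum_(t < T2) qmass (fun u => (V u)%:R) t (code A2) m psi) +
  A2run (fun _ st => C * \sum_(t < TB) bmass lam t (code B) st (fun u => (V u)%:R) s) v m psi.

Lemma gap_invariant V s : invariant (gap V s).
Proof.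
move=> v n0 chi psi psi' m m' wm ins sh; rewrite /gap (A2_run_invariant _ _ _ _ wm ins sh).
under eq_bigr => t _ do rewrite (qmass_shift _ _ _ wm ins sh).
by rewrite -mulr_sumr mulrDr mulrCA.
Qed.

(** [hybrid_exec] is used twice, backwards: for the second stage with final weight 1, then for [A2]
    with final weight [1 + TB]. The factor [1 + eta^-1] comes from comparing acceptance
    probabilities. *)
Lemma tail_gap f (V : pred bits) s v m psi (eta : R) : 0 < eta -> wf m (nq psi) ->
  (forall u i, ~~ V u -> nth false (f u) i = false) ->
  `|tail f s m psi - tail no_oracle s m psi| <=
  eta * sqnorm psi + (1 + eta^-1) * gap V s v m psi.
Proof.
move=> e0 wm hf; set ka := 1 + eta^-1.
have ka0 : 0 <= ka by rewrite addr_ge0 // invr_ge0 ltW.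
have TB0 : 0 <= TB%:R :> R by []; have T20 : 0 <= T2%:R :> R by [].
have C2 : 4 * (1 + TB%:R) ^+ 2 <= C by rewrite ler_pM2l //; nra.
pose dB m' psi' := C * \sum_(t < TB) qmass (fun u => (V u)%:R) t (code B) (Bmem lam (cl m' 0%N) s) psi'.
have hB m' psi' phi' : nq psi' = nq phi' -> wf m' (nq psi') ->
   `|E (exec f TB (code B) (Bmem lam (cl m' 0%N) s)) psi' accept -
     E (exec no_oracle TB (code B) (Bmem lam (cl m' 0%N) s)) phi' accept| <=
   eta * sqnorm phi' + ka * ((1 + TB%:R) * sqnorm (qsub psi' phi') + dB m' phi').
  move=> e w'.
  have := @hybrid_exec R f V TB (code B) (Bmem lam (cl m' 0%N) s) psi' phi' 1 ka eta C
     accept accept (fun _ _ => 0) (lexx _) ka0 C2 (wf_load _ _) e hf.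
  have -> : E (exec no_oracle TB (code B) (Bmem lam (cl m' 0%N) s)) phi' (fun _ _ => 0) = 0.
    by rewrite /E big1.
  rewrite addr0; apply.
  move=> mB psi1 phi1 e1 _; rewrite mul1r ?addr0 /accept; case: ifP => _.
    exact: le_sqnorm_sub.
  by rewrite subrr normr0 addr_ge0 // mulr_ge0 ?sqnorm_ge0 // ltW.
have al1 : 1 <= 1 + TB%:R :> R by rewrite lerDl.
have := @hybrid_exec R f V T2 (code A2) m psi psi _ ka eta C _ _ dB al1 ka0 (lexx _) wm erefl hf hB.
rewrite (_ : sqnorm (qsub psi psi) = 0); last first.
  by rewrite /sqnorm big1 // => b _ /=; rewrite subrr sqmod0.
rewrite mulr0 add0r (_ : E _ _ dB = A2run (fun _ st => C * \sum_(t < TB)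
    bmass lam t (code B) st (fun u => (V u)%:R) s) v m psi) //.
apply: E_eq => m' psi'; rewrite /dB -[RHS]mulrA mulr_suml; congr (_ * _).
by apply: eq_bigr => t _; rewrite qmass_load.
Qed.

Local Notation V p s v := (fun u => valid R S n lam p.1 p.2 s (pad (vklen S lam) v) u).

Definition chain_mass (t : nat) : R := weight (fun p => first p
  (A2run (fun v st => chain_prob R S n lam p.1 p.2 t (code B) st v)) (qinit R)).

(** An accepted input contains the key as its first field, which determines [s]. *)
Lemma sum_valid p v u : \sum_(s : L.-tuple bool) (V p s v u)%:R <= 1 :> R.
Proof.
have [/existsP[s0 h0]|/existsPn h] := boolP [exists s : L.-tuple bool, V p s v u]; last first.
  by rewrite big1 // => s _; rewrite (negPf (h s)).
rewrite (bigD1 s0) //= h0 big1 ?addr0 // => s ns; case: (boolP (V p s v u)) => // hs.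
by case/eqP: ns; apply: val_inj; rewrite /= (valid_sfield hs) (valid_sfield h0).
Qed.

Lemma game_gap (f : bits * bits -> bits -> bits -> mem -> bits -> bits) (eta : R) : 0 < eta ->
  (forall p s v mA u i, ~~ V p s v u -> nth false (f p s v mA u) i = false) ->
  `|game f - game (fun _ _ _ _ => no_oracle)| <=
  eta + (1 + eta^-1) * (C * (T2%:R * (2 ^+ L)^-1 + \sum_(t < TB) chain_mass t)).
Proof.
move=> e0 hf; set ka := 1 + eta^-1.
have ka0 : 0 <= ka by rewrite addr_ge0 // invr_ge0 ltW.
have C0 : 0 <= C by rewrite mulr_ge0 ?sqr_ge0.
pose Psi s p v m psi := eta * sqnorm psi + ka * gap (V p s v) s v m psi.
have Psi0 s p v m psi : 0 <= Psi s p v m psi.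
  rewrite addr_ge0 // mulr_ge0 ?sqnorm_ge0 ?(ltW e0) // addr_ge0 //.
    rewrite mulr_ge0 // sumr_ge0 // => t _; apply: qmass_ge0 => u; exact: ler0n.
  apply: E_ge0 => m' psi'; rewrite mulr_ge0 ?sqnorm_ge0 // mulr_ge0 // sumr_ge0 // => t _.
  by apply: qmass_ge0 => u; apply: ler0n.
have inv s p : invariant (Psi s p).
  move=> v n0 chi psi psi' m m' wm ins sh; rewrite /Psi (gap_invariant _ _ _ wm ins sh).
  by rewrite (sqnorm_inserted ins); ring.
(* Outcome by outcome the two games differ by at most [Psi]; when a message is illegal both
   contribute 0. *)
apply: (@le_trans _ _ (\sum_(s : L.-tuple bool)
   E (exec no_oracle T1 (code A1) (load [:: one_pow lam] [::])) (qinit R) (fun mA psi =>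
        E (setup R S lam) (scale (Complex (Num.sqrt (2 ^+ L))^-1 0) psi)
          (fun p psi' => kg p (Psi s p) mA psi')))).
  rewrite -E_sum; apply: le_trans (E_norm_sub _ _ _ _) _.
  apply: exec_le (wf_load _ _) _ => mA psi wA _; case: ifP => _; last first.
    rewrite subrr normr0; apply: sumr_ge0 => s _; apply: E_ge0 => p psi'.
    by apply: E_ge0 => mK psi''.
  rewrite -sumrB; apply: le_trans (ler_norm_sum _ _ _) _; apply: ler_sum => s _.
  apply: le_trans (E_norm_sub _ _ _ _) _; rewrite !E_setup; apply: exec_le; first exact: wf_load.
  move=> m1 psi1 w1 e1; apply: le_trans (E_norm_sub _ _ _ _) _.
  apply: exec_le; first exact: wf_load.
  move=> mK psi2 wK eK; apply: tail_gap => //; last by move=> u i; apply: hf.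
  case: (eK) => le _ _; apply: wf_A2mem (ext_load_names eK) => //.
  by case: e1 => le1 _ _; apply: wf_widen le1 wA.
(* The runs are now those without oracle, where the first stage ignores [s]: Setup moves to the
   front, and the average over [s] can go innermost. *)
under eq_bigr => s _ do rewrite setup_commutes // sqmod_uniform.
rewrite -mulr_sumr -weight_sum -weight_scale.
have step p : (2 ^+ L)^-1 * \sum_(s : L.-tuple bool) first p (Psi s p) (qinit R) <=
   eta + ka * (C * (T2%:R * (2 ^+ L)^-1 + \sum_(t < TB) first p
     (A2run (fun v st => chain_prob R S n lam p.1 p.2 t (code B) st v)) (qinit R))).
  rewrite -first_run_sum -first_run_scale.
  pose Psi' v m psi := (eta + ka * (C * (T2%:R * (2 ^+ L)^-1))) * sqnorm psi +
    (ka * C) * \sum_(t < TB) A2run (fun v st => chain_prob R S n lam p.1 p.2 t (code B) st v) v m psi.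
  apply: (@le_trans _ _ (first p Psi' (qinit R))); last first.
    by rewrite first_run_add !first_run_scale first_run_sum first_run_norm sqnorm_qinit; lra.
  apply: first_run_le => v m psi wm.
  have avgE (F : bits -> R) : (2 ^+ L)^-1 * \sum_(s : L.-tuple bool) F s = avg F by [].
  rewrite (avgE (fun s => Psi s p v m psi)).
  pose Q s := \sum_(t < T2) qmass (fun u => (V p s v u)%:R) t (code A2) m psi.
  pose W s := A2run (fun _ st => C * \sum_(t < TB)
    bmass lam t (code B) st (fun u => (V p s v u)%:R) s) v m psi.
  have -> : avg (fun s => Psi s p v m psi) = eta * sqnorm psi + ka * (C * avg Q + avg W).
    by rewrite -avg_scale -avg_add -avg_scale -[X in _ = X + _](avg_cst n lam) -avg_add.
  (* As [psi] does not depend on [s], averaging over the key applies [sum_valid] to each query of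
     [A2]. *)
  have hQ : avg Q <= T2%:R * (2 ^+ L)^-1 * sqnorm psi.
    rewrite avg_sum; apply: (@le_trans _ _ (\sum_(t < T2) (2 ^+ L)^-1 * sqnorm psi)); last first.
      by rewrite sumr_const card_ord -[_ *+ T2]mulr_natl mulrA.
    apply: ler_sum => t _; rewrite /avg ler_wpM2l ?invr_ge0 ?exprn_ge0 //.
    rewrite -qmass_sum; apply: le_trans (qmass_le1 t (code A2) wm).
    by apply: qmass_le => u; apply: sum_valid.
  have hW : avg W = C * \sum_(t < TB)
      A2run (fun v st => chain_prob R S n lam p.1 p.2 t (code B) st v) v m psi.
    rewrite /avg /W /A2_run -!E_sum -!E_scale; apply: E_eq => m' psi'.
    pose Z s : R := \sum_(t < TB) bmass lam t (code B) (cl m' 0%N) (fun u => (V p s v u)%:R) s.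
    transitivity (C * (avg Z * sqnorm psi')); last by rewrite avg_sum mulr_suml.
    transitivity ((2 ^+ L)^-1 * \sum_(s : L.-tuple bool) (C * Z s * sqnorm psi')) => //.
    by rewrite -mulr_suml -mulr_sumr /avg; set c := C; set z := \sum_(s : L.-tuple bool) _; ring.
  have e : Psi' v m psi = eta * sqnorm psi + ka * (C * (T2%:R * (2 ^+ L)^-1 * sqnorm psi) +
      C * \sum_(t < TB) A2run (fun v st => chain_prob R S n lam p.1 p.2 t (code B) st v) v m psi).
    by rewrite /Psi'; set c := C; ring.
  by rewrite e hW lerD2l ler_wpM2l // lerD2r ler_wpM2l.
apply: le_trans (weight_le step) _.
rewrite weight_add weight_cst !weight_scale weight_add weight_cst weight_sum.
exact: lexx.
Qed.

(** Both encryptions are compared with the same rejecting game, hence the factor 2. *)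
Lemma ute_gap (eta : R) : 0 < eta ->
  `|Pr (ute_game (mac_chain R n S M) A1 A2 B lam false) -
    Pr (ute_game (mac_chain R n S M) A1 A2 B lam true)| <=
  2 * (eta + (1 + eta^-1) * (C * (T2%:R * (2 ^+ L)^-1 + \sum_(t < TB) chain_mass t))).
Proof.
move=> e0; rewrite !Pr_game.
have nv msg p s v u i : ~~ V p s v u ->
   nth false (mac_oracle R n S lam p.1 p.2 s msg (pad (vklen S lam) v) u) i = false.
  by move=> nv; rewrite mac_oracle_valid (negPf nv) nth_nseq if_same.
set g0 := game _; set g1 := game (fun p s v mA => mac_oracle _ _ _ _ _ _ _ (cl mA 1%N) _).
set D := eta + _.
have h0 : `|g0 - game (fun _ _ _ _ => no_oracle)| <= D.
  by apply: game_gap e0 _ => p s v mA u i; apply: nv.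
have h1 : `|g1 - game (fun _ _ _ _ => no_oracle)| <= D.
  by apply: game_gap e0 _ => p s v mA u i; apply: nv.
rewrite (mulr_natl _ 2) mulr2n; apply: le_trans (ler_distD (game (fun _ _ _ _ => no_oracle)) _ _) _.
by apply: lerD => //; rewrite distrC.
Qed.

End GameBound.

(** * From the chain mass to the advantage against the OSMAC *)

Section Advantage.
Context (R : realType) (n : nat -> nat) (S : osmac) (A1 A2 B : qpt) (lam N D t : nat).
Local Notation L := (n lam + lam)%N.
Local Notation T1 := (poly_clock (clock A1) lam).
Local Notation T2 := (poly_clock (clock A2) lam).
Local Notation TB := (poly_clock (clock B) lam).
Local Notation TK := (poly_clock (clock (KeyGen S)) lam).
Local Notation TS := (poly_clock (clock (Setup S)) lam).
Local Notation N0 := (sumn (input_shape n S lam)).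
Local Notation adversary := (reduction (code A1) (code (KeyGen S)) (code A2) (code B)).
Hypotheses (vk_fit : (2 * vklen S lam <= msglen S lam)%N).
Hypotheses (s_fit : (n lam + lam <= msglen S lam)%N).
Hypotheses (msgN : (msglen S lam <= N)%N) (N0N : (N0 <= N)%N) (tN : (t < N)%N).
Hypotheses (T1N : (T1 <= N)%N) (TKN : (lam + TK <= N)%N) (T2N : (lam + TS + T2 <= N)%N).
Hypotheses (BD : (prog_branch_size (code B) <= D)%N) (A1D : (prog_branch_size (code A1) <= D)%N).
Hypotheses (KD : (prog_branch_size (code (KeyGen S)) <= D)%N).
Hypotheses (A2D : (prog_branch_size (code A2) <= D)%N).

Definition fork_weight : R := weight S lam (fun p =>
  fork_value (win R S lam p.1 p.2) N lam t N0 L (code B) T1 TK T2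
    (code A1) (code (KeyGen S)) (code A2) p.1 (qinit R)).

Lemma two_sig_game_lower T :
  (reduction_time N t N0 D (code B) T1 TK T2 (code A1) (code (KeyGen S)) (code A2) <= T)%N ->
  rep_weight R N ^+ 42 * fork_weight <= Pr (two_sig_game R S lam adversary T).
Proof.
move=> TT; rewrite PrE /two_sig_game E_bind /fork_weight /weight -E_scale !E_setup.
apply: exec_size => m psi sz; rewrite E_bind.
(* [P] may refer to the verification key of Setup, since it only judges the outputs; the reduction
   is started on the public parameters alone. *)
pose P mB : R := (win R S lam (cl m 0%N) (cl m 1%N) (cl mB 0%N) (cl mB 1%N) (cl mB 2%N)
  (cl mB 3%N) (cl mB 4%N))%:R.
have P0 mB : 0 <= P mB by exact: ler0n.
have PN : (size (cl m 0%N) + T2 <= N)%N.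
  apply: leq_trans T2N; rewrite leq_add2r; apply: leq_trans (sz 0%N) _.
  by rewrite /= /one_pow size_nseq.
have lamN : (lam <= N)%N by apply: leq_trans TKN; apply: leq_addr.
have LN : (L <= N)%N by apply: leq_trans msgN.
have Pw mB : win R S lam (cl m 0%N) (cl m 1%N) (cl mB 0%N) (cl mB 1%N) (cl mB 2%N)
    (cl mB 3%N) (cl mB 4%N) -> P mB = 1 by rewrite /P => ->.
rewrite mulrA; apply: le_trans (LB_reduction P0 Pw lamN tN N0N LN BD T1N TKN PN A1D KD A2D psi) _.
apply: le_trans (Vh_mono P0 _ _ _ TT) _; apply: le_trans (Vh_exec P0 _ _ _ _) _.
apply: E_le => mB psi'; rewrite E_ret /P /win /=.
by case: ifP => _; rewrite ?mul1r ?mul0r.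
Qed.

Lemma fork_weight_lower (ka : R) :
  (2 ^+ n lam)^-1 * (2 * ka * chain_mass R n S A1 A2 B lam t - ka ^+ 2) - (2 ^+ L)^-1 <= fork_weight.
Proof.
set a := (2 ^+ n lam)^-1 * (2 * ka); set b := - ((2 ^+ n lam)^-1 * ka ^+ 2) - (2 ^+ L)^-1.
have -> : (2 ^+ n lam)^-1 * (2 * ka * chain_mass R n S A1 A2 B lam t - ka ^+ 2) - (2 ^+ L)^-1 =
    a * chain_mass R n S A1 A2 B lam t + b by rewrite /a /b; ring.
rewrite -(weight_cst S lam b) /chain_mass -weight_scale -weight_add; apply: weight_le => p.
rewrite -{1}[b]mulr1 -(sqnorm_qinit R) -(@first_run_norm R S A1 lam p.1).
rewrite -!first_run_scale -first_run_add; apply: first_run_le => v m psi wm.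
rewrite -(exec_norm no_oracle T2 (code A2) wm) /A2_run -!E_scale -E_add.
apply: E_le => m' psi'; rewrite mulrA -mulrDl ler_wpM2r ?sqnorm_ge0 //.
apply: le_trans (fork_prob_lower p.1 p.2 vk_fit s_fit msgN t (code B) (cl m' 0%N) v ka).
by rewrite le_eqVlt /a /b; apply/orP; left; apply/eqP; ring.
Qed.

(** Solve the tangent inequality for the mass. The [n] extra bits of the key absorb the factor
    [2 ^ n] of Cauchy-Schwarz, which leaves [2 ^ - lam] for equal keys. *)
Lemma chain_mass_le (ka delta : R) T : 0 < ka ->
  (reduction_time N t N0 D (code B) T1 TK T2 (code A1) (code (KeyGen S)) (code A2) <= T)%N ->
  Pr (two_sig_game R S lam adversary T) <= delta ->
  chain_mass R n S A1 A2 B lam t <= ka / 2 +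
    ((8 * N.+1%:R ^+ 2) ^+ 42 * (2 ^+ n lam * delta) + (2 ^+ lam)^-1) / (2 * ka).
Proof.
move=> ka0 TT adv; have := two_sig_game_lower TT; have := fork_weight_lower ka.
set X := chain_mass _ _ _ _ _ _ _ _; set F := fork_weight.
have W0 : 0 < (8 * N.+1%:R ^+ 2) ^+ 42 :> R by rewrite exprn_gt0 // mulr_gt0 // exprn_gt0 // ltr0n.
rewrite /rep_weight exprVn; set W := _ ^+ 42 in W0 *; move=> low up.
have n0 : 0 < 2 ^+ n lam :> R by rewrite exprn_gt0.
have l0 : 0 < 2 ^+ lam :> R by rewrite exprn_gt0.
have FW : F <= W * delta by rewrite -ler_pdivrMl //; apply: le_trans up adv.
have e : (2 ^+ lam)^-1 = 2 ^+ n lam * (2 ^+ L)^-1 :> R.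
  by rewrite exprD invfM mulrA divff ?mul1r // gt_eqF.
have h : (2 ^+ n lam)^-1 * (2 * ka * X - ka ^+ 2) <= W * delta + (2 ^+ L)^-1.
  by rewrite -lerBlDr; apply: le_trans low FW.
rewrite ler_pdivrMl // mulrDr -e mulrCA in h.
have -> : ka / 2 = ka ^+ 2 / (2 * ka) by field; rewrite gt_eqF.
by rewrite -mulrDl ler_pdivlMr ?mulr_gt0 // mulrC addrC -lerBlDr.
Qed.

End Advantage.

(** * Asymptotics *)

(** A pure power composes more easily than [poly_clock]; absorbing additive constants requires
    [lam > 1]. *)
Definition power_bounded (g : nat -> nat) : Prop :=
  exists e, forall lam, (1 < lam)%N -> (g lam <= lam ^ e)%N.

Lemma power_bounded_le g h : (forall lam, (g lam <= h lam)%N) -> power_bounded h -> power_bounded g.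
Proof. by move=> le [e he]; exists e => lam l1; apply: leq_trans (le _) (he _ l1). Qed.

Lemma power_bounded_cst k : power_bounded (fun=> k).
Proof.
exists k => lam l1; apply: leq_trans (ltnW (ltn_expl k (isT : (1 < 2)%N))) _.
by case: k => // k; rewrite leq_exp2r.
Qed.

Lemma power_bounded_id : power_bounded (fun lam => lam).
Proof. by exists 1%N => lam _; rewrite expn1. Qed.

Lemma power_bounded_mul g h : power_bounded g -> power_bounded h ->
  power_bounded (fun lam => g lam * h lam)%N.
Proof. by move=> [a ha] [b hb]; exists (a + b)%N => lam l1; rewrite expnD leq_mul ?ha ?hb. Qed.

Lemma power_bounded_add g h : power_bounded g -> power_bounded h ->
  power_bounded (fun lam => g lam + h lam)%N.
Proof.
move=> [a ha] [b hb]; exists (a + b).+1 => lam l1; have l0 := ltnW l1.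
have : (g lam <= lam ^ (a + b))%N by apply: leq_trans (ha _ l1) _; rewrite leq_exp2l // leq_addr.
have : (h lam <= lam ^ (a + b))%N by apply: leq_trans (hb _ l1) _; rewrite leq_exp2l // leq_addl.
by rewrite expnS; nia.
Qed.

Lemma power_bounded_exp g k : power_bounded g -> power_bounded (fun lam => g lam ^ k)%N.
Proof.
move=> [a ha]; exists (a * k)%N => lam l1; rewrite expnM.
by case: k => // k; rewrite leq_exp2r // ha.
Qed.

Lemma power_bounded_clock c : power_bounded (poly_clock c).
Proof.
by apply: power_bounded_add (power_bounded_cst c); apply: power_bounded_exp power_bounded_id.
Qed.

Lemma poly_power_bounded g : poly_bounded g -> power_bounded g.
Proof. by move=> [c hc]; apply: power_bounded_le hc (power_bounded_clock c). Qed.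

(** With [m] the quotient of [lam] by [2 * j], one has [lam <= 2 * j * 2 ^ m <= 2 ^ (2 * m)], the
    latter because [2 * j <= m]; then take the power [j]. *)
Lemma exp2_dominates j lam : (4 * j ^ 2 <= lam)%N -> (lam ^ j <= 2 ^ lam)%N.
Proof.
case: j => [|i]; first by rewrite expn0 expn_gt0.
set j := i.+1; set d := (2 * j)%N => jl; set m := (lam %/ d)%N.
have dm : (d <= m)%N by rewrite leq_divRL // /d; apply: leq_trans jl; rewrite expnS expn1; nia.
have lm : (lam <= d * 2 ^ m)%N.
  have h1 := ltn_ceil lam (isT : (0 < d)%N); have h2 := ltn_expl m (isT : (1 < 2)%N).
  by rewrite -/m mulnC in h1; apply: leq_trans (ltnW h1) _; rewrite leq_mul2l h2.
have dl : (d * 2 ^ m <= 2 ^ (2 * m))%N.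
  rewrite mul2n -addnn expnD leq_mul2r expn_eq0 /=; apply: leq_trans dm _.
  exact: ltnW (ltn_expl m (isT : (1 < 2)%N)).
apply: (@leq_trans ((2 ^ (2 * m)) ^ j)); first by rewrite leq_exp2r // (leq_trans lm dl).
by rewrite -expnM leq_exp2l //; have := leq_trunc_div lam d; rewrite -/m /d; nia.
Qed.

(** The constants add up 42 guesses of [60 * N + 20] steps, two measured runs and three clocked
    ones. *)
Lemma reduction_time_le N t N0 D cB T1 TK T2 cA1 cK cA2 :
  (t < N)%N -> (N0 <= N)%N -> (T1 <= N)%N -> (TK <= N)%N -> (T2 <= N)%N ->
  (reduction_time N t N0 D cB T1 TK T2 cA1 cK cA2 <=
   (2564 + 10 * D) * N + (860 + 4 * size cB + 2 * (size cA1 + size cK + size cA2)))%N.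
Proof.
move=> tN N0N T1N TKN T2N.
have h1 := leq_mul tN (leqnn D); have h2 := leq_mul T1N (leqnn D).
have h3 := leq_mul TKN (leqnn D); have h4 := leq_mul T2N (leqnn D).
rewrite /reduction_time /post_time /run_time /measure_time /tr_time /rep_time mulnDl -mulnA.
by rewrite (mulnC D N); lia.
Qed.

Lemma sumn_input_shape n S lam :
  (sumn (input_shape n S lam) <= (n lam + lam) + n lam + (n lam).+1 * (3 * vklen S lam + siglen S lam))%N.
Proof.
set k := (3 * vklen S lam + siglen S lam)%N.
have st i : (sumn (st_shape n S lam i) <= k)%N.
  by rewrite /st_shape !sumn_cat !sumn_nseq /= /k; case: (i != 0%N); case: ifP => _; lia.
have le r : (sumn [seq sumn (st_shape n S lam i) | i <- r] <= size r * k)%N.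
  by elim: r => //= i r IH; rewrite mulSn leq_add.
by have := le (iota 0 (n lam).+1); rewrite size_iota -(leq_add2l (n lam + lam + n lam)) -addnA.
Qed.

(** With slack [d / 4] the factor [1 + (d / 4)^-1] is at most [5 / d], and the 20 makes what it
    multiplies at most [d ^+ 2 / 20]; both terms are then at most [d / 4]. *)
Lemma lt_negl_arith (R : realType) (d E C T2 sum eps : R) :
  0 < d -> d <= 1 -> 1 <= E -> 0 <= C -> C <= E -> 0 <= T2 -> T2 <= E -> 0 <= eps ->
  eps <= d ^+ 2 / (20 * E ^+ 2) / 4 -> sum <= E * (3 / 4 * (d ^+ 2 / (20 * E ^+ 2))) ->
  2 * (d / 4 + (1 + (d / 4)^-1) * (C * (T2 * eps + sum))) <= d.
Proof.
move=> d0 d1 E1 C0 CE T0 TE e0 eb sb; have E0 : 0 < E by apply: lt_le_trans E1.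
set k := d ^+ 2 / (20 * E ^+ 2) in eb sb *.
have h1 : T2 * eps + sum <= E * k.
  have : T2 * eps <= E * (k / 4) by apply: ler_pM.
  by move: sb; lra.
have k0 : 0 <= k by rewrite divr_ge0 ?mulr_ge0 ?exprn_ge0 // ltW.
have h2 : C * (T2 * eps + sum) <= d ^+ 2 / 20.
  have -> : d ^+ 2 / 20 = E * (E * k) by rewrite /k; field; rewrite gt_eqF.
  apply: le_trans (ler_wpM2l C0 h1) _; apply: ler_wpM2r CE.
  by rewrite mulr_ge0 // ltW.
have h3 : 1 + (d / 4)^-1 <= 5 / d.
  have -> : (d / 4)^-1 = 4 / d by field; rewrite gt_eqF.
  have : 1 <= d^-1 by rewrite -[1]invr1 lef_pV2 ?posrE.
  by lra.
have h4 : (1 + (d / 4)^-1) * (C * (T2 * eps + sum)) <= d / 4.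
  have p : 0 <= 1 + (d / 4)^-1 by rewrite addr_ge0 // invr_ge0 divr_ge0 // ltW.
  apply: le_trans (ler_wpM2l p h2) _.
  have q : 0 <= d ^+ 2 / 20 by rewrite divr_ge0 ?exprn_ge0 // ltW.
  apply: le_trans (ler_wpM2r q h3) _; rewrite le_eqVlt; apply/orP; left; apply/eqP.
  by field; rewrite gt_eqF.
by move: h4; lra.
Qed.

(** At [ka = k] the tangent costs [k / 2] and the errors [k / 4]; the last quarter is kept for the
    queries of the first stage. *)
Lemma mass_arith (R : realType) (k E W a b X : R) : 0 < k -> 0 < E -> 0 <= a -> W <= E ->
  a <= k ^+ 2 / (4 * E) -> b <= k ^+ 2 / 4 ->
  X <= k / 2 + (W * a + b) / (2 * k) -> X <= 3 / 4 * k.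
Proof.
move=> k0 E0 a0 WE ha hb hX; apply: le_trans hX _.
have h : W * a + b <= k ^+ 2 / 2.
  have : W * a <= E * (k ^+ 2 / (4 * E)) by apply: le_trans (ler_wpM2r a0 WE) _; rewrite ler_pM2l.
  have -> : E * (k ^+ 2 / (4 * E)) = k ^+ 2 / 4 by field; rewrite gt_eqF.
  by move: hb; lra.
have : (W * a + b) / (2 * k) <= k / 4.
  rewrite ler_pdivrMr ?mulr_gt0 //; apply: le_trans h _.
  by rewrite le_eqVlt; apply/orP; left; apply/eqP; field.
by lra.
Qed.

Local Open Scope classical_set_scope.

Lemma Omega_log_exp (R : realType) (n : nat -> nat) :
  (fun lam => (n lam)%:R : R^o) \is 'Omega_\oo (fun lam => ln lam%:R : R^o) ->
  exists K, \forall lam \near \oo, (lam <= 2 ^ (K * n lam))%N.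
Proof.
rewrite qualifE /= => /asboolP [k k0 hk].
(* The hypothesis bounds [lam] by the [n]-th power of [expR (k^-1)], and [2 ^ K.+1] exceeds this
   base. *)
pose K := Num.trunc (expR (k^-1)); exists K.+1.
near=> lam; have l0 : (0 < lam)%N by near: lam; exists 1%N.
have h : k * `|ln lam%:R : R^o| <= `|(n lam)%:R : R^o| by near: lam.
have lp : 0 < lam%:R :> R by rewrite ltr0n.
have : ln lam%:R <= k^-1 * (n lam)%:R :> R.
  rewrite mulrC ler_pdivlMr // mulrC; apply: le_trans (_ : _ <= k * `|ln lam%:R|) _.
    by rewrite ler_wpM2l ?ler_norm // ltW.
  by apply: le_trans h _; rewrite normr_nat.
rewrite -ler_expR lnK ?posrE // => h1.
have h2 : expR (k^-1) <= (2 ^ K.+1)%:R :> R.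
  apply: le_trans (ltW (truncnS_gt _)) _; rewrite ler_nat.
  exact: ltnW (ltn_expl _ _).
rewrite -(ler_nat R) expnM natrX; apply: le_trans h1 _.
by rewrite expRM_natr; apply: lerXn2r; rewrite ?nnegrE ?expR_ge0.
Unshelve. all: by end_near.
Qed.

(** The left side is at most [2 ^ ((K * j + 1) * n)], and [n] exceeds [K * j] for large [lam], since
    [n <= K * j] would bound [lam] by a constant. *)
Lemma exp2_square_dominates (n : nat -> nat) K j :
  (\forall lam \near \oo, (lam <= 2 ^ (K * n lam))%N) ->
  \forall lam \near \oo, (lam ^ j * 2 ^ n lam <= 2 ^ (n lam ^ 2))%N.
Proof.
move=> h; near=> lam.
have hl : (lam <= 2 ^ (K * n lam))%N by near: lam.
have big : (2 ^ (K * (K * j)) < lam)%N by near: lam; exists (2 ^ (K * (K * j))).+1.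
have nK : (K * j < n lam)%N.
  rewrite ltnNge; apply/negP => le; have := leq_trans big hl.
  by rewrite ltn_exp2l // ltnNge leq_mul2l le orbT.
apply: (@leq_trans (2 ^ (K * n lam * j) * 2 ^ n lam)).
  by rewrite leq_mul2r expnM; case: (j) => [|i]; rewrite ?expn0 ?leqnn ?orbT // leq_exp2r // hl orbT.
by rewrite -expnD leq_exp2l // expnS expn1; nia.
Unshelve. all: by end_near.
Qed.

Lemma ler_inv_nat (R : realType) (a b c : nat) : (0 < a)%N -> (a * b <= c)%N -> (0 < c)%N ->
  b%:R / c%:R <= a%:R^-1 :> R.
Proof.
move=> a0 h c0; rewrite ler_pdivrMr ?ltr0n // mulrC ler_pdivlMr ?ltr0n //.
by rewrite -natrM ler_nat mulnC.
Qed.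

(** The exponent collects [4 * c] and [5 * e] from the powers of [x ^+ c] and [x ^+ e], and 12 for
    the constant [20 ^+ 2 * 4], as [20 <= 2 ^ 5] and [4 = 2 ^ 2]. *)
Lemma inv_power_small (R : realType) (x : R) c e : 2 <= x ->
  (x ^+ (4 * c + 5 * e + 12))^-1 <=
  ((x ^+ c)^-1 ^+ 2 / (20 * (x ^+ e) ^+ 2)) ^+ 2 / (4 * x ^+ e).
Proof.
move=> x2; have x0 : 0 < x by apply: lt_le_trans x2.
have -> : ((x ^+ c)^-1 ^+ 2 / (20 * (x ^+ e) ^+ 2)) ^+ 2 / (4 * x ^+ e) =
    (20 ^+ 2 * 4 * x ^+ (4 * c + 5 * e))^-1.
  rewrite exprD (mulnC 4 c) (mulnC 5 e) !exprM.
  have := gt_eqF (exprn_gt0 c x0); have := gt_eqF (exprn_gt0 e x0).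
  by move: (x ^+ c) (x ^+ e) => u v u0 v0; field; rewrite u0 v0.
have xp k : 0 < x ^+ k by exact: exprn_gt0.
have pow2 k : (2 ^ k)%:R <= x ^+ k.
  by rewrite natrX; apply: lerXn2r; rewrite ?nnegrE // ltW.
have le20 : 20 <= x ^+ 5 by apply: le_trans (pow2 5%N); rewrite ler_nat.
have le12 : 20 ^+ 2 * 4 <= x ^+ 12.
  rewrite (exprD x 10 2) (exprM x 5 2); apply: ler_pM => //; last exact: pow2 2%N.
  by apply: lerXn2r; rewrite ?nnegrE // ltW.
by rewrite exprD lef_pV2 ?posrE ?mulr_gt0 // [leRHS]mulrC ler_pM2r //.
Qed.

Lemma mac_chain_negl (R : realType) (n : nat -> nat) (S : osmac) (M : nat -> pred bits)
    (A1 A2 B : qpt) (K : nat) : is_osmac R S ->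
  (forall lam, (2 * vklen S lam <= msglen S lam)%N) ->
  (forall lam, (n lam + lam <= msglen S lam)%N) ->
  (\forall lam \near \oo, (lam <= 2 ^ (K * n lam))%N) ->
  two_sig_secure S (fun lam => (2 ^ n lam)%N) (fun lam => (2 ^+ (n lam ^ 2))^-1 : R) ->
  negl (fun lam => `|Pr (ute_game (mac_chain R n S M) A1 A2 B lam false) -
                     Pr (ute_game (mac_chain R n S M) A1 A2 B lam true)|).
Proof.
move=> [/poly_power_bounded msgP /poly_power_bounded vkP /poly_power_bounded sigP _ _].
move=> vk_fit s_fit hK secure c.
pose cl A lam := poly_clock (clock A) lam; pose N0 lam := sumn (input_shape n S lam).
(* A common bound for every length, clock and position that the reduction guesses. *)
pose N lam := (lam + cl (Setup S) lam + cl A1 lam + cl A2 lam + cl B lam + cl (KeyGen S) lam +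
  msglen S lam + N0 lam).+1.
pose D := (prog_branch_size (code A1) + prog_branch_size (code A2) +
  prog_branch_size (code B) + prog_branch_size (code (KeyGen S)))%N.
pose a := (860 + 4 * size (code B) +
  2 * (size (code A1) + size (code (KeyGen S)) + size (code A2)))%N.
have NE lam : [/\ (msglen S lam <= N lam)%N, (N0 lam <= N lam)%N, (cl A1 lam <= N lam)%N,
    (lam + cl (KeyGen S) lam <= N lam)%N & (lam + cl (Setup S) lam + cl A2 lam <= N lam)%N /\
    (cl B lam <= N lam)%N].
  rewrite /N; move: (cl (Setup S) lam) (cl A1 lam) (cl A2 lam) (cl B lam) (cl (KeyGen S) lam).
  by move: (msglen S lam) (N0 lam) => *; split; [lia..|split; lia].
have DE : [/\ (prog_branch_size (code B) <= D)%N, (prog_branch_size (code A1) <= D)%N,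
    (prog_branch_size (code (KeyGen S)) <= D)%N & (prog_branch_size (code A2) <= D)%N].
  by rewrite /D; move: (prog_branch_size _) (prog_branch_size _) (prog_branch_size _)
    (prog_branch_size _) => *; split; lia.
have clP A : power_bounded (cl A) by exact: power_bounded_clock.
have nP : power_bounded n.
  by apply: power_bounded_le msgP => lam; apply: leq_trans (leq_addr _ _) (s_fit lam).
have N0P : power_bounded N0.
  apply: power_bounded_le (sumn_input_shape n S) _.
  apply: power_bounded_add; first by do !apply: power_bounded_add => //; apply: power_bounded_id.
  apply: power_bounded_mul.
    apply: (@power_bounded_le _ (fun lam => n lam + 1)%N) => [lam|]; first by rewrite addn1.
    exact: power_bounded_add (power_bounded_cst 1).
  by apply: power_bounded_add sigP; apply: power_bounded_mul vkP; apply: power_bounded_cst.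
have NP : power_bounded N.
  apply: (@power_bounded_le _ (fun lam => lam + cl (Setup S) lam + cl A1 lam + cl A2 lam +
    cl B lam + cl (KeyGen S) lam + msglen S lam + N0 lam + 1)%N) => [lam|]; first by rewrite addn1.
  by do !apply: power_bounded_add => //; [exact: power_bounded_id | exact: power_bounded_cst].
pose C lam := (4 * (1 + cl B lam + cl A2 lam) ^ 2)%N.
pose W lam := ((8 * (N lam + 1) ^ 2) ^ 42)%N.
(* One exponent serves all the polynomial factors, so that a single [E] enters the arithmetic. *)
have [e he] : power_bounded (fun lam => C lam + W lam + cl A2 lam + cl B lam)%N.
  do !apply: power_bounded_add => //.
    apply: power_bounded_mul; first exact: power_bounded_cst.
    by apply: power_bounded_exp; do !apply: power_bounded_add => //; exact: power_bounded_cst.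
  apply: power_bounded_exp; apply: power_bounded_mul; first exact: power_bounded_cst.
  by apply: power_bounded_exp; apply: power_bounded_add => //; exact: power_bounded_cst.
have [e' he'] : power_bounded (fun lam => (2564 + 10 * D) * N lam + a)%N.
  by apply: power_bounded_add (power_bounded_cst a); apply: power_bounded_mul NP; exact: power_bounded_cst.
have sec := secure (reduction (code A1) (code (KeyGen S)) (code A2) (code B)) e'.
pose j := (4 * c + 5 * e + 12)%N; have dom := exp2_square_dominates j hK.
near=> lam; rewrite normr_id.
have l1 : (1 < lam)%N by near: lam; exists 2%N.
have lj : (lam ^ j <= 2 ^ lam)%N.
  by apply: exp2_dominates; near: lam; exists (4 * j ^ 2)%N.
have adv : Pr (two_sig_game R S lam (reduction (code A1) (code (KeyGen S)) (code A2) (code B))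
    (2 ^ n lam * poly_clock e' lam)) <= (2 ^+ (n lam ^ 2))^-1 by near: lam.
have nj : (lam ^ j * 2 ^ n lam <= 2 ^ (n lam ^ 2))%N by near: lam.
have {}he := he _ l1; have {}he' := he' _ l1.
have l0 : (0 < lam)%N := ltnW l1.
have lp k : (0 < lam ^ k)%N by rewrite expn_gt0 l0.
have two k : (0 < 2 ^ k)%N by rewrite expn_gt0.
pose x : R := lam%:R; have x2 : 2 <= x by rewrite (ler_nat _ 2).
have x0 : 0 < x by apply: lt_le_trans x2.
pose d := (x ^+ c)^-1; pose E := x ^+ e; pose k := d ^+ 2 / (20 * E ^+ 2).
have d0 : 0 < d by rewrite invr_gt0 exprn_gt0.
have x1 : 1 <= x by rewrite (ler_nat _ 1).
have d1 : d <= 1 by rewrite invf_le1 ?exprn_gt0 // exprn_ege1.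
have E1 : 1 <= E by rewrite exprn_ege1.
have E0 : 0 < E by apply: lt_le_trans E1.
have k0 : 0 < k by rewrite divr_gt0 ?mulr_gt0 ?exprn_gt0.
have k1 : k <= 1.
  rewrite ler_pdivrMr ?mulr_gt0 ?exprn_gt0 // mul1r; apply: (@le_trans _ _ 1).
    by rewrite exprn_ile1 // ltW.
  by apply: (@le_trans _ _ (20 * 1)); rewrite ?ler_pM2l ?exprn_ege1 // mulr1 (ler_nat _ 1).
have toE m : (m <= lam ^ e)%N -> m%:R <= E :> R by rewrite -(ler_nat R) natrX.
have small : (x ^+ j)^-1 <= k ^+ 2 / (4 * E) by exact: inv_power_small.
have small' : (x ^+ j)^-1 <= k ^+ 2 / 4.
  apply: le_trans small _; apply: ler_wpM2l; first by rewrite exprn_ge0 // ltW.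
  by rewrite lef_pV2 ?posrE ?mulr_gt0 // ler_peMr.
have inv2 m : (2 ^+ m)^-1 = 1%:R / (2 ^ m)%:R :> R by rewrite natrX div1r.
have xj : (x ^+ j)^-1 = (lam ^ j)%:R^-1 by rewrite natrX.
have hlam : (2 ^+ lam)^-1 <= (x ^+ j)^-1.
  by rewrite inv2 xj; apply: ler_inv_nat => //; rewrite muln1.
have hn : 2 ^+ n lam * (2 ^+ (n lam ^ 2))^-1 <= (x ^+ j)^-1.
  by rewrite xj -!natrX; apply: ler_inv_nat.
have mass t : (t < cl B lam)%N -> chain_mass R n S A1 A2 B lam t <= 3 / 4 * k.
  move=> tB; case: (NE lam) DE => i1 i2 i3 i4 [i5 i6] [b1 b2 b3 b4].
  have tN : (t < N lam)%N by apply: leq_trans tB i6.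
  have time : (reduction_time (N lam) t (N0 lam) D (code B) (cl A1 lam) (cl (KeyGen S) lam)
      (cl A2 lam) (code A1) (code (KeyGen S)) (code A2) <= 2 ^ n lam * poly_clock e' lam)%N.
    apply: (@leq_trans (lam ^ e')).
      apply: leq_trans he'; apply: reduction_time_le => //.
        exact: leq_trans (leq_addl _ _) i4.
      exact: leq_trans (leq_addl _ _) i5.
    by apply: leq_trans (leq_pmull _ (two _)); apply: leq_addr.
  have X := chain_mass_le (vk_fit lam) (s_fit lam) i1 i2 tN i3 i4 i5 b1 b2 b3 b4 k0 time adv.
  apply: (mass_arith k0 E0 _ _ (le_trans hn small) (le_trans hlam small') X).
    by rewrite mulr_ge0 // invr_ge0 exprn_ge0.
  rewrite -natrX -natrM -natrX -[(N lam).+1]addn1; apply: toE.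
  by apply: leq_trans he; rewrite -!addnA addnCA leq_addr.
have -> : (lam%:R ^+ c)^-1 = d by [].
apply: le_trans (ute_gap n S M A1 A2 B lam (eta := d / 4) _) _; first by rewrite divr_gt0.
apply: (@lt_negl_arith _ d E) => //; rewrite ?invr_ge0 ?exprn_ge0 ?mulr_ge0 ?exprn_ge0 //.
- have -> : 4 * (1 + (poly_clock (clock B) lam)%:R + (poly_clock (clock A2) lam)%:R) ^+ 2 =
      (C lam)%:R :> R by rewrite /C natrM natrX !natrD.
  by apply: toE; apply: leq_trans he; rewrite -!addnA leq_addr.
- by apply: toE; apply: leq_trans he; rewrite addnAC leq_addl.
- apply: (@le_trans _ _ (2 ^+ lam)^-1).
    rewrite lef_pV2 ?posrE ?exprn_gt0 // ler_eXn2l ?leq_addl //.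
    by rewrite ltr1n.
  apply: le_trans (le_trans hlam small') _; rewrite ler_wpM2r // -[leRHS]mulr1 ler_pM2l //.
- apply: (@le_trans _ _ (\sum_(t < cl B lam) (3 / 4 * k))).
    by apply: ler_sum => t _; apply: mass.
  rewrite sumr_const card_ord -[_ *+ _]mulr_natl; apply: ler_wpM2r; first by rewrite mulr_ge0 // ltW.
  by apply: toE; apply: leq_trans he; apply: leq_addl.
Unshelve. all: by end_near.
Qed.

Theorem theorem4p6 (R : realType) (n : nat -> nat) (S : osmac)
    (mu : nat -> nat) (M : nat -> pred bits)
    (M_len : forall lam m, M lam m -> size m = mu lam)
    (S_osmac : is_osmac R S)
    (vk_fit : forall lam, (2 * vklen S lam <= msglen S lam)%N)
    (s_fit : forall lam, (n lam + lam <= msglen S lam)%N)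
    (n_Omega : (fun lam => (n lam)%:R : R^o)
                 \is 'Omega_\oo (fun lam => ln lam%:R : R^o))
    (n_o : (fun lam => (n lam)%:R : R^o) =o_\oo (fun lam => lam%:R : R^o))
    (S_secure : two_sig_secure S (fun lam => (2 ^ n lam)%N)
                  (fun lam => (2 ^+ (n lam ^ 2))^-1 : R)) :
  one_time_ind (mac_chain R n S M).
Proof.
have [K hK] := Omega_log_exp n_Omega.
by move=> A1 A2 B; apply: mac_chain_negl S_osmac vk_fit s_fit hK S_secure.
Qed.
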